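(* For the partially observed system $x_{t+1}=Ax_t+B_ww_t$, $y_t=Cx_t+D_vv_t$ and the direct multi-step least-squares predictor $\hat G^{MS}_N$ of horizon $H\ge1$ defined in the context, the irreducible error $B(\hat G_N^{MS})=\lim_{N\to\infty}\mathbf{E}\,L(\hat G_N^{MS})$ is given by $$B(\hat G_N^{MS})=\operatorname{tr}\left(\Phi\big(\Sigma_{\hat x}-\Sigma_{\hat x}C^\top\Sigma_y^{-1}C\Sigma_{\hat x}\big)\Phi^\top\right)+\|\Gamma_e\|_F^2.$$
   Context: System: $x_{t+1}=Ax_t+B_ww_t$, $y_t=Cx_t+D_vv_t$, with $x_t\in\mathbb{R}^{d_x}$, $y_t\in\mathbb{R}^{d_y}$, $x_0=0$, and $w_t\sim\mathcal N(0,I_{d_x})$, $v_t\sim\mathcal N(0,I_{d_y})$ i.i.d. and mutually independent (there are no inputs). Standing assumptions: $\rho(A)<1$ (spectral radius), $(A,C)$ observable, $(A,B_w)$ controllable, $D_vD_v^\top\succ0$. Dataset: $y_1,\dots,y_N$ from one rollout. For a sequence $a$, $a_{s:r}$ denotes the stacked vector of $a_s,\dots,a_r$. Multi-step predictor: $\hat G^{MS}_N=\arg\min_{G\in\mathbb{R}^{Hd_y\times d_y}}\sum_{t=1}^{N-H}\|y_{t+1:t+H}-Gy_t\|^2$ ($N$ large enough that the minimizer is almost surely unique). Loss: for a matrix $G\in\mathbb{R}^{Hd_y\times d_y}$, $L(G)=\lim_{T\to\infty}\mathbf{E}\frac1T\sum_{t=0}^T\|y_{t+1:t+H}-Gy_t\|^2$,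 the expectation being over an evaluation rollout of the system independent of the dataset; equivalently, the expectation under the stationary distribution of the system. In $\mathbf{E}\,L(\hat G_N)$ the outer expectation is over the dataset. Innovations form: let $S$ be the stabilizing solution of the Riccati equation $S=ASA^\top-ASC^\top(CSC^\top+D_vD_v^\top)^{-1}CSA^\top+B_wB_w^\top$, let $K=ASC^\top(CSC^\top+D_vD_v^\top)^{-1}$ be the Kalman gain, and $D_e=(CSC^\top+D_vD_v^\top)^{1/2}$. In stationarity, $\hat x_{t+1}=A\hat x_t+KD_ee_t$, $y_t=C\hat x_t+D_ee_t$, with $e_t$ i.i.d. standard normal. $\Sigma_{\hat x}$ is the stationary covariance of $\hat x_t$ (so $\Sigma_{\hat x}=A\Sigma_{\hat x}A^\top+KD_eD_e^\top K^\top$) and $\Sigma_y$ is the stationary covariance of $y_t$ (so $\Sigma_y=C\Sigma_{\hat x}C^\top+D_eD_e^\top$). $\Phi\in\mathbb{R}^{Hd_y\times d_x}$ has $i$-th block row $CA^{i-1}(A-KC)$, $1\le i\le H$. $\Gamma_e\in\mathbb{R}^{Hd_y\times Hd_y}$ is block lower triangular with diagonal blocks $D_e$ and $(i,j)$ block $CA^{i-j-1}KD_e$ for $i>j$. $\|\cdot\|_F$ is the Frobenius norm. *)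

(* Defs.v *)
From HB Require Import structures.
From mathcomp Require Import all_boot all_order all_algebra.
From mathcomp Require Import all_classical all_reals all_analysis.
From mathcomp Require Import complex.

Set Implicit Arguments.
Unset Strict Implicit.
Unset Printing Implicit Defensive.

Import Order.TTheory GRing.Theory Num.Theory.
Import numFieldNormedType.Exports.

Local Open Scope classical_set_scope.
Local Open Scope ring_scope.

Section LinearAlgebra.
Context {R : realType}.

(* The norm `|_| of MathComp-Analysis on matrices is the max norm.  On a column
   vector, fnorm is the Euclidean norm. *)
Definition fnorm m n (M : 'M[R]_(m, n)) : R :=
  Num.sqrt (\sum_i \sum_j M i j ^+ 2).

Definition psdmx n (M : 'M[R]_n) : Prop :=
  M^T = M /\ forall u : 'cV[R]_n, 0 <= (u^T *m M *m u) 0 0.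

Definition pdmx n (M : 'M[R]_n) : Prop :=
  M^T = M /\ forall u : 'cV[R]_n, u != 0 -> 0 < (u^T *m M *m u) 0 0.

(* D is the principal square root of M. *)
Definition is_sqrtmx n (M D : 'M[R]_n) : Prop := psdmx D /\ D *m D = M.

(* The eigenvalues are the complex ones; Normc.normc is the modulus, with
   values in R.  The supremum is 0 when n = 0. *)
Definition spectral_radius n (A : 'M[R]_n) : R :=
  sup [set r | exists2 z : R[i],
         eigenvalue (map_mx (real_complex R) A) z & r = ComplexField.Normc.normc z].

Definition observable dx dy (A : 'M[R]_dx) (C : 'M[R]_(dy, dx)) : Prop :=
  \rank (\mxcol_(i < dx) (C *m A ^+ i)) = dx.

Definition controllable dx m (A : 'M[R]_dx) (B : 'M[R]_(dx, m)) : Prop :=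
  \rank (\mxrow_(i < dx) (A ^+ i *m B)) = dx.

End LinearAlgebra.

Section Kalman.
Context {R : realType} {dx dy : nat}.
Variables (A Bw : 'M[R]_dx) (C : 'M[R]_(dy, dx)) (Dv : 'M[R]_dy).

Definition innovation_cov (S : 'M[R]_dx) : 'M[R]_dy := C *m S *m C^T + Dv *m Dv^T.

Definition kalman_gain (S : 'M[R]_dx) : 'M[R]_(dx, dy) :=
  A *m S *m C^T *m invmx (innovation_cov S).

Definition riccati_stabilizing (S : 'M[R]_dx) : Prop :=
  [/\ psdmx S,
      S = A *m S *m A^T
          - A *m S *m C^T *m invmx (innovation_cov S) *m C *m S *m A^T
          + Bw *m Bw^T
    & spectral_radius (A - kalman_gain S *m C) < 1].

End Kalman.

(* A vector of R^(H d) made of H blocks of size d has the dimension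
   \sum_(i < H) d of the library's block matrices.  Blocks are numbered from 0,
   hence the exponents i and i - j - 1 below. *)
Section Blocks.
Context {R : realType} {dx dy : nat}.
Variables (H : nat) (A : 'M[R]_dx) (C : 'M[R]_(dy, dx)) (K : 'M[R]_(dx, dy)).

Definition Phi : 'M[R]_(\sum_(i < H) dy, dx) :=
  \mxcol_(i < H) (C *m A ^+ i *m (A - K *m C)).

Definition Gamma_e (De : 'M[R]_dy) : 'M[R]_(\sum_(i < H) dy, \sum_(j < H) dy) :=
  \mxblock_(i < H, j < H)
    (if (j < i)%N then C *m A ^+ (i - j - 1) *m K *m De
     else if (i == j)%N then De else 0).

End Blocks.

Section Noise.
Context {d : measure_display} {T : measurableType d} {R : realType}.
Variable P : probability T R.

Definition mutually_independent (I : eqType) (X : I -> {RV P >-> R}) : Prop :=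
  forall (s : seq I) (B : I -> set R), uniq s -> (forall i, measurable (B i)) ->
    P (\bigcap_(i in [set` s]) X i @^-1` B i) = (\prod_(i <- s) P (X i @^-1` B i))%E.

Definition iid_std_normal (I : eqType) (X : I -> {RV P >-> R}) : Prop :=
  (forall (i : I) (B : set R), measurable B -> distribution P (X i) B = normal_prob 0 1 B) /\
  mutually_independent X.

(* An i.i.d. sequence of N(0, I_n) vectors is given by its scalar coordinates,
   u t i being coordinate i of the vector u_t. *)
Definition white_noise n (u : nat -> 'I_n -> {RV P >-> R}) : Prop :=
  iid_std_normal (fun k : nat * 'I_n => u k.1 k.2).

Definition independent_white_noises m n
    (w : nat -> 'I_m -> {RV P >-> R}) (v : nat -> 'I_n -> {RV P >-> R}) : Prop :=
  iid_std_normal (fun k : nat * ('I_m + 'I_n) =>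
    match k.2 with inl i => w k.1 i | inr j => v k.1 j end).

Definition rvec n (X : 'I_n -> {RV P >-> R}) (om : T) : 'cV[R]_n := \col_i X i om.

(* x_{t+1} = A x_t + B u_t with x_0 = 0. *)
Fixpoint state n m (A : 'M[R]_n) (B : 'M[R]_(n, m))
    (u : nat -> 'I_m -> {RV P >-> R}) (t : nat) (om : T) : 'cV[R]_n :=
  if t is s.+1 then A *m state A B u s om + B *m rvec (u s) om else 0.

Definition output dx dy (A Bw : 'M[R]_dx) (C : 'M[R]_(dy, dx)) (Dv : 'M[R]_dy)
    (w : nat -> 'I_dx -> {RV P >-> R}) (v : nat -> 'I_dy -> {RV P >-> R})
    (t : nat) (om : T) : 'cV[R]_dy :=
  C *m state A Bw w t om + Dv *m rvec (v t) om.

(* The processes considered start at 0 and converge to stationarity: their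
   stationary covariance is the limit of the covariance matrix at time t. *)
Definition stationary_covariance n (z : nat -> T -> 'cV[R]_n) (Sigma : 'M[R]_n) : Prop :=
  forall i j, (fun t : nat => covariance P (fun om => z t om i 0) (fun om => z t om j 0))
                @ \oo --> (Sigma i j)%:E.

End Noise.

Section Prediction.
Context {R : realType} {dy : nat}.
Variable H : nat.

(* y_{t+1:t+H} *)
Definition future (y : nat -> 'cV[R]_dy) (t : nat) : 'cV[R]_(\sum_(i < H) dy) :=
  \mxcol_(i < H) y (t + i.+1)%N.

Definition empirical_risk (y : nat -> 'cV[R]_dy) (N : nat)
    (G : 'M[R]_(\sum_(i < H) dy, dy)) : R :=
  \sum_(1 <= t < (N - H).+1) fnorm (future y t - G *m y t) ^+ 2.

Definition is_multistep_predictor (y : nat -> 'cV[R]_dy) (N : nat)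
    (G : 'M[R]_(\sum_(i < H) dy, dy)) : Prop :=
  forall G', empirical_risk y N G <= empirical_risk y N G'.

Definition loss d (T : measurableType d) (P : probability T R)
    (y : nat -> T -> 'cV[R]_dy) (G : 'M[R]_(\sum_(i < H) dy, dy)) : \bar R :=
  limn (fun n : nat =>
    'E_P[(fun om => n%:R^-1 *
        \sum_(0 <= t < n.+1)
           fnorm (future (fun s => y s om) t - G *m y t om) ^+ 2)%R]%E).

End Prediction.

(* Main.v *)
Require Import Defs.
From HB Require Import structures.
From mathcomp Require Import all_boot all_order all_algebra.
From mathcomp Require Import all_classical all_reals all_analysis.
From mathcomp Require Import measurable_realfun complex ring lra zify.

Set Implicit Arguments.
Unset Strict Implicit.
Unset Printing Implicit Defensive.

Import Order.TTheory GRing.Theory Num.Theory.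
Import numFieldNormedType.Exports.

Local Open Scope classical_set_scope.
Local Open Scope ring_scope.

(* The loss of G is the risk of the best linear predictor Gs of the future from
   y_t plus \sum_i tr ((G_i - Gs_i) Sigma_y (G_i - Gs_i)^T).  The state has the
   stationary covariance Sigma_xhat + S, and the innovations form turns the risk
   of Gs into the announced value.  It remains to show E |Ghat_N - Gs|^2 -> 0.

   Since Ghat_N does at least as well as Gs on the data, its error is controlled
   by the time averages of (residual of Gs) x (output) and by the inverse of the
   empirical covariance of the outputs.  The averages tend to 0 in mean square:
   the residual is asymptotically orthogonal to the output, the correlations decay
   geometrically, and Isserlis' formula gives the fourth moments.

   For the inverse covariance, the samples are cut into disjoint blocks of d_y
   outputs.  Each entry of Dv^-1 [y_t1 .. y_td] is a standard normal variable plus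
   a term independent of it, and E |Z + a|^(-1/2) <= 9 for all a.  Integrating
   out the noises one after the other bounds the moments of order 1/2 of the
   entries of the inverse of a block, and products over distinct groups of blocks
   provide the higher moments. *)

(** The limit concerns E L(Ghat_N), so consistency in probability would not do: |Ghat_N - Gs|^2 must
    be controlled in L^1, although Ghat_N involves the inverse of a random matrix that can be nearly
    singular. Moments of 1/|Z + a| are finite only below order 1, hence the order 1/2. The powers
    then pile up. For a block Z, a coordinate of a row z satisfies z_j^2 <= |zZ|^2 s^4, where s is a
    sum of square roots of entries of Z^-1; the crude error bound is quadratic in this s^4;
    separating it from the residual energy by 2ab <= a^2 + b^2 squares it once more. The result is
    s^16, hence 16 groups with one factor each. A truncation level K keeps the cross averages, which
    vanish, apart from the scores, which are merely bounded in mean: the error is at most K^2 o(1) +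
    B/K, and N goes to infinity before K. On the algebraic side, no optimality of the Kalman filter
    is invoked: the Riccati equation and the formula of the gain suffice to rewrite all
    covariances. *)

(** * Geometric decay of the powers of a matrix of spectral radius below 1 *)

Section SpectralDecay.
Context {R : realType}.
Local Notation normc := (@ComplexField.Normc.normc R).

Lemma normc_ge0 (x : R[i]) : 0 <= normc x.
Proof. by case: x => a b; exact: sqrtr_ge0. Qed.

Lemma normc_real (x : R) : normc (real_complex R x) = `|x|.
Proof. by rewrite /= expr0n/= addr0 sqrtr_sqr. Qed.

(** The constant m = a + c / (kappa - |z|) satisfies c + |z| m <= kappa m, which is what the
    induction step asks for. *)
Lemma affine_recurrence_decay (x y : nat -> R[i]) (z : R[i]) (a c kappa : R) :
  0 < kappa -> normc z < kappa -> 0 <= c -> normc (x 0%N) <= a ->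
  (forall k, x k.+1 = y k + z * x k) ->
  (forall k, normc (y k) <= c * kappa ^+ k) ->
  forall k, normc (x k) <= (a + c / (kappa - normc z)) * kappa ^+ k.
Proof.
move=> k0 zk c0 xa xS yc.
have d0 : 0 < kappa - normc z by rewrite subr_gt0.
elim=> [|k IH].
  by rewrite expr0 mulr1 (le_trans xa)// lerDl divr_ge0// ltW.
rewrite xS; apply: (le_trans (le_normcD _ _)); rewrite ComplexField.Normc.normcM.
set m := a + _ in IH *.
apply: (@le_trans _ _ (c * kappa ^+ k + normc z * (m * kappa ^+ k))).
  by rewrite lerD// ler_wpM2l// normc_ge0.
rewrite [_ ^+ k.+1]exprS [leRHS]mulrA mulrA -mulrDl ler_wpM2r ?exprn_ge0 ?(ltW k0)//.
have a0 : 0 <= a by apply: le_trans xa; exact: normc_ge0.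
rewrite -lerBrDr [normc z * m]mulrC -mulrBr /m mulrDl divfK ?gt_eqF//.
by rewrite lerDr mulr_ge0// ltW.
Qed.

(** Induction on the roots of an annihilating polynomial, in place of a Jordan form. Since D A^(k+1)
    = D (A - z) A^k + z D A^k, the entries of D A^k solve a scalar recurrence whose forcing term is
    covered by the shorter list of roots; the free factor D makes this induction possible. *)
Lemma annihilated_decay n (A : 'M[R[i]]_n.+1) (kappa : R) (r : seq R[i]) (D : 'M[R[i]]_n.+1) :
  0 < kappa -> (forall z, z \in r -> normc z < kappa) ->
  D * \prod_(z <- r) (A - z%:M) = 0 ->
  exists2 c, 0 <= c & forall k i j, normc ((D * A ^+ k) i j) <= c * kappa ^+ k.
Proof.
move=> k0; elim: r D => [|z r IH] D zr.
  rewrite big_nil mulr1 => ->; exists 0 => // k i j.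
  by rewrite mul0r mxE ComplexField.Normc.normc0 mul0r.
rewrite big_cons mulrA => /IH[|c c0 hc].
  by move=> w wr; apply: zr; rewrite inE wr orbT.
have zk : normc z < kappa by apply: zr; rewrite inE eqxx.
pose a := \sum_i \sum_j normc (D i j).
have aD i j : normc (D i j) <= a.
  rewrite /a (bigD1 i)//= (bigD1 j)//= -addrA lerDl addr_ge0//.
    by apply: sumr_ge0 => *; exact: normc_ge0.
  by apply: sumr_ge0 => *; apply: sumr_ge0 => *; exact: normc_ge0.
exists (a + c / (kappa - normc z)).
  rewrite addr_ge0//; last by rewrite divr_ge0// subr_ge0 ltW.
  by apply: sumr_ge0 => *; apply: sumr_ge0 => *; exact: normc_ge0.
move=> k i j.
apply: (affine_recurrence_decay (x := fun k => (D * A ^+ k) i j)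
  (y := fun k => (D * (A - z%:M) * A ^+ k) i j)) => //.
  by rewrite expr0 mulr1.
move=> l; have -> : D * A ^+ l.+1 = D * (A - z%:M) * A ^+ l + z *: (D * A ^+ l).
  rewrite mulrBr mulrBl exprS mulrA -[D * z%:M]/(D *m z%:M) mul_mx_scalar.
  by rewrite -scalerAl subrK.
by rewrite !mxE.
Qed.

Lemma spectral_decay n (A : 'M[R]_n) : spectral_radius A < 1 ->
  exists kappa c, [/\ 0 < kappa, kappa < 1, 0 <= c &
    forall k i j, `|(A ^+ k) i j| <= c * kappa ^+ k].
Proof.
case: n A => [|n] A.
  by move=> _; exists 2^-1, 0; split => // [|k []//]; rewrite invf_lt1// ltr1n.
set rho := spectral_radius A => rho1.
(* The maximum with 1/2 makes [kappa] positive without a proof that 0 <= rho. *)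
pose kappa := Num.max 2^-1 ((1 + rho) / 2).
have k0 : 0 < kappa by rewrite lt_max invr_gt0 ltr0n.
have k1 : kappa < 1.
  by rewrite gt_max invf_lt1// ltr1n/= ltr_pdivrMr// mul1r; lra.
pose Ac := map_mx (real_complex R) A.
have [r] := closed_field_poly_normal (char_poly Ac).
rewrite (monicP (char_poly_monic Ac)) scale1r => chE.
have rk z : z \in r -> normc z < kappa.
  move=> zr; apply: (@le_lt_trans _ _ rho); last by rewrite lt_max; apply/orP; right; lra.
  apply: ub_le_sup; last first.
    by exists z => //; rewrite eigenvalue_root_char chE root_prod_XsubC.
  (* The supremum dominates the moduli only if they are bounded; their sum over all roots is a
     bound. *)
  exists (\sum_(w <- r) normc w) => _ [w + ->].
  rewrite eigenvalue_root_char -/Ac chE root_prod_XsubC => wr.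
  rewrite (big_rem w)//= lerDl.
  by apply: sumr_ge0 => *; exact: normc_ge0.
have ann : 1 * \prod_(z <- r) (Ac - z%:M) = 0.
  rewrite mul1r -[RHS](Cayley_Hamilton Ac) chE rmorph_prod; apply: eq_bigr => z _.
  by rewrite rmorphB/= horner_mx_X horner_mx_C.
have [c c0 hc] := annihilated_decay k0 rk ann.
exists kappa, c; split => // k i j.
have := hc k i j; rewrite mul1r.
have -> : Ac ^+ k = map_mx (real_complex R) (A ^+ k) by rewrite rmorphXn.
by rewrite mxE normc_real.
Qed.

End SpectralDecay.

(** * Moments and small-ball bounds of the standard normal law *)

Section Normal.
Context {R : realType}.
Notation mu := (@lebesgue_measure R).
Notation N01 := (@normal_prob R 0 1).

(** The change of variables goes through the Radon-Nikodym derivative of [normal_prob], which equals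
    [normal_pdf] almost everywhere because both have the same integral over every measurable set. *)
Lemma ge0_integral_normal_prob (f : R -> \bar R) : measurable_fun [set: R] f ->
  (forall x, 0 <= f x)%E ->
  (\int[N01]_x f x = \int[mu]_x (f x * (normal_pdf 0 1 x)%:E))%E.
Proof.
move=> mf f0.
have dom := normal_prob_dominates (0:R) 1.
rewrite -(Radon_Nikodym_SigmaFinite.change_of_variables dom f0 measurableT mf).
apply: ae_eq_integral => //=.
- apply: emeasurable_funM => //.
  exact: measurable_int (Radon_Nikodym_SigmaFinite.f_integrable dom).
- by apply: emeasurable_funM => //; apply/measurable_EFinP; exact: measurable_normal_pdf.
- apply: ae_eqe_mul2l; apply: integral_ae_eq => //.
  + exact: Radon_Nikodym_SigmaFinite.f_integrable dom.
  + by apply/measurable_EFinP; exact: measurable_normal_pdf.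
  + move=> E _ mE; rewrite -(Radon_Nikodym_SigmaFinite.f_integral dom) //.
Qed.

Notation phi := (@normal_pdf R 0 1).
Notation pk := (@normal_peak R 1).

Lemma normal_pdf01E x : phi x = pk * expR (- (x ^+ 2 / 2)).
Proof. by rewrite normal_pdfE ?oner_neq0// /normal_fun subr0 expr1n mulNr. Qed.

Lemma normal_pdf01N x : phi (- x) = phi x.
Proof. by rewrite !normal_pdf01E sqrrN. Qed.

Lemma is_derive_normal_pdf (x : R) : is_derive x 1 phi (- (x * phi x)).
Proof.
have -> : phi = (fun x => pk * expR (- (x ^+ 2 / 2))).
  by apply/funext => y; rewrite normal_pdf01E.
apply: is_derive_eq.
rewrite /GRing.scale /=; move: (expR _) pk => u p.
by rewrite !mulr0 add0r !mulr1; field.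
Qed.

Lemma continuous_normal_pdf01 : continuous phi.
Proof. by apply: continuous_normal_pdf; rewrite oner_neq0. Qed.

(** The standard normal distribution function; inside this section it hides the matrix [Phi] of the
    statement. *)
Let Phi (x : R) := \int[mu]_(t in `]-oo, x]) phi t.

Let is_derive_Phi (x : R) : is_derive x 1 Phi (phi x).
Proof.
have [||||dF <-] := @continuous_FTC1 R phi (BInfty _ true) x (x + 1).
- by rewrite ltrDl.
- by apply: integrableS (integrable_normal_pdf _ _).
- by rewrite /Order.lt/=.
- exact: continuous_normal_pdf01.
- by rewrite derive1E; exact: derivableP.
Qed.

(** The identity as a random variable under the normal law: its distribution function is the local
    [Phi], which yields the limit 1 at infinity. *)
Let idR : measurableTypeR R -> R := idfun.

#[local] HB.instance Definition _ :=
  @isMeasurableFun.Build _ _ _ _ idR (@measurable_id _ _ setT).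

Let cvg_Phi : Phi x @[x --> +oo%R] --> (1 : R).
Proof.
have /fine_cvg := cvg_cdfy1 (idR : {RV N01 >-> R}).
exact.
Qed.

(** Squaring e^u >= 1 + u at u = x^2/8 gives e^(x^2/4) >= (1 + x^2/8)^2, so that x^4 e^(-x^2/2) <=
    x^4 / (1 + x^2/8)^2 <= 64. *)
Lemma normal_pdf01_decay (x : R) : 0 < x -> x ^+ 3 * phi x <= 64 * pk / x.
Proof.
move=> x0; rewrite normal_pdf01E.
rewrite ler_pdivlMr// mulrAC -exprSr mulrCA [64 * _]mulrC ler_wpM2l ?normal_peak_ge0//.
have e1 : (1 + x ^+ 2 / 8) ^+ 2 <= expR (x ^+ 2 / 4).
  have -> : x ^+ 2 / 4 = x ^+ 2 / 8 + x ^+ 2 / 8 by field.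
  rewrite expRD -expr2 ler_pXn2r ?nnegrE ?expR_ge0 ?expR_ge1Dx//.
  by rewrite addr_ge0// divr_ge0// sqr_ge0.
have e2 : expR (- (x ^+ 2 / 2)) <= (expR (x ^+ 2 / 4))^-1.
  rewrite -expRN ler_expR; have := sqr_ge0 x; lra.
apply: (@le_trans _ _ (x ^+ 4 / (1 + x ^+ 2 / 8) ^+ 2)).
  rewrite ler_wpM2l ?exprn_ge0 ?(ltW x0)//; apply: (le_trans e2).
  rewrite lef_pV2 ?posrE ?expR_gt0// exprn_gt0//.
  by rewrite ltr_pwDl// divr_ge0// sqr_ge0.
rewrite ler_pdivrMr; last by rewrite exprn_gt0// ltr_pwDl// divr_ge0// sqr_ge0.
have := sqr_ge0 x; rewrite (exprM x 2 2); nra.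
Qed.

Let cvg_cube : (x ^+ 3 * phi x) @[x --> +oo%R] --> (0 : R).
Proof.
apply: (@squeeze_cvgr _ _ _ _ (cst 0) (fun x => 64 * pk / x)).
- near=> x; rewrite normal_pdf01_decay ?andbT//=.
  by rewrite mulr_ge0 ?normal_pdf_ge0// exprn_ge0.
- exact: cvg_cst.
- rewrite -[X in _ --> X](mulr0 (64 * pk)); apply: cvgM; first exact: cvg_cst.
  by apply/gtr0_cvgV0 => //; near do done.
Unshelve. all: by end_near. 
Qed.

Let cvg_lin : (x * phi x) @[x --> +oo%R] --> (0 : R).
Proof.
apply: (@squeeze_cvgr _ _ _ _ (cst 0) (fun x => x ^+ 3 * phi x)) => //; last exact: cvg_cst.
near=> x; rewrite mulr_ge0 ?normal_pdf_ge0//= ler_wpM2r ?normal_pdf_ge0//.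
have x1 : 1 <= x by [].
by rewrite -[leLHS]expr1 ler_weXn2l.
Unshelve. all: by end_near. 
Qed.

(** Each half-line moment has an antiderivative built from [Phi] and the density, for instance Phi -
    x phi for x^2 phi. The result is kept as a multiple of 1 - Phi 0: the value Phi 0 is never
    computed, since the total mass gives 2 (1 - Phi 0) = 1 in [whole0]. *)
Let halfline (f F : R -> R) (c : R) : (forall x, 0 <= x -> 0 <= f x) -> continuous f ->
  (forall x : R, is_derive x 1 F (f x)) -> F x @[x --> +oo%R] --> c -> F 0 = c * Phi 0 ->
  (\int[mu]_(x in `[0%R, +oo[) (f x)%:E = (c * (1 - Phi 0))%:E)%E.
Proof.
move=> f0 cf dF cF F0.
rewrite (@ge0_continuous_FTC2y _ f F 0 c)//.
- by rewrite F0 -EFinB mulrBr mulr1.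
- exact: continuous_subspaceT.
- apply: cvg_at_right_filter.
  by apply: differentiable_continuous; exact/derivable1_diffP.
- by move=> x _; rewrite derive1E derive_val.
Qed.

Let half0 : (\int[mu]_(x in `[0%R, +oo[) (phi x)%:E = (1 - Phi 0)%:E)%E.
Proof.
rewrite (@halfline phi Phi 1 _ _ is_derive_Phi) ?mul1r//.
- by move=> x _; exact: normal_pdf_ge0.
- exact: continuous_normal_pdf01.
Qed.

Let continuous_mom k : continuous (fun x : R => x ^+ k * phi x).
Proof.
by move=> x; apply: cvgM; [exact: exprn_continuous|exact: continuous_normal_pdf01].
Qed.

Let half2 : (\int[mu]_(x in `[0%R, +oo[) (x ^+ 2 * phi x)%:E = (1 - Phi 0)%:E)%E.
Proof.
have d (x : R) : is_derive x 1 (fun x => Phi x - x * phi x) (x ^+ 2 * phi x).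
  have := is_derive_normal_pdf; have := is_derive_Phi => d1 d2.
  by apply: is_derive_eq; rewrite /GRing.scale /=; ring.
rewrite (@halfline _ _ 1 _ _ d) ?mul1r//.
- by move=> x _; rewrite mulr_ge0 ?normal_pdf_ge0// sqr_ge0.
- by rewrite -[X in _ --> X]subr0; apply: cvgB.
- by rewrite mul0r subr0.
Qed.

Let half4 : (\int[mu]_(x in `[0%R, +oo[) (x ^+ 4 * phi x)%:E = (3 * (1 - Phi 0))%:E)%E.
Proof.
have d (x : R) : is_derive x 1 (fun x => 3 * Phi x - 3 * (x * phi x) - x ^+ 3 * phi x)
    (x ^+ 4 * phi x).
  have := is_derive_normal_pdf; have := is_derive_Phi => d1 d2.
  by apply: is_derive_eq; rewrite /GRing.scale /=; ring.
rewrite (@halfline _ _ 3 _ _ d)//.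
- by move=> x _; rewrite mulr_ge0 ?normal_pdf_ge0// exprn_even_ge0.
- rewrite [X in _ --> X](_ : 3 = 3 * 1 - 3 * 0 - 0 :> R); last by ring.
  apply: cvgB; last exact: cvg_cube.
  apply: cvgB.
    exact: (cvgM (cvg_cst _) cvg_Phi).
  exact: (cvgM (cvg_cst _) cvg_lin).
- by rewrite expr0n/= !mul0r; ring.
Qed.

Let wholeline k : ~~ odd k ->
  (\int[mu]_x (x ^+ k * phi x)%:E = 2%:E * \int[mu]_(x in `[0%R, +oo[) (x ^+ k * phi x)%:E)%E.
Proof.
move=> ek; rewrite ge0_symfun_integralT//.
- by rewrite set_itvcy.
- by move=> x; rewrite mulr_ge0 ?normal_pdf_ge0// exprn_even_ge0.
- by move=> x /=; rewrite normal_pdf01N exprNn -signr_odd (negbTE ek) expr0 mul1r.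
Qed.

Let whole0 : (2%:E * (1 - Phi 0)%:E = 1 :> \bar R)%E.
Proof.
rewrite -half0 -(integral_normal_pdf (0:R) 1).
have := @wholeline 0 isT.
rewrite (_ : (fun x => (x ^+ 0 * phi x)%:E) = fun x => (phi x)%:E).
  by move=> ->.
by apply/funext => x; rewrite expr0 mul1r.
Qed.

Lemma normal_moment2 : (\int[N01]_x (x ^+ 2)%:E = 1)%E.
Proof.
rewrite ge0_integral_normal_prob; last 2 first.
- by apply/measurable_EFinP; exact: measurable_funX.
- by move=> x; rewrite lee_fin sqr_ge0.
under eq_integral do rewrite -EFinM.
by rewrite wholeline// half2 whole0.
Qed.

Lemma normal_moment4 : (\int[N01]_x (x ^+ 4)%:E = 3%:E)%E.
Proof.
rewrite ge0_integral_normal_prob; last 2 first.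
- by apply/measurable_EFinP; exact: measurable_funX.
- by move=> x; rewrite lee_fin exprn_even_ge0.
under eq_integral do rewrite -EFinM.
by rewrite wholeline// half4 [(3 * _)%:E]EFinM muleCA whole0 mule1.
Qed.

Lemma normal_prob_sym (f : R -> \bar R) : measurable_fun [set: R] f ->
  (forall x, 0 <= f x)%E -> (\int[N01]_x f (- x)%R = \int[N01]_x f x)%E.
Proof.
move=> mf f0.
have mfN : measurable_fun [set: R] (fun x => f (- x)) by exact: measurableT_comp.
rewrite !ge0_integral_normal_prob//.
have mphi : measurable_fun [set: R] (fun x => (phi x)%:E).
  by apply/measurable_EFinP; exact: measurable_normal_pdf.
pose g x := (f x * (phi x)%:E)%E.
have mg : measurable_fun [set: R] g by exact: emeasurable_funM.
transitivity (\int[mu]_x (g \o (-%R : R -> R)) x)%E.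
  by apply: eq_integral => x _; rewrite /g /= normal_pdf01N.
have mo : measurable_fun setT (-%R : measurableTypeR R -> measurableTypeR R).
  exact: (measurable_funN (@measurable_id _ _ setT)).
have := @ge0_integral_pushforward _ _ _ _ R _ mo mu setT g.
rewrite preimage_setT => <-//; last first.
  by move=> x _; rewrite mule_ge0// lee_fin normal_pdf_ge0.
by apply: eq_measure_integral => A mA _; exact: lebesgue_measureN.
Qed.

(** Symmetrization removes the odd powers of x, so that only nonnegative integrands occur and no
    integrability has to be established beforehand. *)
Let even_part (f : R -> R) (s : R) : measurable_fun [set: R] f -> (forall x, 0 <= f x) ->
  (\int[N01]_x (f x + f (- x))%:E = (s + s)%:E)%E -> (\int[N01]_x (f x)%:E = s%:E)%E.
Proof.
move=> mf f0; have mf' : measurable_fun [set: R] (EFin \o f) by exact/measurable_EFinP.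
under eq_integral do rewrite EFinD.
rewrite ge0_integralD//=; first last.
- by apply/measurable_EFinP; exact: measurableT_comp.
- by move=> x _; rewrite lee_fin.
- by move=> x _; rewrite lee_fin.
rewrite (@normal_prob_sym (EFin \o f))// /comp.
have : (0 <= \int[N01]_x (f x)%:E)%E by apply: integral_ge0 => x _; rewrite lee_fin.
case: (\int[N01]_x _)%E => // r _; rewrite -EFinD => -[] h; congr _%:E; lra.
Qed.

Let mX (k : nat) : measurable_fun [set: R] (fun x : R => (x ^+ k)%:E).
Proof. by apply/measurable_EFinP; exact: measurable_funX. Qed.

Lemma normal_affine2 (c a : R) :
  (\int[N01]_x ((c + a * x) ^+ 2)%:E = (c ^+ 2 + a ^+ 2)%:E)%E.
Proof.
apply: even_part => [|x|].
- by apply: measurable_funX; apply: measurable_funD => //; exact: measurable_funM.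
- exact: sqr_ge0.
set k0 := 2 * c ^+ 2; set k2 := 2 * a ^+ 2.
have k0_ge0 : (0 <= k0%:E)%E by rewrite lee_fin mulr_ge0// sqr_ge0.
have k2_ge0 : (0 <= k2%:E)%E by rewrite lee_fin mulr_ge0// sqr_ge0.
have -> : (fun x => ((c + a * x) ^+ 2 + (c + a * - x) ^+ 2)%:E) =
    (fun x => (k0%:E + k2%:E * (x ^+ 2)%:E)%E).
  by apply/funext => x; rewrite -EFinM -EFinD; congr EFin; rewrite /k0 /k2; ring.
have p2 (y : R) : (0 <= (y ^+ 2)%:E)%E by rewrite lee_fin sqr_ge0.
have ge2 (y : R) : (0 <= k2%:E * (y ^+ 2)%:E)%E by rewrite mule_ge0.
have m2 := mX 2.
have m2' : measurable_fun [set: R] (fun y : R => k2%:E * (y ^+ 2)%:E)%E.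
  exact: emeasurable_funM.
rewrite ge0_integralD//= integral_cst//= probability_setT mule1 ge0_integralZl//=.
by rewrite normal_moment2 mule1 -EFinD; congr EFin; rewrite /k0 /k2; ring.
Qed.

Lemma normal_affine4 (c a : R) :
  (\int[N01]_x ((c + a * x) ^+ 4)%:E =
    (c ^+ 4 + 6 * (c ^+ 2 * a ^+ 2) + 3 * a ^+ 4)%:E)%E.
Proof.
have p4' (y : R) : 0 <= y ^+ 4 by rewrite exprn_even_ge0.
apply: even_part => [|x|]; [|exact: p4'|].
  by apply: measurable_funX; apply: measurable_funD => //; exact: measurable_funM.
set k0 := 2 * c ^+ 4; set k2 := 12 * (c ^+ 2 * a ^+ 2); set k4 := 2 * a ^+ 4.
have k0_ge0 : (0 <= k0%:E)%E by rewrite lee_fin mulr_ge0.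
have k2_ge0 : (0 <= k2%:E)%E by rewrite lee_fin mulr_ge0// mulr_ge0// sqr_ge0.
have k4_ge0 : (0 <= k4%:E)%E by rewrite lee_fin mulr_ge0.
have -> : (fun x => ((c + a * x) ^+ 4 + (c + a * - x) ^+ 4)%:E) =
    (fun x => (k0%:E + (k2%:E * (x ^+ 2)%:E + k4%:E * (x ^+ 4)%:E))%E).
  apply/funext => x; rewrite -!EFinM -!EFinD; congr EFin.
  by rewrite /k0 /k2 /k4; ring.
have p2 (y : R) : (0 <= (y ^+ 2)%:E)%E by rewrite lee_fin sqr_ge0.
have p4 (y : R) : (0 <= (y ^+ 4)%:E)%E by rewrite lee_fin.
have ge2 (y : R) : (0 <= k2%:E * (y ^+ 2)%:E)%E by rewrite mule_ge0.
have ge4 (y : R) : (0 <= k4%:E * (y ^+ 4)%:E)%E by rewrite mule_ge0.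
have ge24 (y : R) : (0 <= k2%:E * (y ^+ 2)%:E + k4%:E * (y ^+ 4)%:E)%E by rewrite adde_ge0.
have m2 := mX 2; have m4 := mX 4.
have m2' : measurable_fun [set: R] (fun y : R => k2%:E * (y ^+ 2)%:E)%E.
  exact: emeasurable_funM.
have m4' : measurable_fun [set: R] (fun y : R => k4%:E * (y ^+ 4)%:E)%E.
  exact: emeasurable_funM.
have m24 : measurable_fun [set: R] (fun y : R => k2%:E * (y ^+ 2)%:E + k4%:E * (y ^+ 4)%:E)%E.
  exact: emeasurable_funD.
rewrite ge0_integralD//= integral_cst//= probability_setT mule1.
rewrite ge0_integralD//= ge0_integralZl//= ge0_integralZl//=.
rewrite normal_moment2 normal_moment4 mule1 -EFinM -!EFinD; congr EFin.
by rewrite /k0 /k2 /k4; ring.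
Qed.

Lemma normal_peak01_le1 : pk <= 1.
Proof.
rewrite /normal_peak invf_le1 ?sqrtr_gt0; last first.
  by rewrite expr1n mul1r mulrn_wgt0// pi_gt0.
rewrite -[leLHS]sqrtr1 ler_wsqrtr// expr1n mul1r.
have := pi_ge2 R; rewrite -mulr_natr; lra.
Qed.

Lemma normal_prob_le (A : set R) : measurable A -> (N01 A <= mu A)%E.
Proof.
move=> mA; rewrite /normal_prob -[leRHS]mul1e -(integral_cst mu mA 1).
apply: ge0_le_integral => //=.
- by move=> x _; rewrite lee_fin normal_pdf_ge0.
- by apply/measurable_EFinP/measurable_funTS; exact: measurable_normal_pdf.
- move=> x _; rewrite lee_fin.
  by apply: (le_trans (normal_pdf_ub _ _ _)); rewrite ?oner_neq0 ?normal_peak01_le1.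
Qed.

Lemma normal_prob_small_ball (a r : R) : 0 <= r ->
  (N01 [set x | `|x + a| <= r]%R <= (2 * r)%:E)%E.
Proof.
move=> r0.
have -> : [set x | `|x + a| <= r]%R = `[- a - r, - a + r]%classic.
  apply/seteqP; split => x /=; rewrite in_itv/= ler_norml => /andP[h1 h2]; apply/andP; split; lra.
apply: (le_trans (normal_prob_le _)) => //=.
rewrite lebesgue_measure_itv/= lte_fin; case: ifPn => _.
  by rewrite -EFinB lee_fin; lra.
by rewrite lee_fin mulr_ge0.
Qed.

End Normal.

(** * Moment of order -1/2 of a shifted normal variable *)

Section InvSqrt.
Context {R : realType}.
Notation N01 := (@normal_prob R 0 1).

Lemma measurable_invr : measurable_fun [set: R] (@GRing.inv R).
Proof.
rewrite -(setUv [set (0 : R)]); apply/measurable_funU; [by []|exact: measurableC|split].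
  exact: measurable_fun_set1.
apply: open_continuous_measurable_fun.
  by rewrite openC; apply: accessible_closed_set1; exact: hausdorff_accessible.
by move=> x /[!inE]/= /eqP x0; exact: inv_continuous.
Qed.

Lemma measurable_sqrtr : measurable_fun [set: R] (@Num.sqrt R).
Proof. by apply: continuous_measurable_fun; exact: sqrt_continuous. Qed.

(* The value at 0 is 0, because 0^-1 = 0. *)
Definition invsqrt (y : R) : R := Num.sqrt `|y^-1|.

Lemma invsqrt_ge0 y : 0 <= invsqrt y. Proof. exact: sqrtr_ge0. Qed.

Lemma measurable_invsqrt : measurable_fun [set: R] invsqrt.
Proof.
apply: (measurableT_comp measurable_sqrtr).
by apply: measurableT_comp => //; exact: measurable_invr.
Qed.

(** Layers for |y|^(-1/2): when 4^-(k+1) < |y| <= 4^-k, the value is at most 2^(k+1), which is layer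
    k. The layers thus dominate [invsqrt] below |y| = 1. *)
Let dyadic (y : R) (k : nat) : \bar R :=
  ((2 ^+ k.+1)%:E * (\1_[set x | `|x| <= 4 ^- k]%R y)%:E)%E.

Let dyadic_ge0 y k : (0 <= dyadic y k)%E.
Proof. by rewrite /dyadic mule_ge0// lee_fin ?exprn_ge0. Qed.

Let four_gt (n : nat) : n%:R < 4 ^+ n :> R.
Proof.
elim: n => [|n IHn]; first by rewrite expr0.
rewrite -natr1 exprS; have : (1 : R) <= 4 ^+ n by rewrite exprn_ege1// ler1n.
by nra.
Qed.

Let invsqrt_le_dyadic y : ((invsqrt y)%:E <= 1 + \sum_(0 <= k <oo) dyadic y k)%E.
Proof.
have s0 z : (0 <= \sum_(0 <= k <oo) dyadic z k)%E by exact: nneseries_ge0.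
have [y1|y1] := leP 1 `|y|.
  apply: (@le_trans _ _ 1%E); last by rewrite leeDl.
  by rewrite lee_fin /invsqrt -[leRHS]sqrtr1 ler_wsqrtr// normfV invf_le1// (lt_le_trans ltr01).
have [->|y0] := eqVneq y 0.
  by rewrite /invsqrt invr0 normr0 sqrtr0 adde_ge0.
have ypos : 0 < `|y| by rewrite normr_gt0.
have ex : exists n, 4 ^- n < `|y|.
  exists (Num.bound `|y|^-1).
  rewrite -[ltRHS]invrK ltf_pV2 ?posrE ?exprn_gt0 ?invr_gt0//.
  apply: lt_trans (four_gt _).
  by apply: archi_boundP; rewrite invr_ge0.
case: (ex_minnP ex) => -[|k] hk mink.
  by move: hk; rewrite expr0 invr1 ltNge (ltW y1).
have yk : `|y| <= 4 ^- k.
  by rewrite leNgt; apply/negP => /mink; rewrite ltnn.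
apply: (@le_trans _ _ (dyadic y k)).
  rewrite /dyadic indicE mem_set//= mule1 lee_fin /invsqrt.
  have -> : 2 ^+ k.+1 = Num.sqrt (4 ^+ k.+1) :> R.
    have -> : 4 ^+ k.+1 = (2 ^+ k.+1) ^+ 2 :> R by rewrite exprAC; congr (_ ^+ _); ring.
    by rewrite sqrtr_sqr ger0_norm// exprn_ge0.
  rewrite ler_wsqrtr// normfV -[leRHS]invrK lef_pV2 ?posrE ?invr_gt0 ?exprn_gt0//.
  exact: ltW.
apply: (@le_trans _ _ (\sum_(0 <= k <oo) dyadic y k)%E); last by rewrite leeDr.
apply: le_trans (nneseries_lim_ge k.+1 _) => //.
by rewrite big_nat_recr//= leeDr// sume_ge0.
Qed.

Let mball (k : nat) : measurable [set x : R | `|x| <= 4 ^- k].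
Proof.
have -> : [set x : R | `|x| <= 4 ^- k] = `[(- 4 ^- k)%R, (4 ^- k)%R]%classic.
  by apply/seteqP; split => x /=; rewrite in_itv/= ler_norml.
by [].
Qed.

Let mindic a k : measurable_fun [set: R] (fun x => (\1_[set x | `|x| <= 4 ^- k]%R (x + a) : R)%:E).
Proof.
apply/measurable_EFinP; apply: measurableT_comp; last exact: measurable_funD.
by apply: measurable_indic; exact: mball.
Qed.

Let mdyadic a k : measurable_fun [set: R] (fun x => dyadic (x + a) k).
Proof. by apply: emeasurable_funM => //; exact: mindic. Qed.

(** Whatever the shift a, layer k costs 2^(k+1) times a probability at most 2 * 4^-k, that is 4 *
    2^-k. The layers sum to 8, and the remaining 1 accounts for |x + a| >= 1. *)
Lemma normal_invsqrt_le (a : R) : (\int[N01]_x (invsqrt (x + a))%:E <= 9%:E)%E.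
Proof.
have mi : measurable_fun [set: R] (fun x => (invsqrt (x + a))%:E).
  apply/measurable_EFinP; apply: (measurableT_comp measurable_invsqrt).
  exact: measurable_funD.
have ms : measurable_fun [set: R] (fun x => \sum_(0 <= k <oo) dyadic (x + a) k)%E.
  by apply: ge0_emeasurable_sum => // k _ x _; exact: mdyadic.
have s0 x : (0 <= \sum_(0 <= k <oo) dyadic (x + a) k)%E by exact: nneseries_ge0.
apply: (@le_trans _ _ (\int[N01]_x (1 + \sum_(0 <= k <oo) dyadic (x + a)%R k))%E).
  apply: ge0_le_integral => //.
  - by move=> x _; rewrite lee_fin invsqrt_ge0.
  - exact: (emeasurable_funD (measurable_cst 1%E) ms).
rewrite ge0_integralD// integral_cst//= probability_setT mule1.
rewrite integral_nneseries//; last by move=> k; exact: (mdyadic a k).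
rewrite (_ : 9%:E = 1 + 8%:E)%E; last by rewrite -EFinD; congr EFin; ring.
rewrite leeD2l//.
apply: (@le_trans _ _ (\sum_(0 <= k <oo) (4 * 2 ^- k)%:E)%E).
  apply: lee_nneseries => [k _ _|k _]; first exact: integral_ge0.
  rewrite ge0_integralZl//=; last exact: (mindic a k).
  have -> : (\int[N01]_x (\1_[set x | `|x| <= 4 ^- k]%R (x + a) : R)%:E =
      \int[N01]_x (\1_[set x | `|x + a| <= 4 ^- k]%R x)%:E)%E.
    by apply: eq_integral => x _; rewrite !indicE.
  rewrite integral_indic//; last first.
    have /(_ measurableT _ (mball k)) :=
      measurable_funD (@measurable_id _ R setT) (@measurable_cst _ _ _ _ setT a).
    by rewrite setTI; exact.
  rewrite setIT.
  apply: (le_trans (lee_wpmul2l _ (normal_prob_small_ball _ _))).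
  - by rewrite lee_fin exprn_ge0.
  - by rewrite invr_ge0 exprn_ge0.
  - rewrite -EFinM lee_fin exprS.
    have -> : 4 ^- k = 2 ^- k * 2 ^- k :> R.
      by rewrite -invfM -exprMn; congr (_ ^- _); ring.
    suff -> : 2 * 2 ^+ k * (2 * (2 ^- k * 2 ^- k)) = 4 * 2 ^- k :> R by [].
    by field; rewrite expf_neq0.
apply: lime_le; first by apply: is_cvg_nneseries => k _ _; rewrite lee_fin mulr_ge0// invr_ge0 exprn_ge0.
apply: nearW => n; rewrite sumEFin lee_fin.
suff -> : \sum_(0 <= k < n) (4 * 2 ^- k) = 8 - 8 * 2 ^- n :> R.
  by rewrite lerBlDr lerDl mulr_ge0// invr_ge0 exprn_ge0.
elim: n => [|n IHn]; first by rewrite big_nil expr0 invr1; ring.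
rewrite big_nat_recr//= IHn exprS invfM; field.
by rewrite expf_neq0.
Qed.

Lemma normal_prob_shift0 (a : R) : N01 [set x | x + a = 0]%R = 0%E.
Proof.
apply/eqP; rewrite eq_le measure_ge0 andbT.
have := normal_prob_small_ball a (lexx 0); rewrite mulr0.
by congr (N01 _ <= _)%E; apply/seteqP; split => x /=; rewrite normr_le0 => /eqP.
Qed.

End InvSqrt.

(** * The sigma-algebra of all variables but one *)

Section Others.
Context {d : measure_display} {T : measurableType d} {R : realType}.
Variable P : probability T R.
Context {I : eqType}.
Variable X : I -> {RV P >-> R}.

(** The cylinders that leave X k free: a pi-system, on which independence is known directly. *)
Definition others (k : I) : set (set T) := [set E | exists (s : seq I) (B : I -> set R),
  [/\ uniq s, k \notin s, (forall i, measurable (B i))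
    & E = \bigcap_(i in [set` s]) X i @^-1` B i]].

(** The carrier is still T, so a function of om that does not involve X k is described by a type
    ascription: it is measurable as a map from [without X k]. *)
Definition without k := g_sigma_algebraType (others k).
HB.instance Definition _ k := Measurable.on (without k).

Lemma measurable_rv_preimage i (B : set R) : measurable B -> measurable (X i @^-1` B).
Proof. by move=> mB; rewrite -[X in measurable X]setTI; exact: measurable_funP. Qed.

Lemma others_measurable k E : others k E -> measurable E.
Proof.
move=> [s [B [_ _ mB ->]]].
apply: fin_bigcap_measurable => [|i _]; first exact: finite_seq.
exact: measurable_rv_preimage.
Qed.

Lemma setI_closed_others k : setI_closed (others k).
Proof.
move=> _ _ [s1 [B1 [u1 k1 m1 ->]]] [s2 [B2 [u2 k2 m2 ->]]].
pose B i := (if i \in s1 then B1 i else setT) `&` (if i \in s2 then B2 i else setT).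
exists (undup (s1 ++ s2)), B; split.
- exact: undup_uniq.
- by rewrite mem_undup mem_cat negb_or k1.
- by move=> i; apply: measurableI; case: ifP.
- apply/seteqP; split => [om [h1 h2] i _|om h].
    by split; case: ifPn => // hi; [exact: h1|exact: h2].
  split=> i /= hi.
  + by have := h i; rewrite /= mem_undup mem_cat hi => /(_ isT) -[]; rewrite hi.
  + by have := h i; rewrite /= mem_undup mem_cat hi orbT => /(_ isT) -[_]; rewrite hi.
Qed.

Lemma othersT k : others k setT.
Proof.
exists [::], (fun=> setT); split => //.
by rewrite set_nil bigcap_set0.
Qed.

Lemma measurable_without k : measurable_fun setT (idfun : T -> without k).
Proof.
apply: (@measurability _ _ _ (without k) setT _ (others k)) => [//|_ [E oE <-]].
by rewrite setTI; exact: (others_measurable oE).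
Qed.

Lemma measurable_other k i : i != k -> measurable_fun setT (X i : without k -> R).
Proof.
move=> ik _ B mB; rewrite setTI; apply: sub_sigma_algebra.
exists [:: i], (fun j => if j == i then B else setT); split => //.
- by rewrite inE eq_sym.
- by move=> j; case: ifP.
- by rewrite set_cons1 bigcap_set1 eqxx.
Qed.

End Others.

(** * Integrating out one variable *)

Section Peel.
Context {d : measure_display} {T : measurableType d} {R : realType}.
Variable P : probability T R.
Context {I : eqType}.
Variable X : I -> {RV P >-> R}.
Hypothesis hX : iid_std_normal X.
Notation N01 := (@normal_prob R 0 1).

Let idk k : T -> without X k := idfun.
HB.instance Definition _ k := isMeasurableFun.Build _ _ _ _ (idk k) (@measurable_without _ _ _ P I X k).

Let joint k (om : T) : measurableTypeR R * without X k := (X k om, idk k om).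
Let mjoint k : measurable_fun setT (joint k).
Proof.
apply: (@measurable_fun_pair _ _ _ T (measurableTypeR R) (without X k) (X k) (idk k)).
  exact: (measurable_funPT (X k)).
exact (@measurable_without _ _ _ P I X k).
Qed.
HB.instance Definition _ k := isMeasurableFun.Build _ _ _ _ (joint k) (@mjoint k).

Let independent_others k (A : set R) (E : set T) :
  measurable A -> others X k E -> P (X k @^-1` A `&` E) = (N01 A * P E)%E.
Proof.
move=> mA [s [B [us ks mB ->]]].
have [dX iX] := hX.
pose B' i := if i == k then A else B i.
have mB' i : measurable (B' i) by rewrite /B'; case: ifP.
have B'k : B' k = A by rewrite /B' eqxx.
have Bs i : i \in s -> B' i = B i.
  by move=> si; rewrite /B'; case: eqP si => // ->; rewrite (negbTE ks).
have := iX (k :: s) B' _ mB'; rewrite /= ks us => /(_ isT).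
rewrite big_cons B'k -(dX k A mA) /distribution /pushforward.
rewrite (iX s B us mB).
have -> : \bigcap_(i in [set` k :: s]) X i @^-1` B' i =
    X k @^-1` A `&` \bigcap_(i in [set` s]) X i @^-1` B i.
  apply/seteqP; split => [om h|om [h1 h2] i /=].
    split => [|i si]; first by have := h k; rewrite /= B'k inE eqxx; exact.
    by have := h i; rewrite /= inE si orbT Bs//; exact.
  by rewrite inE => /predU1P[->|si]; rewrite ?B'k// Bs//; exact: h2.
by move=> ->; congr (_ * _)%E; apply: eq_big_seq => i si; rewrite Bs.
Qed.

(** As functions of E, both sides are finite measures that agree on the pi-system [others X k]. *)
Lemma independent_without k (A : set R) (E : set (without X k)) :
  measurable A -> measurable E -> P (X k @^-1` A `&` E) = (N01 A * P E)%E.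
Proof.
move=> mA; have mXA := measurable_rv_preimage X k mA.
have Afin : N01 A \is a fin_num by exact: fin_num_measure.
have A0 : 0 <= fine (N01 A) by exact: fine_ge0.
pose f : {mfun T >-> without X k} := idk k.
pose m1 : {measure set (without X k) -> \bar R} := pushforward (mrestr P mXA) f.
pose m2 : {measure set (without X k) -> \bar R} := mscale (NngNum A0) (pushforward P f).
have mf : measurable_fun [set: T] f by exact: measurable_without.
have m1E F : m1 mf F = P (X k @^-1` A `&` F) by rewrite setIC.
have m2E F : m2 mf F = (N01 A * P F)%E.
  by rewrite -[in RHS](fineK Afin).
move=> mE; rewrite -m1E -m2E.
apply: (@measure_unique _ R (without X k) (others X k) (fun=> setT) _ _ _ _ (m1 mf) (m2 mf)) => //.
- exact (@setI_closed_others _ _ _ _ _ X k).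
- by move=> _; exact (@othersT _ _ _ _ _ X k).
- by rewrite bigcup_const//; exists 0%N.
- by move=> F oF; rewrite m1E m2E; exact: independent_others.
- move=> _; rewrite m1E (le_lt_trans (probability_le1 _ _)) ?ltry//.
  by rewrite setIT.
Qed.

(** The law of om -> (X k om, om), with the second component seen in [without X k], is a product
    measure by [independent_without]; Tonelli then integrates X k first. *)
Lemma peel k (F : measurableTypeR R * without X k -> \bar R) :
  measurable_fun setT F -> (forall z, 0 <= F z)%E ->
  (\int[P]_om F (X k om, om) = \int[P]_om \int[N01]_x F (x, om))%E.
Proof.
move=> mF F0.
pose f : {mfun T >-> without X k} := idk k.
pose g : {mfun T >-> (measurableTypeR R * without X k)%type} := joint k.
pose P2 := distribution P f.
transitivity (\int[distribution P g]_z F z)%E.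
  by rewrite ge0_integral_distribution.
transitivity (\int[(N01 \x P2)%E]_z F z)%E.
  have h := @eq_measure_integral _ _ _ setT (N01 \x P2)%E (distribution P g) F; apply: h => A mA _.
  apply/esym/product_measure_unique => //= B E mB mE.
  rewrite /distribution /pushforward -(independent_without mB mE).
  by congr (P _).
rewrite fubini_tonelli2// /fubini_G.
rewrite ge0_integral_distribution//.
  exact: (@measurable_fun_fubini_tonelli_G _ _ (measurableTypeR R) (without X k) R N01 F).
by move=> om; exact: integral_ge0.
Qed.

End Peel.

(** * Expectation of real-valued functions *)

Section Expect.
Context {d : measure_display} {T : measurableType d} {R : realType}.
Variable P : probability T R.
Implicit Types f g h k : T -> R.

Definition Ex f : R := \int[P]_om f om.
Definition integ f : Prop := P.-integrable [set: T] (EFin \o f).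

Lemma integ_measurable f : integ f -> measurable_fun setT f.
Proof. by move=> /integrableP[/measurable_EFinP]. Qed.

Lemma integ_cst (c : R) : integ (fun=> c).
Proof.
exact: finite_measure_integrable_cst.
Qed.

Lemma integD f g : integ f -> integ g -> integ (fun om => f om + g om).
Proof. by move=> hf hg; exact: (integrableD measurableT hf hg). Qed.

Lemma integZ (c : R) f : integ f -> integ (fun om => c * f om).
Proof. by move=> hf; exact: (integrableZl measurableT c hf). Qed.

Lemma integB f g : integ f -> integ g -> integ (fun om => f om - g om).
Proof. by move=> hf hg; exact: (integrableB measurableT hf hg). Qed.

Lemma integ_sum (J : Type) (s : seq J) (F : J -> T -> R) :
  (forall j, integ (F j)) -> integ (fun om => \sum_(j <- s) F j om).
Proof.
move=> h; elim: s => [|j s IH].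
  by under eq_fun do rewrite big_nil; exact: integ_cst.
by under eq_fun do rewrite big_cons; exact: integD.
Qed.

Lemma integ_dominated f g : measurable_fun setT f -> integ g ->
  (forall om, `|f om| <= g om) -> integ f.
Proof.
move=> mf ig fg; apply: (le_integrable measurableT _ _ ig); first exact/measurable_EFinP.
by move=> om _ /=; rewrite lee_fin (le_trans (fg om))// ler_norm.
Qed.

Lemma integ_ge0 f (c : R) : measurable_fun setT f -> (forall om, 0 <= f om) ->
  (\int[P]_om (f om)%:E = c%:E)%E -> integ f /\ Ex f = c.
Proof.
move=> mf f0 h; split; last by rewrite /Ex /Rintegral h.
apply/integrableP; split; first exact/measurable_EFinP.
under eq_integral => om _ do rewrite /= ger0_norm//.
by rewrite h ltry.
Qed.

Lemma EFin_Ex f : integ f -> (\int[P]_om (f om)%:E = (Ex f)%:E)%E.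
Proof. by move=> hf; rewrite /Ex /Rintegral fineK//; exact: integrable_fin_num. Qed.

Lemma ExD f g : integ f -> integ g -> Ex (fun om => f om + g om) = Ex f + Ex g.
Proof. by move=> hf hg; exact: RintegralD. Qed.

Lemma ExB f g : integ f -> integ g -> Ex (fun om => f om - g om) = Ex f - Ex g.
Proof. by move=> hf hg; exact: RintegralB. Qed.

Lemma ExZ (c : R) f : integ f -> Ex (fun om => c * f om) = c * Ex f.
Proof. by move=> hf; exact: RintegralZl. Qed.

Lemma Ex_cst (c : R) : Ex (fun=> c) = c.
Proof. by rewrite /Ex /Rintegral integral_cst//= probability_setT mule1. Qed.

Lemma Ex_sum (J : Type) (s : seq J) (F : J -> T -> R) :
  (forall j, integ (F j)) -> Ex (fun om => \sum_(j <- s) F j om) = \sum_(j <- s) Ex (F j).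
Proof.
move=> h; elim: s => [|j s IH].
  by under eq_fun do rewrite big_nil; rewrite big_nil Ex_cst.
under eq_fun do rewrite big_cons.
by rewrite ExD// ?big_cons ?IH//; exact: integ_sum.
Qed.

Lemma le_Ex f g : integ f -> integ g -> (forall om, f om <= g om) -> Ex f <= Ex g.
Proof. by move=> hf hg fg; apply: le_Rintegral. Qed.

Lemma eq_Ex f g : (forall om, f om = g om) -> Ex f = Ex g.
Proof. by move=> fg; congr Ex; apply/funext. Qed.

End Expect.

(** * Linear combinations of i.i.d. normal variables and their moments *)

Section GaussianSpace.
Context {d : measure_display} {T : measurableType d} {R : realType}.
Variable P : probability T R.
Context {I : eqType}.
Variable X : I -> {RV P >-> R}.
Hypothesis hX : iid_std_normal X.
Notation N01 := (@normal_prob R 0 1).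
Notation Ex := (Ex P).
Notation integ := (integ P).

Definition linform (s : seq I) (a : I -> R) (om : T) : R := \sum_(i <- s) a i * X i om.

Lemma measurable_linform s a : measurable_fun setT (linform s a).
Proof. by apply: measurable_sum => i; exact: measurable_funM. Qed.

Lemma measurable_linform_without k s a : k \notin s ->
  measurable_fun setT (linform s a : without X k -> R).
Proof.
elim: s => [|i s IH] ks.
  have -> : linform [::] a = cst 0 by apply/funext => om; rewrite /linform big_nil.
  exact: measurable_cst.
move: ks; rewrite inE negb_or => /andP[ki ks].
have -> : linform (i :: s) a = (fun om => a i * X i om + linform s a om).
  by apply/funext => om; rewrite /linform big_cons.
apply: measurable_funD; last exact: IH.
by apply: measurable_funM => //; apply: measurable_other; rewrite eq_sym.
Qed.

Lemma peel_affine_pow k (a : R) n (g : T -> R) : ~~ odd n ->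
  measurable_fun setT (g : without X k -> R) ->
  (\int[P]_om ((g om + a * X k om) ^+ n)%:E
   = \int[P]_om \int[N01]_x ((g om + a * x) ^+ n)%:E)%E.
Proof.
move=> en mg.
pose F (z : measurableTypeR R * without X k) : \bar R := ((g z.2 + a * z.1) ^+ n)%:E.
rewrite -(@peel _ _ _ _ _ _ hX k F)//; last first.
  by move=> z; rewrite lee_fin exprn_even_ge0.
apply/measurable_EFinP; apply: measurable_funX; apply: measurable_funD.
  by apply: (measurableT_comp mg); exact: measurable_snd.
by apply: measurable_funM => //; exact: measurable_fst.
Qed.

Let q (s : seq I) (a : I -> R) : R := \sum_(i <- s) a i ^+ 2.

Let q_ge0 s a : 0 <= q s a.
Proof. by apply: sumr_ge0 => i _; exact: sqr_ge0. Qed.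

Let mpow (s : seq I) a (c : R) n : measurable_fun setT (fun om => ((c + linform s a om) ^+ n)%:E).
Proof.
apply/measurable_EFinP; apply: measurable_funX; apply: measurable_funD => //.
exact: measurable_linform.
Qed.

Let step s a k (c : R) om : c + linform (k :: s) a om = (c + linform s a om) + a k * X k om.
Proof. by rewrite /linform big_cons; ring. Qed.

Let mcl s a k (c : R) : k \notin s ->
  measurable_fun setT ((fun om => c + linform s a om) : without X k -> R).
Proof. by move=> ks; apply: measurable_funD => //; exact: measurable_linform_without. Qed.

(** The head variable is integrated out, the rest of the form acting as the constant in
    [normal_affine2]. A nonzero shift c is what later gives access to the mean. *)
Let moment2 s a (c : R) : uniq s ->
  (\int[P]_om ((c + linform s a om) ^+ 2)%:E = (c ^+ 2 + q s a)%:E)%E.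
Proof.
elim: s => [|k s IH] /=.
  move=> _; under eq_integral do rewrite /linform big_nil addr0.
  by rewrite /q big_nil addr0 integral_cst//= probability_setT mule1.
move=> /andP[ks us].
under eq_integral do rewrite step.
rewrite (peel_affine_pow _ _ (mcl _ _ ks))//.
under eq_integral do rewrite normal_affine2 EFinD.
have p2 (y : R) : (0 <= (y ^+ 2)%:E)%E by rewrite lee_fin sqr_ge0.
have m2 := mpow s a c 2.
rewrite ge0_integralD//=.
rewrite IH// integral_cst//= probability_setT mule1 -EFinD.
by congr EFin; rewrite /q big_cons; ring.
Qed.

Let moment4 s a (c : R) : uniq s ->
  (\int[P]_om ((c + linform s a om) ^+ 4)%:E
    = (c ^+ 4 + 6 * (c ^+ 2 * q s a) + 3 * q s a ^+ 2)%:E)%E.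
Proof.
elim: s => [|k s IH] /=.
  move=> _; under eq_integral do rewrite /linform big_nil addr0.
  rewrite /q big_nil integral_cst//= probability_setT mule1.
  by congr EFin; ring.
move=> /andP[ks us].
under eq_integral do rewrite step.
rewrite (peel_affine_pow _ _ (mcl _ _ ks))//.
have p2 (y : R) : (0 <= (y ^+ 2)%:E)%E by rewrite lee_fin sqr_ge0.
have p4 (y : R) : (0 <= (y ^+ 4)%:E)%E by rewrite lee_fin exprn_even_ge0.
set k2 := 6 * a k ^+ 2; set k4 := 3 * a k ^+ 4.
have k2_ge0 : (0 <= k2%:E)%E by rewrite lee_fin mulr_ge0// sqr_ge0.
have k4_ge0 : (0 <= k4%:E)%E by rewrite lee_fin mulr_ge0// exprn_even_ge0.
have E om : (\int[N01]_x (((c + linform s a om) + a k * x) ^+ 4)%:E =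
   ((c + linform s a om) ^+ 4)%:E + (k2%:E * ((c + linform s a om) ^+ 2)%:E + k4%:E))%E.
  by rewrite normal_affine4 -EFinM -!EFinD; congr EFin; rewrite /k2 /k4; ring.
under eq_integral do rewrite E.
have m20 := mpow s a c 2; have m4 := mpow s a c 4.
have m2 : measurable_fun setT (fun om => k2%:E * ((c + linform s a om) ^+ 2)%:E)%E.
  exact: emeasurable_funM.
have pp2 (y : R) : (0 <= k2%:E * (y ^+ 2)%:E)%E by rewrite mule_ge0.
have pp4 (y : R) : (0 <= k2%:E * (y ^+ 2)%:E + k4%:E)%E by rewrite adde_ge0.
have m24 : measurable_fun setT (fun om => k2%:E * ((c + linform s a om) ^+ 2)%:E + k4%:E)%E.
  exact: emeasurable_funD.
rewrite ge0_integralD//= ge0_integralD//= ge0_integralZl//=.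
rewrite IH// moment2// integral_cst//= probability_setT mule1 -EFinM -!EFinD.
by congr EFin; rewrite /q big_cons -/(q s a) /k2 /k4; ring.
Qed.

(** The linear span of the X i. Absence of repetitions in s lets the variables be integrated out one
    at a time. *)
Definition gaussian (f : T -> R) := exists s a, uniq s /\ f = linform s a.

Lemma gaussian_measurable f : gaussian f -> measurable_fun setT f.
Proof. by move=> [s [a [_ ->]]]; exact: measurable_linform. Qed.

Lemma gaussian0 : gaussian (fun=> 0).
Proof.
exists [::], (fun=> 0); split => //.
by apply/funext => om; rewrite /linform big_nil.
Qed.

Lemma gaussianX i : gaussian (X i).
Proof.
exists [:: i], (fun=> 1); split => //.
by apply/funext => om; rewrite /linform big_seq1 mul1r.
Qed.

Lemma gaussianZ (c : R) f : gaussian f -> gaussian (fun om => c * f om).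
Proof.
move=> [s [a [us ->]]]; exists s, (fun i => c * a i); split => //.
by apply/funext => om; rewrite /linform mulr_sumr; apply: eq_bigr => i _; rewrite mulrA.
Qed.

Let linform_extend s s' a : uniq s -> uniq s' -> {subset s <= s'} ->
  linform s a = linform s' (fun i => if i \in s then a i else 0).
Proof.
move=> us us' ss'; apply/funext => om; rewrite /linform.
have -> : \sum_(i <- s') (if i \in s then a i else 0) * X i om =
    \sum_(i <- s' | i \in s) a i * X i om.
  by rewrite [RHS]big_mkcond/=; apply: eq_bigr => i _; case: ifP => // _; rewrite mul0r.
rewrite -[RHS]big_filter; apply: perm_big; apply: uniq_perm => //.
  exact: filter_uniq.
by move=> i; rewrite mem_filter; case: (boolP (i \in s)) => // /ss' ->.
Qed.

Lemma gaussianD f g : gaussian f -> gaussian g -> gaussian (fun om => f om + g om).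
Proof.
move=> [s [a [us ->]]] [s' [a' [us' ->]]].
have u := undup_uniq (s ++ s').
rewrite (linform_extend a us u); last by move=> i; rewrite mem_undup mem_cat => ->.
rewrite (linform_extend a' us' u); last by move=> i; rewrite mem_undup mem_cat orbC => ->.
move: (fun i => if i \in s then a i else 0) (fun i => if i \in s' then a' i else 0) => b b'.
exists (undup (s ++ s')), (fun i => b i + b' i); split => //.
by apply/funext => om; rewrite /linform -big_split/=; apply: eq_bigr => i _; rewrite mulrDl.
Qed.

Lemma gaussianB f g : gaussian f -> gaussian g -> gaussian (fun om => f om - g om).
Proof.
move=> hf hg; have := gaussianD hf (gaussianZ (-1) hg).
by congr gaussian; apply/funext => om; rewrite mulN1r.
Qed.

Lemma gaussian_sum (J : Type) (s : seq J) (F : J -> T -> R) :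
  (forall j, gaussian (F j)) -> gaussian (fun om => \sum_(j <- s) F j om).
Proof.
move=> h; elim: s => [|j s IH].
  by under eq_fun do rewrite big_nil; exact: gaussian0.
by under eq_fun do rewrite big_cons; exact: gaussianD.
Qed.

Definition ip (f g : T -> R) := Ex (fun om => f om * g om).

Lemma ipC f g : ip f g = ip g f.
Proof. by apply: eq_Ex => om; rewrite mulrC. Qed.

Lemma gaussian_sqr f : gaussian f -> integ (fun om => f om ^+ 2).
Proof.
move=> [s [a [us ->]]]; have := moment2 a 0 us.
under eq_integral do rewrite add0r.
move=> /integ_ge0 [] //; last by move=> om; exact: sqr_ge0.
by apply: measurable_funX; exact: measurable_linform.
Qed.

Lemma gaussian_pow4 f : gaussian f ->
  integ (fun om => f om ^+ 4) /\ Ex (fun om => f om ^+ 4) = 3 * ip f f ^+ 2.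
Proof.
move=> [s [a [us ->]]]; have := moment4 a 0 us; have := moment2 a 0 us.
under eq_integral do rewrite add0r.
have mf := measurable_linform s a.
move=> /integ_ge0 [||_ h2]; [exact: measurable_funX|by move=> om; exact: sqr_ge0|].
under eq_integral do rewrite add0r.
move=> /integ_ge0 [||i4 h4]; [exact: measurable_funX|by move=> om; rewrite exprn_even_ge0|].
split => //; rewrite h4 /ip; under eq_Ex do rewrite -expr2.
by rewrite h2; ring.
Qed.

Lemma gaussian_prod f g : gaussian f -> gaussian g -> integ (fun om => f om * g om).
Proof.
move=> hf hg.
apply: (integ_dominated _ (integD (gaussian_sqr hf) (gaussian_sqr hg))).
  by apply: measurable_funM; exact: gaussian_measurable.
move=> om /=; rewrite ler_norml.
by have := sqr_ge0 (f om - g om); have := sqr_ge0 (f om + g om); nra.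
Qed.

Lemma gaussian_integ f : gaussian f -> integ f.
Proof.
move=> hf; apply: (integ_dominated _ (integD (integ_cst P 1) (gaussian_sqr hf))).
  exact: gaussian_measurable.
by move=> om /=; rewrite ler_norml; nra.
Qed.

(** The second moment with shift 1 gives E (1 + f)^2 = 1 + E f^2; expanding the square leaves 2 E f
    = 0. *)
Lemma gaussian_mean f : gaussian f -> Ex f = 0.
Proof.
move=> hf; have [s [a [us fE]]] := hf.
have := moment2 a 1 us; have := moment2 a 0 us.
under eq_integral do rewrite add0r.
have mf := measurable_linform s a.
move=> /integ_ge0 [||_ h2]; [exact: measurable_funX|by move=> om; exact: sqr_ge0|].
move=> /integ_ge0 [||_ h1]; [|by move=> om; exact: sqr_ge0|].
  by apply: measurable_funX; exact: measurable_funD.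
have : Ex (fun om => (1 + f om) ^+ 2) = Ex (fun om => (1 + 2 * f om) + f om ^+ 2).
  by apply: eq_Ex => om; ring.
have i1 := integ_cst P 1; have i2 := integZ 2 (gaussian_integ hf).
rewrite ExD//; [|exact: integD|exact: gaussian_sqr].
rewrite ExD// Ex_cst ExZ; last exact: gaussian_integ.
by move: h1 h2; rewrite -fE => -> ->; lra.
Qed.

Lemma gaussian_prod4 f g h k : gaussian f -> gaussian g -> gaussian h -> gaussian k ->
  integ (fun om => f om * g om * h om * k om).
Proof.
move=> hf hg hh hk.
have [i1 _] := gaussian_pow4 hf; have [i2 _] := gaussian_pow4 hg.
have [i3 _] := gaussian_pow4 hh; have [i4 _] := gaussian_pow4 hk.
apply: (integ_dominated _ (integD (integD i1 i2) (integD i3 i4))).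
  by do ![apply: measurable_funM; last exact: gaussian_measurable]; exact: gaussian_measurable.
move=> om /=; move: (f om) (g om) (h om) (k om) => {f g h k hf hg hh hk i1 i2 i3 i4}x y z w.
have x2 (t : R) : t ^+ 4 = t ^+ 2 ^+ 2 by rewrite -exprM.
rewrite ler_norml !x2.
have a1 := sqr_ge0 (x ^+ 2 - y ^+ 2); have a2 := sqr_ge0 (z ^+ 2 - w ^+ 2).
have a3 := sqr_ge0 (x * y - z * w); have a4 := sqr_ge0 (x * y + z * w).
nra.
Qed.

Lemma ipDl f g h : gaussian f -> gaussian g -> gaussian h ->
  ip (fun om => f om + g om) h = ip f h + ip g h.
Proof.
move=> hf hg hh; rewrite /ip; under eq_Ex do rewrite mulrDl.
by rewrite ExD//; exact: gaussian_prod.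
Qed.

Lemma ipZl (c : R) f h : gaussian f -> gaussian h ->
  ip (fun om => c * f om) h = c * ip f h.
Proof.
move=> hf hh; rewrite /ip; under eq_Ex do rewrite -mulrA.
by rewrite ExZ//; exact: gaussian_prod.
Qed.

Lemma ipBl f g h : gaussian f -> gaussian g -> gaussian h ->
  ip (fun om => f om - g om) h = ip f h - ip g h.
Proof.
move=> hf hg hh; rewrite /ip; under eq_Ex do rewrite mulrBl.
by rewrite ExB//; exact: gaussian_prod.
Qed.

Lemma ipDr f g h : gaussian f -> gaussian g -> gaussian h ->
  ip h (fun om => f om + g om) = ip h f + ip h g.
Proof. by move=> *; rewrite ipC ipDl// ipC [ip g h]ipC. Qed.

Lemma ipBr f g h : gaussian f -> gaussian g -> gaussian h ->
  ip h (fun om => f om - g om) = ip h f - ip h g.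
Proof. by move=> *; rewrite ipC ipBl// ipC [ip g h]ipC. Qed.

Lemma ip_suml (J : Type) (s : seq J) (F : J -> T -> R) h :
  (forall j, gaussian (F j)) -> gaussian h ->
  ip (fun om => \sum_(j <- s) F j om) h = \sum_(j <- s) ip (F j) h.
Proof.
move=> hF hh; rewrite /ip; under eq_Ex do rewrite mulr_suml.
by rewrite Ex_sum// => j; exact: gaussian_prod.
Qed.

Lemma ip_ge0 f : 0 <= ip f f.
Proof. by apply: Rintegral_ge0 => om _; rewrite -expr2 sqr_ge0. Qed.

Lemma ip_sqrD f g : gaussian f -> gaussian g ->
  ip (fun om => f om + g om) (fun om => f om + g om) = ip f f + 2 * ip f g + ip g g.
Proof.
move=> hf hg; have hp := gaussianD hf hg.
by rewrite (ipDl hf hg hp) (ipDr hf hg hf) (ipDr hf hg hg) (ipC g f); ring.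
Qed.

Lemma ip_sqrB f g : gaussian f -> gaussian g ->
  ip (fun om => f om - g om) (fun om => f om - g om) = ip f f - 2 * ip f g + ip g g.
Proof.
move=> hf hg; have hm := gaussianB hf hg.
by rewrite (ipBl hf hg hm) (ipBr hf hg hf) (ipBr hf hg hg) (ipC g f); ring.
Qed.

(** Polarization of the fourth moment: 12 f^2 g^2 = (f + g)^4 + (f - g)^4 - 2 (f^4 + g^4). *)
Let polar2 f g : gaussian f -> gaussian g ->
  Ex (fun om => f om * f om * g om * g om) = ip f f * ip g g + 2 * ip f g ^+ 2.
Proof.
move=> hf hg.
have hp := gaussianD hf hg; have hm := gaussianB hf hg.
have [ip4 ep] := gaussian_pow4 hp; have [im4 em] := gaussian_pow4 hm.
have [if4 ef] := gaussian_pow4 hf; have [ig4 eg] := gaussian_pow4 hg.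
have -> : Ex (fun om => f om * f om * g om * g om) = Ex (fun om => 12^-1 *
   (((f om + g om) ^+ 4 + (f om - g om) ^+ 4) - 2 * (f om ^+ 4 + g om ^+ 4))).
  by apply: eq_Ex => om; field.
have i1 := integD ip4 im4; have i2 := integZ 2 (integD if4 ig4).
rewrite ExZ; last exact: integB.
rewrite ExB// ExD// ep em ExZ; last exact: integD.
rewrite ExD// ef eg.
rewrite (ip_sqrD hf hg) (ip_sqrB hf hg).
by field.
Qed.

Let polar3 f g h : gaussian f -> gaussian g -> gaussian h ->
  Ex (fun om => f om * f om * g om * h om) = ip f f * ip g h + 2 * (ip f g * ip f h).
Proof.
move=> hf hg hh.
have hp := gaussianD hg hh; have hm := gaussianB hg hh.
have -> : Ex (fun om => f om * f om * g om * h om) = Ex (fun om => 4^-1 *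
   (f om * f om * (g om + h om) * (g om + h om) - f om * f om * (g om - h om) * (g om - h om))).
  by apply: eq_Ex => om; field.
have i1 := gaussian_prod4 hf hf hp hp; have i2 := gaussian_prod4 hf hf hm hm.
rewrite ExZ; last exact: integB.
rewrite ExB// !polar2//.
rewrite (ip_sqrD hg hh) (ip_sqrB hg hh) (ipDr hg hh hf) (ipBr hg hh hf).
by field.
Qed.

(** Two more polarizations, in the last pair of factors ([polar3]) and here in the first pair,
    reduce the mixed moment to E f^4 = 3 (E f^2)^2. *)
Lemma isserlis f g h k : gaussian f -> gaussian g -> gaussian h -> gaussian k ->
  Ex (fun om => f om * g om * h om * k om) =
  ip f g * ip h k + ip f h * ip g k + ip f k * ip g h.
Proof.
move=> hf hg hh hk.
have hp := gaussianD hf hg; have hm := gaussianB hf hg.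
have -> : Ex (fun om => f om * g om * h om * k om) = Ex (fun om => 4^-1 *
   ((f om + g om) * (f om + g om) * h om * k om - (f om - g om) * (f om - g om) * h om * k om)).
  by apply: eq_Ex => om; field.
have i1 := gaussian_prod4 hp hp hh hk; have i2 := gaussian_prod4 hm hm hh hk.
rewrite ExZ; last exact: integB.
rewrite ExB// !polar3//.
rewrite (ip_sqrD hf hg) (ip_sqrB hf hg) (ipDl hf hg hh) (ipDl hf hg hk).
rewrite (ipBl hf hg hh) (ipBl hf hg hk).
by field.
Qed.

Let ip_linform s a : uniq s -> ip (linform s a) (linform s a) = q s a.
Proof.
move=> us; have := moment2 a 0 us.
under eq_integral do rewrite add0r.
move=> /integ_ge0 [||_ h2].
- by apply: measurable_funX; exact: measurable_linform.
- by move=> om; exact: sqr_ge0.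
- by rewrite /ip; under eq_Ex do rewrite -expr2; rewrite h2 expr0n/= add0r.
Qed.

Lemma ip_XX i j : ip (X i) (X j) = (i == j)%:R.
Proof.
have gE k : (X k : T -> R) = linform [:: k] (fun=> 1).
  by apply/funext => om; rewrite /linform big_seq1 mul1r.
have nrm k : ip (X k) (X k) = 1.
  by rewrite gE ip_linform// /q big_seq1 expr1n.
have [->|ij] := eqVneq i j; first exact: nrm.
have := ip_sqrD (gaussianX i) (gaussianX j); rewrite !nrm.
have -> : (fun om => X i om + X j om) = linform [:: i; j] (fun=> 1).
  by apply/funext => om; rewrite /linform big_cons big_seq1 !mul1r.
rewrite ip_linform; last by rewrite /= inE ij.
by rewrite /q big_cons big_seq1 !expr1n /= => h; rewrite mulr0n; lra.
Qed.

End GaussianSpace.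

(** * Frobenius norm and Cauchy-Schwarz inequalities *)

Section FrobeniusNorm.
Context {R : realType}.

Lemma fnorm_sqr m n (M : 'M[R]_(m, n)) : fnorm M ^+ 2 = \sum_i \sum_j M i j ^+ 2.
Proof.
by rewrite sqr_sqrtr// sumr_ge0// => i _; rewrite sumr_ge0// => j _; exact: sqr_ge0.
Qed.

Lemma fnorm_sqr_tr m n (M : 'M[R]_(m, n)) : fnorm M ^+ 2 = \tr (M *m M^T).
Proof.
rewrite fnorm_sqr; apply: eq_bigr => i _; rewrite mxE; apply: eq_bigr => j _.
by rewrite mxE expr2.
Qed.

Lemma fnorm_tr m n (M : 'M[R]_(m, n)) : fnorm M^T = fnorm M.
Proof.
by congr Num.sqrt; rewrite exchange_big; apply: eq_bigr => i _; apply: eq_bigr => j _; rewrite mxE.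
Qed.

Lemma fnorm_sqr_trl m n (M : 'M[R]_(m, n)) : fnorm M ^+ 2 = \tr (M^T *m M).
Proof. by rewrite -fnorm_tr fnorm_sqr_tr trmxK. Qed.

Lemma fnorm_sqr_mxcol (p : nat) (q : 'I_p -> nat) n (B : forall i, 'M[R]_(q i, n)) :
  fnorm (\mxcol_i B i) ^+ 2 = \sum_i fnorm (B i) ^+ 2.
Proof.
rewrite fnorm_sqr_trl tr_mxcol mul_mxrow_mxcol raddf_sum.
by apply: eq_bigr => i _; rewrite fnorm_sqr_trl.
Qed.

Lemma fnorm_sqr_mxrow (p : nat) (q : 'I_p -> nat) n (B : forall i, 'M[R]_(n, q i)) :
  fnorm (\mxrow_i B i) ^+ 2 = \sum_i fnorm (B i) ^+ 2.
Proof.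
rewrite fnorm_sqr_tr tr_mxrow mul_mxrow_mxcol raddf_sum.
by apply: eq_bigr => i _; rewrite fnorm_sqr_tr.
Qed.

Lemma fnorm_sqr_mxblock (p q : nat) (a : 'I_p -> nat) (b : 'I_q -> nat)
    (B : forall i j, 'M[R]_(a i, b j)) :
  fnorm (\mxblock_(i, j) B i j) ^+ 2 = \sum_i \sum_j fnorm (B i j) ^+ 2.
Proof.
rewrite mxblockEv fnorm_sqr_mxcol.
by apply: eq_bigr => i _; rewrite fnorm_sqr_mxrow.
Qed.

Lemma cauchy_schwarz_sum (J : finType) (x y : J -> R) :
  (\sum_j x j * y j) ^+ 2 <= (\sum_j x j ^+ 2) * (\sum_j y j ^+ 2).
Proof.
set a := \sum_j x j ^+ 2; set b := \sum_j y j ^+ 2; set c := \sum_j _.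
have a0 : 0 <= a by apply: sumr_ge0 => *; exact: sqr_ge0.
(* The choice (s, t) = (c, a) will give a (a b - c^2) >= 0; hence the separate treatment of a =
   0. *)
have quad (s t : R) : 0 <= s ^+ 2 * a - 2 * (s * t) * c + t ^+ 2 * b.
  have : 0 <= \sum_j (s * x j - t * y j) ^+ 2 by apply: sumr_ge0 => *; exact: sqr_ge0.
  have -> // : \sum_j (s * x j - t * y j) ^+ 2 = s ^+ 2 * a - 2 * (s * t) * c + t ^+ 2 * b.
  rewrite /a /b /c !mulr_sumr -sumrB -big_split/=; apply: eq_bigr => j _; ring.
have [a00|a0'] := eqVneq a 0.
  suff -> : c = 0 by rewrite expr0n/= a00 mul0r.
  have x0 j : x j = 0.
    have := a00; rewrite /a => /eqP; rewrite psumr_eq0 => [|i _]; last exact: sqr_ge0.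
    by move=> /allP/(_ j); rewrite mem_index_enum => /(_ isT) /=; rewrite sqrf_eq0 => /eqP.
  by rewrite /c big1// => j _; rewrite x0 mul0r.
have apos : 0 < a by rewrite lt_neqAle eq_sym a0'.
have := quad c a; rewrite -(pmulr_rge0 _ apos).
have -> : c ^+ 2 * a - 2 * (c * a) * c + a ^+ 2 * b = a * (a * b - c ^+ 2) by ring.
by rewrite mulrA pmulr_rge0 ?mulr_gt0// subr_ge0.
Qed.

Lemma sqr_sum_le m (x : 'I_m -> R) : (\sum_j x j) ^+ 2 <= m%:R * \sum_j x j ^+ 2.
Proof.
have := cauchy_schwarz_sum (fun=> 1) x.
under eq_bigr do rewrite mul1r.
by under [X in _ <= X * _]eq_bigr do rewrite expr1n; rewrite sumr_const card_ord.
Qed.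

Lemma pow4_sum_le m (x : 'I_m -> R) :
  (\sum_j x j) ^+ 4 <= m%:R ^+ 3 * \sum_j x j ^+ 4.
Proof.
rewrite (exprM _ 2 2); apply: (@le_trans _ _ ((m%:R * \sum_j x j ^+ 2) ^+ 2)).
  rewrite ler_pXn2r ?sqr_sum_le// nnegrE ?sqr_ge0// mulr_ge0//.
  by apply: sumr_ge0 => *; exact: sqr_ge0.
rewrite exprMn [_ ^+ 3]exprSr -mulrA ler_wpM2l ?exprn_ge0//.
apply: le_trans (sqr_sum_le _) _; rewrite le_eqVlt; apply/orP; left; apply/eqP.
by congr (_ * _); apply: eq_bigr => j _; rewrite -exprM.
Qed.

Lemma fnorm_sqr_mulmx m n p (A : 'M[R]_(m, n)) (B : 'M[R]_(n, p)) :
  fnorm (A *m B) ^+ 2 <= fnorm A ^+ 2 * fnorm B ^+ 2.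
Proof.
rewrite [in leLHS]fnorm_sqr [fnorm A ^+ 2]fnorm_sqr -(fnorm_tr B) fnorm_sqr mulr_suml.
apply: ler_sum => i _; rewrite mulr_sumr; apply: ler_sum => j _.
rewrite mxE; apply: (le_trans (cauchy_schwarz_sum _ _)).
by under [X in _ <= _ * X]eq_bigr do rewrite mxE.
Qed.

End FrobeniusNorm.

(** * Deterministic error bound for least squares *)

Section LeastSquares.
Context {R : realType} {p m : nat}.
Variables (n : nat) (eta : nat -> 'cV[R]_p) (y : nat -> 'cV[R]_m) (D : 'M[R]_(p, m)).

(** Here eta stands for the residual of a reference predictor and D for the deviation of the
    minimizer from it; the left side is then the empirical risk of the minimizer. *)
Hypothesis minD : \sum_(1 <= t < n.+1) fnorm (eta t - D *m y t) ^+ 2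
  <= \sum_(1 <= t < n.+1) fnorm (eta t) ^+ 2.

Let W := \sum_(1 <= t < n.+1) fnorm (D *m y t) ^+ 2.
Let S := \sum_(1 <= t < n.+1) fnorm (eta t) ^+ 2.
Let Q i j := \sum_(1 <= t < n.+1) eta t i 0 * y t j 0.

Lemma fnorm_sqr_cV k (x : 'cV[R]_k) : fnorm x ^+ 2 = \sum_i x i 0 ^+ 2.
Proof. by rewrite fnorm_sqr; apply: eq_bigr => i _; rewrite big_ord1. Qed.

Let cross t := \sum_i eta t i 0 * (D *m y t) i 0.

Let expand t : fnorm (eta t - D *m y t) ^+ 2 =
  fnorm (eta t) ^+ 2 - 2 * cross t + fnorm (D *m y t) ^+ 2.
Proof.
rewrite !fnorm_sqr_cV /cross mulr_sumr -sumrB -big_split/=; apply: eq_bigr => i _.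
by rewrite 2!mxE; ring.
Qed.

Let W_cross : W <= 2 * \sum_(1 <= t < n.+1) cross t.
Proof.
have := minD; under eq_bigr do rewrite expand.
by rewrite big_split/= sumrB -mulr_sumr -/W; lra.
Qed.

(** The cross term is split by 2ab <= 2a^2 + b^2/2, so that W <= 2 S + W/2. *)
Lemma ls_fitted_le_noise : W <= 4 * S.
Proof.
have : 2 * \sum_(1 <= t < n.+1) cross t <= 2 * S + 2^-1 * W.
  rewrite /S /W !mulr_sumr -big_split/=; apply: ler_sum => t _.
  rewrite !fnorm_sqr_cV /cross !mulr_sumr -big_split/=; apply: ler_sum => i _.
  have := sqr_ge0 (2 * eta t i 0 - (D *m y t) i 0); nra.
have := W_cross; lra.
Qed.

Lemma ls_fitted_le_cross : W <= 2 * \sum_i \sum_j Q i j * D i j.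
Proof.
apply: (le_trans W_cross); rewrite le_eqVlt; apply/orP; left; apply/eqP; congr (_ * _).
rewrite /cross exchange_big/=; apply: eq_bigr => i _.
rewrite /Q; under [RHS]eq_bigr do rewrite mulr_suml.
rewrite [RHS]exchange_big/=; apply: eq_bigr => t _.
by rewrite mxE mulr_sumr; apply: eq_bigr => j _; ring.
Qed.

(* K is a truncation level: for tau <= K the cross term controls D, and for
   K < tau the crude bound W <= 4 S suffices. *)
Lemma ls_error_bound (tau K : R) : 0 <= tau -> 0 < K -> fnorm D ^+ 2 <= tau * W ->
  fnorm D ^+ 2 <= 4 * K ^+ 2 * (\sum_i \sum_j Q i j ^+ 2) + 4 * tau ^+ 2 * S / K.
Proof.
move=> tau0 K0 DW.
have S0 : 0 <= S by apply: sumr_ge0 => *; exact: sqr_ge0.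
have Q0 : 0 <= \sum_i \sum_j Q i j ^+ 2.
  by apply: sumr_ge0 => *; apply: sumr_ge0 => *; exact: sqr_ge0.
have [tauK|Ktau] := leP tau K; last first.
  apply: (@le_trans _ _ (4 * tau ^+ 2 * S / K)); last first.
    by rewrite lerDr mulr_ge0// mulr_ge0// sqr_ge0.
  apply: (le_trans DW); rewrite ler_pdivlMr//.
  have := ls_fitted_le_noise => W4.
  have : tau * W <= tau * (4 * S) by rewrite ler_wpM2l.
  move=> h; apply: (@le_trans _ _ (tau * (4 * S) * K)); first by rewrite ler_wpM2r// ltW.
  have -> : 4 * tau ^+ 2 * S = tau * (4 * S) * tau by ring.
  by rewrite ler_wpM2l ?(ltW Ktau)// mulr_ge0// mulr_ge0.
apply: (@le_trans _ _ (4 * K ^+ 2 * (\sum_i \sum_j Q i j ^+ 2))); last first.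
  rewrite lerDl mulr_ge0 ?invr_ge0 ?(ltW K0)//.
  by rewrite mulr_ge0// mulr_ge0// sqr_ge0.
have [tz|tz] := eqVneq tau 0.
  by apply: (le_trans DW); rewrite tz mul0r mulr_ge0// mulr_ge0// sqr_ge0.
have tpos : 0 < tau by rewrite lt_neqAle eq_sym tz.
apply: (@le_trans _ _ (4 * tau ^+ 2 * (\sum_i \sum_j Q i j ^+ 2))); last first.
  by rewrite ler_wpM2r// ler_wpM2l// ler_pXn2r ?nnegrE// ltW.
(* Young's inequality 2 tau Q D <= 2 tau^2 Q^2 + D^2/2; the half of |D|^2 is then absorbed by the
   left side. *)
have h : tau * (2 * \sum_i \sum_j Q i j * D i j) <=
    2 * tau ^+ 2 * (\sum_i \sum_j Q i j ^+ 2) + 2^-1 * fnorm D ^+ 2.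
  rewrite fnorm_sqr !mulr_sumr -big_split/=; apply: ler_sum => i _.
  rewrite !mulr_sumr -big_split/=; apply: ler_sum => j _.
  have := sqr_ge0 (2 * tau * Q i j - D i j); nra.
have : fnorm D ^+ 2 <= tau * (2 * \sum_i \sum_j Q i j * D i j).
  by apply: (le_trans DW); rewrite ler_wpM2l// ls_fitted_le_cross.
lra.
Qed.

End LeastSquares.

(** * Completing the square for matrices *)

Section CompletingSquare.
Context {R : realType} {p q : nat}.
Variables (Y : 'M[R]_q).
Hypotheses (uY : Y \in unitmx) (trY : Y^T = Y).

(** Meant for a cross covariance X + Z Y, where X is carried by the state estimate and Z is the
    coefficient of the current output. *)
Lemma schur_expand (X Z : 'M[R]_(p, q)) :
  (X + Z *m Y) *m invmx Y *m (X + Z *m Y)^T =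
  X *m invmx Y *m X^T + Z *m Y *m Z^T + X *m Z^T + Z *m X^T.
Proof.
rewrite linearD/= trmx_mul trY !(mulmxDl, mulmxDr) mulmxK// !mulmxA mulmxKV//.
move: (X *m _ *m X^T) (X *m Z^T) (Z *m X^T) (Z *m Y *m Z^T) => a b c e.
by apply/matrixP => k l; rewrite !mxE; ring.
Qed.

Lemma complete_square (V : 'M[R]_p) (N G : 'M[R]_(p, q)) :
  V - G *m N^T - N *m G^T + G *m Y *m G^T = (V - N *m invmx Y *m N^T)
  + (G - N *m invmx Y) *m Y *m (G - N *m invmx Y)^T.
Proof.
rewrite linearB/= trmx_mul trmx_inv trY !(mulmxBl, mulmxBr) mulmxKV// !mulmxA mulmxK//.
move: (G *m N^T) (N *m G^T) (G *m _ *m G^T) (N *m _ *m N^T) => a b c e.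
by apply/matrixP => k l; rewrite !mxE; ring.
Qed.

End CompletingSquare.

(** * Covariance algebra of the innovations form *)

Section Innovations.
Context {R : realType} {dx dy : nat}.
Variables (A Bw : 'M[R]_dx) (C : 'M[R]_(dy, dx)) (Dv : 'M[R]_dy).
Variables (S Sh : 'M[R]_dx) (De : 'M[R]_dy).
Let D := innovation_cov C Dv S.
Let K := kalman_gain A C Dv S.
Hypothesis hDv : pdmx (Dv *m Dv^T).
Hypothesis psdS : psdmx S.
Hypothesis riccati : S = A *m S *m A^T
  - A *m S *m C^T *m invmx (innovation_cov C Dv S) *m C *m S *m A^T + Bw *m Bw^T.
Hypothesis hDe : is_sqrtmx D De.
Hypothesis lyapunov : Sh = A *m Sh *m A^T + (K *m De) *m (K *m De)^T.

Lemma pdmx_unit n (M : 'M[R]_n) : pdmx M -> M \in unitmx.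
Proof.
move=> [_ pM]; rewrite -row_free_unit -kermx_eq0; apply/eqP/row_matrixP => i.
rewrite row0; apply/eqP/negPn/negP => ri0.
have := pM (row i (kermx M))^T; rewrite trmx_eq0 => /(_ ri0).
have : row i (kermx M) *m M = 0 by apply/sub_kermxP; exact: row_sub.
by rewrite trmxK => ->; rewrite mul0mx mxE ltxx.
Qed.

Lemma pdmxD n (M N : 'M[R]_n) : psdmx M -> pdmx N -> pdmx (M + N).
Proof.
move=> [tM pM] [tN pN]; split; first by rewrite linearD/= tM tN.
move=> u u0; rewrite mulmxDr mulmxDl mxE.
by have := pM u; have := pN u u0; lra.
Qed.

Lemma psdmx_congr n m (M : 'M[R]_n) (B : 'M[R]_(m, n)) : psdmx M -> psdmx (B *m M *m B^T).
Proof.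
move=> [tM pM]; split; first by rewrite !trmx_mul trmxK tM mulmxA.
by move=> u; have := pM (B^T *m u); rewrite trmx_mul trmxK !mulmxA.
Qed.

Let pdD : pdmx D.
Proof. by apply: pdmxD => //; exact: psdmx_congr. Qed.

Let unitD : D \in unitmx. Proof. exact: pdmx_unit. Qed.

Let trD : D^T = D. Proof. by case: pdD. Qed.

Let trS : S^T = S. Proof. by case: psdS. Qed.

Let DeE : De *m De^T = D. Proof. by case: hDe => -[-> _] ->. Qed.

Let KD : K *m D = A *m S *m C^T.
Proof. by rewrite /K /kalman_gain -/D mulmxKV. Qed.

Let Q := K *m D *m K^T.

Let KDeE : (K *m De) *m (K *m De)^T = Q.
Proof. by rewrite trmx_mul /Q -DeE !mulmxA. Qed.

Let QE : Q = A *m S *m C^T *m invmx D *m C *m S *m A^T.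
Proof.
rewrite /Q KD /K /kalman_gain -/D !trmx_mul trmx_inv trD trmxK trS.
by rewrite !mulmxA.
Qed.

Let ShE : Sh = A *m Sh *m A^T + Q. Proof. by rewrite -KDeE. Qed.

(** The state is the Kalman estimate plus an error uncorrelated with it, of covariances [Sh] and
    [S]. The lemmas below recover this decomposition algebraically. *)
Definition state_cov := Sh + S.
Definition output_cov := C *m state_cov *m C^T + Dv *m Dv^T.

(** The term subtracted in the Riccati equation is Q = K D K^T, which is also the driving term in
    the equation of [Sh]: it cancels in the sum. *)
Lemma state_cov_lyapunov : state_cov = A *m state_cov *m A^T + Bw *m Bw^T.
Proof.
rewrite /state_cov mulmxDr mulmxDl {1}ShE {1}riccati -/D -QE.
move: (A *m Sh *m A^T) Q (A *m S *m A^T) (Bw *m Bw^T) => a b c e.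
by apply/matrixP => i j; rewrite !mxE; ring.
Qed.

Lemma output_cov_innovation : output_cov = C *m Sh *m C^T + D.
Proof. by rewrite /output_cov /state_cov mulmxDr mulmxDl -addrA. Qed.

Lemma iterated_lyapunov i :
  Sh = A ^+ i *m Sh *m (A ^+ i)^T + \sum_(l < i) A ^+ l *m Q *m (A ^+ l)^T.
Proof.
elim: i => [|i IH]; first by rewrite big_ord0 addr0 expr0 trmx1 mul1mx mulmx1.
rewrite big_ord_recr/= {1}IH {1}ShE mulmxDr mulmxDl exprSr trmx_mul !mulmxA.
rewrite -[A ^+ i * A]/(A ^+ i *m A).
by rewrite -!addrA; congr (_ + _); rewrite addrC.
Qed.

Section Block.
Variable i : nat.
Let L := C *m A ^+ i.
Let Ph := L *m (A - K *m C).
Let Ps := L *m K.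

(** The stationary covariance of y_(t+i+1) with y_t. *)
Definition cross_cov := C *m A ^+ i.+1 *m state_cov *m C^T.

Let AKShE : (A - K *m C) *m Sh = A *m Sh - K *m C *m Sh.
Proof. by rewrite mulmxBl. Qed.

(** From xhat_(t+1) = (A - K C) xhat_t + K y_t, the part of y_(t+i+1) determined at time t is Ph
    xhat_t + Ps y_t, and the right side is its covariance with y_t. Algebraically, the identity
    rests on K D = A S C^T. *)
Lemma cross_cov_innovation : cross_cov = Ph *m Sh *m C^T + Ps *m output_cov.
Proof.
have -> : cross_cov = L *m (A *m state_cov *m C^T).
  by rewrite /cross_cov exprSr -[A ^+ i * A]/(A ^+ i *m A) /L !mulmxA.
have -> : Ph *m Sh *m C^T = L *m ((A - K *m C) *m Sh *m C^T) by rewrite /Ph !mulmxA.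
have -> : Ps *m output_cov = L *m (K *m output_cov) by rewrite /Ps !mulmxA.
rewrite -mulmxDr; congr (L *m _).
rewrite output_cov_innovation mulmxDr KD AKShE mulmxBl /state_cov mulmxDr mulmxDl !mulmxA.
move: (A *m Sh *m C^T) (A *m S *m C^T) (K *m C *m Sh *m C^T) => a b c.
by apply/matrixP => k l; rewrite !mxE; ring.
Qed.

Let trSh : Sh^T = Sh -> (Ph *m Sh *m C^T)^T = C *m Sh *m Ph^T.
Proof. by move=> h; rewrite !trmx_mul trmxK h mulmxA. Qed.

(** The first four terms form the covariance of Ph xhat_t + Ps y_t = L xhat_(t+1), namely L Sh L^T
    ([e1]). The later innovations supply the sum ([e2], by iterating the Lyapunov equation) and
    D. *)
Lemma output_cov_blocks : Sh^T = Sh ->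
  output_cov = Ph *m Sh *m Ph^T + Ps *m output_cov *m Ps^T
    + Ph *m Sh *m C^T *m Ps^T + Ps *m C *m Sh *m Ph^T
    + (\sum_(l < i) (C *m A ^+ l *m K) *m D *m (C *m A ^+ l *m K)^T + D).
Proof.
move=> trSh'.
have e1 : Ph *m Sh *m Ph^T + Ps *m output_cov *m Ps^T
    + Ph *m Sh *m C^T *m Ps^T + Ps *m C *m Sh *m Ph^T = L *m Sh *m L^T.
  rewrite [X in _ = L *m X *m _]ShE.
  have -> : Ph *m Sh *m Ph^T = L *m ((A - K *m C) *m Sh *m (A - K *m C)^T) *m L^T.
    by rewrite /Ph trmx_mul !mulmxA.
  have -> : Ps *m output_cov *m Ps^T = L *m (K *m output_cov *m K^T) *m L^T.
    by rewrite /Ps trmx_mul !mulmxA.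
  have -> : Ph *m Sh *m C^T *m Ps^T = L *m ((A - K *m C) *m Sh *m C^T *m K^T) *m L^T.
    by rewrite /Ph /Ps trmx_mul !mulmxA.
  have -> : Ps *m C *m Sh *m Ph^T = L *m (K *m C *m Sh *m (A - K *m C)^T) *m L^T.
    by rewrite /Ph /Ps trmx_mul !mulmxA.
  rewrite -!mulmxDl -!mulmxDr; congr (L *m _ *m L^T).
  rewrite output_cov_innovation AKShE linearB/= trmx_mul.
  rewrite [K *m (_ + _)]mulmxDr [(_ + K *m D) *m _]mulmxDl -/Q.
  rewrite !(mulmxBl, mulmxBr, mulNmx, mulmxN) !mulmxA.
  move: (A *m Sh *m A^T) Q (A *m Sh *m C^T *m K^T) (K *m C *m Sh *m A^T)
    (K *m C *m Sh *m C^T *m K^T) => a b c e f.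
  by apply/matrixP => k l; rewrite !mxE; ring.
have e2 : C *m Sh *m C^T = L *m Sh *m L^T
    + \sum_(l < i) (C *m A ^+ l *m K) *m D *m (C *m A ^+ l *m K)^T.
  rewrite {1}(iterated_lyapunov i) mulmxDr mulmxDl; congr (_ + _).
    by rewrite /L trmx_mul !mulmxA.
  rewrite mulmx_sumr mulmx_suml; apply: eq_bigr => l _.
  by rewrite /Q !trmx_mul !mulmxA.
by rewrite e1 [LHS]output_cov_innovation e2 [RHS]addrA.
Qed.

(** The contribution Ps y_t is known and drops out. There remain the covariance of xhat_t once y_t
    has been regressed out, carried by Ph, and the innovations that come after t. *)
Lemma residual_cov : Sh^T = Sh -> output_cov \in unitmx ->
  output_cov - cross_cov *m invmx output_cov *m cross_cov^T =
  Ph *m (Sh - Sh *m C^T *m invmx output_cov *m C *m Sh) *m Ph^T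
  + (\sum_(l < i) (C *m A ^+ l *m K) *m D *m (C *m A ^+ l *m K)^T + D).
Proof.
move=> trSh' uY.
have trY : output_cov^T = output_cov.
  by rewrite output_cov_innovation linearD/= trD !trmx_mul trmxK trSh' mulmxA.
have -> : cross_cov *m invmx output_cov *m cross_cov^T =
    Ph *m (Sh *m C^T *m invmx output_cov *m C *m Sh) *m Ph^T
    + Ps *m output_cov *m Ps^T + Ph *m Sh *m C^T *m Ps^T + Ps *m C *m Sh *m Ph^T.
  rewrite cross_cov_innovation schur_expand//.
  by rewrite trSh// !mulmxA.
rewrite [in X in X - _]output_cov_blocks// mulmxBr mulmxBl.
move: (Ph *m Sh *m Ph^T) (Ps *m output_cov *m Ps^T) (Ph *m Sh *m C^T *m Ps^T)
  (Ps *m C *m Sh *m Ph^T) (Ph *m (Sh *m C^T *m _ *m C *m Sh) *m Ph^T)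
  (\sum_(l < i) _ + D) => a b c e f g.
by apply/matrixP => k l; rewrite !mxE; ring.
Qed.

Lemma prediction_risk (G : 'M[R]_dy) : Sh^T = Sh -> output_cov \in unitmx ->
  \tr (output_cov - G *m cross_cov^T - cross_cov *m G^T + G *m output_cov *m G^T) =
  \tr (output_cov - cross_cov *m invmx output_cov *m cross_cov^T)
  + \tr ((G - cross_cov *m invmx output_cov) *m output_cov
         *m (G - cross_cov *m invmx output_cov)^T).
Proof.
move=> trSh' uY.
have trY : output_cov^T = output_cov.
  by rewrite output_cov_innovation linearD/= trD !trmx_mul trmxK trSh' mulmxA.
by rewrite -linearD/= -complete_square.
Qed.

End Block.

Lemma innovation_risk (H : nat) : Sh^T = Sh -> output_cov \in unitmx ->
  \sum_(i < H) \tr (output_cov - cross_cov i *m invmx output_cov *m (cross_cov i)^T) =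
  \tr (Phi H A C K *m (Sh - Sh *m C^T *m invmx output_cov *m C *m Sh) *m (Phi H A C K)^T)
   + fnorm (Gamma_e H A C K De) ^+ 2.
Proof.
move=> trSh' uY.
rewrite /Phi /Gamma_e mxcol_mul tr_mxcol mul_mxcol_mxrow mxtrace_mxblock.
rewrite fnorm_sqr_mxblock -big_split/=; apply: eq_bigr => i _.
rewrite residual_cov// linearD/=; congr (_ + _).
rewrite linearD/= raddf_sum/=.
have sq (B : 'M[R]_(dy, dx)) : fnorm (B *m K *m De) ^+ 2 = \tr (B *m K *m D *m (B *m K)^T).
  by rewrite fnorm_sqr_tr trmx_mul -DeE !mulmxA.
have sqD : fnorm De ^+ 2 = \tr D by rewrite fnorm_sqr_tr DeE.
rewrite (bigID (fun j : 'I_H => (j < i)%N))/=; congr (_ + _).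
  rewrite (eq_bigr (fun j : 'I_H => fnorm (C *m A ^+ (i - j - 1) *m K *m De) ^+ 2)); last first.
    by move=> j ->.
  rewrite -(big_ord_widen H (fun j => fnorm (C *m A ^+ (i - j - 1) *m K *m De) ^+ 2)) 1?ltnW//.
  (* Row i of [Gamma_e] lists the exponents i - j - 1, that is l = 0, ..., i - 1 in reverse
     order. *)
  rewrite [RHS](reindex_inj rev_ord_inj); apply: eq_bigr => l _.
  have -> : (i - rev_ord l - 1)%N = l by rewrite /=; have := ltn_ord l; lia.
  by rewrite sq.
rewrite (bigD1 i) ?ltnn//= eqxx -sqD big1 ?addr0//.
move=> j /andP[ji ij]; rewrite (negbTE ji) eq_sym (negbTE ij).
by rewrite fnorm_sqr big1// => k _; rewrite big1// => l _; rewrite mxE expr0n.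
Qed.

End Innovations.

(** * Second moments of Gaussian vectors and of linear recursions *)

Section VectorMoments.
Context {d : measure_display} {T : measurableType d} {R : realType}.
Variable P : probability T R.
Context {I : eqType}.
Variable X : I -> {RV P >-> R}.
Hypothesis hX : iid_std_normal X.
Notation ip := (ip P).
Notation gaussian := (gaussian X).

Definition gvec n (z : T -> 'cV[R]_n) := forall i, gaussian (fun om => z om i 0).

(** Left uncentered: the vectors it is applied to have mean zero, so it is their cross
    covariance. *)
Definition mom n m (z : T -> 'cV[R]_n) (z' : T -> 'cV[R]_m) : 'M[R]_(n, m) :=
  \matrix_(i, j) ip (fun om => z om i 0) (fun om => z' om j 0).

Lemma gvecD n (z z' : T -> 'cV[R]_n) : gvec z -> gvec z' -> gvec (fun om => z om + z' om).
Proof.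
move=> hz hz' i; under eq_fun do rewrite mxE.
exact: gaussianD.
Qed.

Lemma gvecB n (z z' : T -> 'cV[R]_n) : gvec z -> gvec z' -> gvec (fun om => z om - z' om).
Proof.
move=> hz hz' i; under eq_fun do rewrite 2!mxE.
exact: gaussianB.
Qed.

Lemma gvecM n m (A : 'M[R]_(m, n)) (z : T -> 'cV[R]_n) : gvec z -> gvec (fun om => A *m z om).
Proof.
move=> hz i; under eq_fun do rewrite mxE.
by apply: gaussian_sum => j; exact: gaussianZ.
Qed.

Lemma gvec0 n : gvec (fun=> 0 : 'cV[R]_n).
Proof. by move=> i; under eq_fun do rewrite mxE; exact: gaussian0. Qed.

Lemma mom_tr n m (z : T -> 'cV[R]_n) (z' : T -> 'cV[R]_m) : (mom z z')^T = mom z' z.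
Proof. by apply/matrixP => i j; rewrite !mxE ipC. Qed.

Lemma momDl n m (z1 z2 : T -> 'cV[R]_n) (z' : T -> 'cV[R]_m) :
  gvec z1 -> gvec z2 -> gvec z' ->
  mom (fun om => z1 om + z2 om) z' = mom z1 z' + mom z2 z'.
Proof.
move=> h1 h2 h'; apply/matrixP => i j; rewrite !mxE -(ipDl hX)//.
by congr (ip _ _); apply/funext => om; rewrite mxE.
Qed.

Lemma momBl n m (z1 z2 : T -> 'cV[R]_n) (z' : T -> 'cV[R]_m) :
  gvec z1 -> gvec z2 -> gvec z' ->
  mom (fun om => z1 om - z2 om) z' = mom z1 z' - mom z2 z'.
Proof.
move=> h1 h2 h'; apply/matrixP => i j; rewrite !mxE -(ipBl hX)//.
by congr (ip _ _); apply/funext => om; rewrite 2!mxE.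
Qed.

Lemma momMl n m p (A : 'M[R]_(p, n)) (z : T -> 'cV[R]_n) (z' : T -> 'cV[R]_m) :
  gvec z -> gvec z' -> mom (fun om => A *m z om) z' = A *m mom z z'.
Proof.
move=> hz hz'; apply/matrixP => i j; rewrite !mxE.
under [in LHS]eq_fun do rewrite mxE.
rewrite (ip_suml hX)//; last by move=> k; exact: gaussianZ.
by apply: eq_bigr => k _; rewrite (ipZl hX)// mxE.
Qed.

Lemma momDr n m (z1 z2 : T -> 'cV[R]_n) (z' : T -> 'cV[R]_m) :
  gvec z1 -> gvec z2 -> gvec z' ->
  mom z' (fun om => z1 om + z2 om) = mom z' z1 + mom z' z2.
Proof. by move=> *; rewrite -mom_tr momDl// linearD/= !mom_tr. Qed.

Lemma momBr n m (z1 z2 : T -> 'cV[R]_n) (z' : T -> 'cV[R]_m) :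
  gvec z1 -> gvec z2 -> gvec z' ->
  mom z' (fun om => z1 om - z2 om) = mom z' z1 - mom z' z2.
Proof. by move=> *; rewrite -mom_tr momBl// linearB/= !mom_tr. Qed.

Lemma momMr n m p (A : 'M[R]_(p, n)) (z : T -> 'cV[R]_n) (z' : T -> 'cV[R]_m) :
  gvec z -> gvec z' -> mom z' (fun om => A *m z om) = mom z' z *m A^T.
Proof. by move=> *; rewrite -mom_tr momMl// trmx_mul mom_tr. Qed.

Lemma mom0r n m (z : T -> 'cV[R]_n) : mom z (fun=> 0 : 'cV[R]_m) = 0.
Proof.
apply/matrixP => i j; rewrite !mxE /ip.
by rewrite -[RHS](Ex_cst P 0); apply: eq_Ex => om /=; rewrite mulr0.
Qed.

Lemma Ex_fnorm_sqr n (z : T -> 'cV[R]_n) : gvec z ->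
  integ P (fun om => fnorm (z om) ^+ 2) /\ Ex P (fun om => fnorm (z om) ^+ 2) = \tr (mom z z).
Proof.
move=> hz; have E : (fun om => fnorm (z om) ^+ 2) = (fun om => \sum_i z om i 0 ^+ 2).
  by apply/funext => om; rewrite fnorm_sqr_cV.
have iz i : integ P (fun om => z om i 0 ^+ 2) by exact: (gaussian_sqr hX).
rewrite E; split; first exact: integ_sum.
rewrite Ex_sum//; apply: eq_bigr => i _; rewrite mxE /ip.
by apply: eq_Ex => om; rewrite expr2.
Qed.

Lemma psdmx_mom n (z : T -> 'cV[R]_n) : gvec z -> psdmx (mom z z).
Proof.
move=> hz; split; first exact: mom_tr.
move=> u; have -> : u^T *m mom z z *m u = mom (fun om => u^T *m z om) (fun om => u^T *m z om).
  have h := gvecM u^T hz.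
  by rewrite momMl// momMr// trmxK mulmxA.
by rewrite mxE ip_ge0.
Qed.

Lemma covariance_gaussian f g : gaussian f -> gaussian g ->
  covariance P f g = (ip f g)%:E.
Proof.
move=> hf hg.
have Ef : 'E_P[f]%E = 0%E by rewrite unlock EFin_Ex ?(gaussian_mean hX)//; exact: (gaussian_integ hX).
have Eg : 'E_P[g]%E = 0%E by rewrite unlock EFin_Ex ?(gaussian_mean hX)//; exact: (gaussian_integ hX).
rewrite unlock Ef Eg /= unlock -EFin_Ex; last exact: (gaussian_prod hX).
apply: eq_integral => om _ /=; congr (_%:E).
by change ((f om - 0) * (g om - 0) = f om * g om); rewrite !subr0.
Qed.

Section State.
Context {n m : nat}.
(** The input u is kept general because the system driven by w and the filter driven by the
    innovations are both instances. *)
Variables (A : 'M[R]_n) (B : 'M[R]_(n, m)) (u : nat -> 'I_m -> {RV P >-> R}).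
Hypothesis gu : forall t i, gaussian (u t i).
Hypothesis white : forall t i s j, ip (u t i) (u s j) = ((t == s) && (i == j))%:R.

Lemma gvec_rvec k (z : 'I_k -> {RV P >-> R}) : (forall i, gaussian (z i)) -> gvec (rvec z).
Proof. by move=> hz i; under eq_fun do rewrite mxE. Qed.

Lemma mom_noise t s : mom (rvec (u t)) (rvec (u s)) = (t == s)%:R%:M.
Proof.
apply/matrixP => i j; rewrite !mxE.
have -> : ip (fun om => rvec (u t) om i 0) (fun om => rvec (u s) om j 0) = ip (u t i) (u s j).
  by congr (ip _ _); apply/funext => om; rewrite mxE.
by rewrite white; case: (t == s); case: (i == j).
Qed.

Lemma gvec_state t : gvec (state A B u t).
Proof.
elim: t => [|t IH] /=; first exact: gvec0.
by apply: gvecD; apply: gvecM => //; exact: gvec_rvec.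
Qed.

Lemma mom_state_orth k (z : T -> 'cV[R]_k) s : gvec z ->
  (forall r, (r < s)%N -> mom z (rvec (u r)) = 0) -> mom z (state A B u s) = 0.
Proof.
move=> hz; elim: s => [|s IH] orth; first exact: mom0r.
have gs := gvec_state s; have gr := gvec_rvec (gu s).
rewrite /= momDr//; [|exact: gvecM..].
rewrite !momMr// IH => [|r rs]; last by apply: orth; rewrite ltnS ltnW.
by rewrite orth// !mul0mx addr0.
Qed.

Let noise_state t s : (s <= t)%N -> mom (rvec (u t)) (state A B u s) = 0.
Proof.
move=> st; apply: mom_state_orth; first exact: gvec_rvec.
move=> r rs; rewrite mom_noise; case: eqP => [tr|_]; last by rewrite raddf0.
by move: rs; rewrite -tr ltnNge st.
Qed.

Definition scov t := mom (state A B u t) (state A B u t).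

Lemma scovS t : scov t.+1 = A *m scov t *m A^T + B *m B^T.
Proof.
have gs := gvec_state t; have gr := gvec_rvec (gu t).
have g1 := gvecM A gs; have g2 := gvecM B gr.
rewrite /scov /= momDl ?momDr//; try exact: gvecD.
rewrite !momMl ?momMr//; [|exact: gvecD..].
rewrite noise_state// -(mom_tr (rvec _)) noise_state// trmx0 mom_noise eqxx.
by rewrite !(mul0mx, mulmx0) addr0 add0r mul1mx mulmxA.
Qed.

Lemma mom_state_shift k s : mom (state A B u (s + k)) (state A B u s) = A ^+ k *m scov s.
Proof.
elim: k => [|k IH]; first by rewrite addn0 expr0 mul1mx.
have gs := gvec_state (s + k); have gr := gvec_rvec (gu (s + k)).
rewrite addnS /= momDl//; [|exact: gvecM|exact: gvecM|exact: gvec_state].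
rewrite !momMl//; [|exact: gvec_state..].
by rewrite IH noise_state ?leq_addr// mulmx0 addr0 exprS mulmxA.
Qed.

(** The deviation Sx - scov t solves the homogeneous recursion and starts at Sx, the initial state
    being 0. *)
Lemma scov_lyapunov (Sx : 'M[R]_n) t : Sx = A *m Sx *m A^T + B *m B^T ->
  scov t = Sx - A ^+ t *m Sx *m (A ^+ t)^T.
Proof.
move=> SxE; elim: t => [|t IH].
  rewrite expr0 trmx1 mulmx1 mul1mx subrr /scov /=; exact: mom0r.
rewrite scovS IH mulmxBr mulmxBl [X in _ = X - _]SxE.
have -> : A *m (A ^+ t *m Sx *m (A ^+ t)^T) *m A^T = A ^+ t.+1 *m Sx *m (A ^+ t.+1)^T.
  by rewrite exprS -[A * A ^+ t]/(A *m A ^+ t) trmx_mul !mulmxA.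
by rewrite addrAC.
Qed.

End State.

End VectorMoments.

(** * Entrywise limits and bounds of matrices *)

Section EntrywiseLimit.
Context {R : realType}.

Definition mcvg m n (M : nat -> 'M[R]_(m, n)) (L : 'M[R]_(m, n)) :=
  forall i j, M t i j @[t --> \oo] --> L i j.

Definition mbound m n (M : 'M[R]_(m, n)) (b : R) := forall i j, `|M i j| <= b.

Lemma mcvg_cst m n (L : 'M[R]_(m, n)) : mcvg (fun=> L) L.
Proof. by move=> i j; exact: cvg_cst. Qed.

Lemma cvg_sum_ord n (f : 'I_n -> nat -> R) (l : 'I_n -> R) :
  (forall k, f k t @[t --> \oo] --> l k) ->
  (\sum_k f k t) @[t --> \oo] --> \sum_k l k.
Proof.
move=> h; elim: n f l h => [|n IH] f l h.
  by under eq_cvg do rewrite big_ord0; rewrite big_ord0; exact: cvg_cst.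
under eq_cvg do rewrite big_ord_recl; rewrite big_ord_recl.
apply: cvgD; first exact: h.
by apply: (IH (fun k => f (lift ord0 k))) => k; exact: h.
Qed.

Lemma mcvgD m n (M N : nat -> 'M[R]_(m, n)) K L :
  mcvg M K -> mcvg N L -> mcvg (fun t => M t + N t) (K + L).
Proof.
by move=> hM hN i j; under eq_cvg do rewrite mxE; rewrite mxE; exact: cvgD.
Qed.

Lemma mcvgN m n (M : nat -> 'M[R]_(m, n)) K : mcvg M K -> mcvg (fun t => - M t) (- K).
Proof.
by move=> hM i j; under eq_cvg do rewrite mxE; rewrite mxE; exact: cvgN.
Qed.

Lemma mcvgM m n p (M : nat -> 'M[R]_(m, n)) (N : nat -> 'M[R]_(n, p)) K L :
  mcvg M K -> mcvg N L -> mcvg (fun t => M t *m N t) (K *m L).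
Proof.
move=> hM hN i j; under eq_cvg do rewrite mxE; rewrite mxE.
by apply: cvg_sum_ord => k; exact: cvgM.
Qed.

Lemma mcvg_tr m n (M : nat -> 'M[R]_(m, n)) K : mcvg M K -> mcvg (fun t => (M t)^T) K^T.
Proof. by move=> hM i j; under eq_cvg do rewrite mxE; rewrite mxE; exact: hM. Qed.

Lemma mcvg_shift m n (M : nat -> 'M[R]_(m, n)) K : mcvg M K -> mcvg (fun t => M t.+1) K.
Proof. by move=> hM i j; have := hM i j; rewrite -cvg_shiftS. Qed.

Lemma mcvg_unique m n (M : nat -> 'M[R]_(m, n)) K L : mcvg M K -> mcvg M L -> K = L.
Proof.
move=> hK hL; apply/matrixP => i j.
exact: (cvg_unique _ (hK i j) (hL i j)).
Qed.

Lemma mcvg_tr_mx n (M : nat -> 'M[R]_n) K : mcvg M K -> \tr (M t) @[t --> \oo] --> \tr K.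
Proof. by move=> hM; apply: cvg_sum_ord => i; exact: hM. Qed.

Lemma psdmx_lim n (M : nat -> 'M[R]_n) L : (forall t, psdmx (M t)) -> mcvg M L -> psdmx L.
Proof.
move=> pM hM; split.
  apply: (mcvg_unique (mcvg_tr hM)).
  by have -> : (fun t => (M t)^T) = M by apply/funext => t; case: (pM t).
move=> u; have h := mcvgM (mcvgM (mcvg_cst (L := u^T)) hM) (mcvg_cst (L := u)).
have h00 := h 0 0; rewrite -(cvg_lim _ h00)//.
apply: limr_ge; first by apply/cvg_ex; eexists; exact: h00.
by apply: nearW => t; have [_] := pM t; exact.
Qed.

Lemma mboundW m n (M : 'M[R]_(m, n)) b b' : b <= b' -> mbound M b -> mbound M b'.
Proof. by move=> bb' h i j; apply: le_trans (h i j) bb'. Qed.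

Lemma mbound_ex m n (M : 'M[R]_(m, n)) : exists2 b, 0 <= b & mbound M b.
Proof.
exists (\sum_i \sum_j `|M i j|); first by do 2 apply: sumr_ge0 => *.
move=> i j; rewrite (bigD1 i)//= (bigD1 j)//= -addrA lerDl addr_ge0//.
  exact: sumr_ge0.
by do 2 apply: sumr_ge0 => *.
Qed.

Lemma mboundD m n (M N : 'M[R]_(m, n)) a b :
  mbound M a -> mbound N b -> mbound (M + N) (a + b).
Proof. by move=> hM hN i j; rewrite mxE (le_trans (ler_normD _ _))// lerD. Qed.

Lemma mbound_tr m n (M : 'M[R]_(m, n)) a : mbound M a -> mbound M^T a.
Proof. by move=> hM i j; rewrite mxE. Qed.

Lemma mboundM m n p (M : 'M[R]_(m, n)) (N : 'M[R]_(n, p)) a b :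
  mbound M a -> mbound N b -> mbound (M *m N) (n%:R * (a * b)).
Proof.
move=> hM hN i j; rewrite mxE; apply: (le_trans (ler_norm_sum _ _ _)).
apply: (@le_trans _ _ (\sum_(k < n) a * b)).
  by apply: ler_sum => k _; rewrite normrM ler_pM.
by rewrite sumr_const card_ord mulr_natl.
Qed.

Lemma cvg_geometric_bound (f : nat -> R) (c kappa : R) : 0 < kappa -> kappa < 1 ->
  (forall t, `|f t| <= c * kappa ^+ t) -> f t @[t --> \oo] --> (0 : R).
Proof.
move=> k0 k1 h; apply/norm_cvg0P.
have g0 : (c * kappa ^+ t) @[t --> \oo] --> (0 : R).
  by apply: (@cvg_geometric R c kappa); rewrite ger0_norm// ltW.
apply: (@squeeze_cvgr _ _ _ _ (cst 0) (fun t => c * kappa ^+ t)) => //; last exact: cvg_cst.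
by apply: nearW => t; rewrite /= normr_ge0 h.
Qed.

End EntrywiseLimit.

(** * Covariances of the output process *)

Section OutputProcess.
Context {d : measure_display} {T : measurableType d} {R : realType}.
Variable P : probability T R.
Context {dx dy : nat}.
Variables (w : nat -> 'I_dx -> {RV P >-> R}) (v : nat -> 'I_dy -> {RV P >-> R}).
Hypothesis hwv : independent_white_noises w v.
Variables (A Bw : 'M[R]_dx) (C : 'M[R]_(dy, dx)) (Dv : 'M[R]_dy).

(** A single index for all scalar noises puts w and v in one Gaussian space. The body copies
    [independent_white_noises], so that [hwv] is the i.i.d. hypothesis by conversion. *)
Definition wv_noise (k : nat * ('I_dx + 'I_dy)) : {RV P >-> R} :=
  match k.2 with inl i => w k.1 i | inr j => v k.1 j end.

Notation X := wv_noise.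
Let hX : iid_std_normal X := hwv.
Notation ip := (ip P).
Notation mom := (mom P).
Notation gvec := (gvec X).
Notation y := (output A Bw C Dv w v).
Notation x := (state A Bw w).

Let gw t i : gaussian X (w t i). Proof. exact: (gaussianX X (t, inl i)). Qed.
Let gv t i : gaussian X (v t i). Proof. exact: (gaussianX X (t, inr i)). Qed.

Let white_w t i s j : ip (w t i) (w s j) = ((t == s) && (i == j))%:R.
Proof. exact: (ip_XX hX (t, inl i) (s, inl j)). Qed.

Let white_v t i s j : ip (v t i) (v s j) = ((t == s) && (i == j))%:R.
Proof. exact: (ip_XX hX (t, inr i) (s, inr j)). Qed.

Let gx t : gvec (x t). Proof. exact: gvec_state. Qed.
Let gvv t : gvec (rvec (v t)). Proof. exact: gvec_rvec. Qed.

Lemma gvec_output t : gvec (y t).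
Proof. by apply: gvecD; apply: gvecM. Qed.

Let v_state t s : mom (rvec (v t)) (x s) = 0.
Proof.
apply: (mom_state_orth hX) => // r _; apply/matrixP => i j; rewrite !mxE.
have -> : ip (fun om => rvec (v t) om i 0) (fun om => rvec (w r) om j 0) = ip (v t i) (w r j).
  by congr (ip _ _); apply/funext => om; rewrite mxE.
by rewrite (ip_XX hX (t, inr i) (r, inl j)) xpair_eqE andbF.
Qed.

Notation Pt := (scov A Bw w).

Lemma mom_output k s :
  mom (y (s + k)) (y s) = C *m A ^+ k *m Pt s *m C^T + (k == 0%N)%:R *: (Dv *m Dv^T).
Proof.
have g1 t : gvec (fun om => C *m x t om) by exact: gvecM.
have g2 t : gvec (fun om => Dv *m rvec (v t) om) by exact: gvecM.
rewrite /output (momDl hX)//; last exact: gvecD.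
rewrite !(momDr hX)// !(momMl hX)// !(momMr hX)//.
rewrite v_state -[mom (x _) (rvec _)]mom_tr v_state trmx0.
rewrite (mom_state_shift hX)// (mom_noise white_v).
rewrite !(mul0mx, mulmx0) addr0 add0r !mulmxA; congr (_ + _).
have -> : (s + k == s)%N = (k == 0)%N by rewrite -{2}[s]addn0 eqn_add2l.
by case: eqP => _; rewrite ?scale1r ?mulmx1// scale0r raddf0 mulmx0 mul0mx.
Qed.

Section Limits.
Variables (Sx : 'M[R]_dx) (kappa c : R).
Hypothesis SxE : Sx = A *m Sx *m A^T + Bw *m Bw^T.
Hypotheses (k0 : 0 < kappa) (k1 : kappa < 1) (c0 : 0 <= c).
Hypothesis Ak : forall k i j, `|(A ^+ k) i j| <= c * kappa ^+ k.

Lemma scov_cvg : mcvg Pt Sx.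
Proof.
have -> : Pt = (fun t => Sx - A ^+ t *m Sx *m (A ^+ t)^T).
  by apply/funext => t; exact: (scov_lyapunov hX).
rewrite -[X in mcvg _ X]subr0; apply: mcvgD; first exact: mcvg_cst.
apply: mcvgN.
have A0 : mcvg (fun t => A ^+ t) (0 : 'M[R]_dx).
  move=> i j; rewrite mxE; apply: (cvg_geometric_bound k0 k1) => t; exact: Ak.
have := mcvgM (mcvgM A0 (mcvg_cst (L := Sx))) (mcvg_tr A0).
by rewrite mul0mx mul0mx.
Qed.

Lemma scov_bound : exists2 b, 0 <= b & forall t, mbound (Pt t) b.
Proof.
have [b b0 Sb] := mbound_ex Sx.
exists (b + dx%:R * (dx%:R * (c * b) * c)).
  by rewrite addr_ge0// !mulr_ge0.
move=> t; rewrite (scov_lyapunov hX _ _ t SxE)//.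
apply: mboundD => // i j; rewrite mxE normrN; move: i j.
have Ac : mbound (A ^+ t) c.
  move=> i j; apply: (le_trans (Ak _ _ _)); rewrite ler_piMr//.
  by rewrite exprn_ile1// ltW.
by apply: mboundM; [exact: mboundM|exact: mbound_tr].
Qed.

Lemma mom_output0_cvg : mcvg (fun t => mom (y t) (y t)) (C *m Sx *m C^T + Dv *m Dv^T).
Proof.
have -> : (fun t => mom (y t) (y t)) = fun t => C *m Pt t *m C^T + Dv *m Dv^T.
  by apply/funext => t; have := mom_output 0 t; rewrite addn0 expr0 mulmx1 scale1r.
apply: mcvgD; last exact: mcvg_cst.
by apply: mcvgM; [apply: mcvgM; [exact: mcvg_cst|exact: scov_cvg]|exact: mcvg_cst].
Qed.

Lemma mom_outputS_cvg k :
  mcvg (fun t => mom (y (t + k.+1)) (y t)) (C *m A ^+ k.+1 *m Sx *m C^T).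
Proof.
have -> : (fun t => mom (y (t + k.+1)) (y t)) = fun t => C *m A ^+ k.+1 *m Pt t *m C^T.
  by apply/funext => t; rewrite mom_output scale0r addr0.
by apply: mcvgM; [apply: mcvgM; [exact: mcvg_cst|exact: scov_cvg]|exact: mcvg_cst].
Qed.

(** With truncated subtraction, (t - s) + (s - t) is |t - s|. At lag k the moment contains A^k
    between bounded factors, and the measurement noise contributes at lag 0 only. *)
Lemma mom_output_decay : exists2 b, 0 <= b &
  forall t s, mbound (mom (y t) (y s)) (b * kappa ^+ ((t - s) + (s - t))).
Proof.
have [b b0 Pb] := scov_bound; have [cb cb0 Cb] := mbound_ex C.
have [db db0 Db] := mbound_ex (Dv *m Dv^T).
pose B := dx%:R * (dx%:R * (dx%:R * (cb * c) * b) * cb) + db.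
have B0 : 0 <= B by rewrite addr_ge0// !mulr_ge0.
have shift k s : mbound (mom (y (s + k)) (y s)) (B * kappa ^+ k).
  have Ac : mbound (A ^+ k) (c * kappa ^+ k) by exact: Ak.
  rewrite mom_output mulrDl.
  have -> : dx%:R * (dx%:R * (dx%:R * (cb * c) * b) * cb) * kappa ^+ k =
    dx%:R * (dx%:R * (dx%:R * (cb * (c * kappa ^+ k)) * b) * cb) by ring.
  apply: mboundD; first by do ![apply: mboundM => //]; exact: mbound_tr.
  move=> i j; rewrite mxE; case: eqP => [->|_].
    by rewrite mul1r expr0 mulr1.
  by rewrite mul0r normr0 mulr_ge0// exprn_ge0// ltW.
exists B => // t s.
have [st|/ltnW ts] := leqP s t.
  by have := shift (t - s)%N s; rewrite subnKC// (eqP st) addn0.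
have := mbound_tr (shift (s - t)%N t); rewrite subnKC// mom_tr.
by rewrite (eqP ts) add0n.
Qed.

End Limits.

End OutputProcess.

(** * Time averages and geometric sums *)

Section Averages.
Context {R : realType}.

Lemma cesaro_from1 (u : nat -> R) (l : R) : u t @[t --> \oo] --> l ->
  (n%:R^-1 * \sum_(1 <= t < n.+1) u t) @[n --> \oo] --> l.
Proof.
move=> ul; rewrite -cvg_shiftS/=.
have u1 : (fun t => u t.+1) t @[t --> \oo] --> l by rewrite (cvg_shiftS u).
have -> : (fun n => n.+1%:R^-1 * \sum_(1 <= t < n.+2) u t) =
    arithmetic_mean (fun t => u t.+1).
  by apply/funext => n /=; rewrite big_add1.
exact: cesaro.
Qed.

(** The loss divides n + 1 terms by n; the surplus term u 0 / n tends to 0. *)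
Lemma cesaro_from0 (u : nat -> R) (l : R) : u t @[t --> \oo] --> l ->
  (n%:R^-1 * \sum_(0 <= t < n.+1) u t) @[n --> \oo] --> l.
Proof.
move=> ul.
have -> : (fun n => n%:R^-1 * \sum_(0 <= t < n.+1) u t) =
   (fun n => n%:R^-1 * u 0%N + n%:R^-1 * \sum_(1 <= t < n.+1) u t).
  by apply/funext => n; rewrite big_nat_recl// big_add1 mulrDr.
rewrite -[l]add0r; apply: cvgD; last exact: cesaro_from1.
rewrite -[X in _ --> X](mul0r (u 0%N)); apply: cvgM; last exact: cvg_cst.
by apply/gtr0_cvgV0; [exists 1%N => // n /=; rewrite ltr0n|exact: cvgr_idn].
Qed.

(** Two geometric series, one on each side of t. After multiplication by 1 - kappa, the part before
    t is at most kappa^(t - m) ([low]) and the whole at most 2 - kappa^e ([high]), bounds that are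
    stable under induction. *)
Lemma geometric_row_sum (kappa : R) t n : 0 < kappa -> kappa < 1 ->
  \sum_(0 <= s < n) kappa ^+ ((t - s) + (s - t)) <= 2 / (1 - kappa).
Proof.
move=> k0 k1; rewrite ler_pdivlMr ?subr_gt0//.
have pw e : 0 <= kappa ^+ e by rewrite exprn_ge0// ltW.
have low m : (m <= t)%N ->
    (\sum_(0 <= s < m) kappa ^+ ((t - s) + (s - t))) * (1 - kappa) <= kappa ^+ (t - m).
  elim: m => [|m IH] mt; first by rewrite big_nil mul0r.
  rewrite big_nat_recr//= mulrDl.
  have -> : (t - m + (m - t))%N = (t - m.+1).+1 by lia.
  have := IH (ltnW mt); have -> : (t - m)%N = (t - m.+1).+1 by lia.
  rewrite exprS; have := pw (t - m.+1)%N; set q := kappa ^+ _ => q0 h.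
  apply: (@le_trans _ _ (kappa * q + kappa * q * (1 - kappa))); first by rewrite lerD2r.
  have := mulr_ge0 q0 (sqr_ge0 (1 - kappa)); lra.
have high e : (\sum_(0 <= s < t + e) kappa ^+ ((t - s) + (s - t))) * (1 - kappa)
    <= 2 - kappa ^+ e.
  elim: e => [|e IH].
    by rewrite addn0 expr0; have := low t (leqnn t); rewrite subnn expr0; lra.
  rewrite addnS big_nat_recr//= mulrDl.
  have -> : (t - (t + e) + (t + e - t))%N = e by lia.
  rewrite exprS; set q := kappa ^+ e in IH *.
  lra.
have [nt|tn] := leqP n t.
  apply: le_trans (low n nt) _.
  have : kappa ^+ (t - n) <= 1 by rewrite exprn_ile1// ltW.
  lra.
have := high (n - t)%N; rewrite subnKC ?(ltnW tn)// => h; apply: le_trans h _.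
by rewrite lerBlDr lerDl.
Qed.

Lemma sqr_mean_le n (a : nat -> R) :
  (n%:R^-1 * \sum_(1 <= t < n.+1) a t) ^+ 2 <= n%:R^-1 * \sum_(1 <= t < n.+1) a t ^+ 2.
Proof.
case: n => [|n]; first by rewrite invr0 !mul0r expr0n.
rewrite !big_add1/= !big_mkord exprMn.
apply: (@le_trans _ _ (n.+1%:R^-1 ^+ 2 * (n.+1%:R * \sum_(i < n.+1) a i.+1 ^+ 2))).
  by rewrite ler_wpM2l ?sqr_ge0//; exact: (sqr_sum_le (fun i : 'I_n.+1 => a i.+1)).
by rewrite expr2 -!mulrA mulKf// pnatr_eq0.
Qed.

End Averages.

(** * Mean square of a time average of products *)

Section MeanProduct.
Context {d : measure_display} {T : measurableType d} {R : realType}.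
Variable P : probability T R.
Context {I : eqType}.
Variable X : I -> {RV P >-> R}.
Hypothesis hX : iid_std_normal X.
Notation ip := (ip P).
Variables (f g : nat -> T -> R) (b kappa : R).
Hypotheses (gf : forall t, gaussian X (f t)) (gg : forall t, gaussian X (g t)).
Hypotheses (b0 : 0 <= b) (k0 : 0 < kappa) (k1 : kappa < 1).
Hypothesis ff : forall t s, `|ip (f t) (f s)| <= b.
Hypothesis gf_b : forall t s, `|ip (g t) (f s)| <= b.
Hypothesis gg_b : forall t s, `|ip (g t) (g s)| <= b * kappa ^+ ((t - s) + (s - t)).
Hypothesis fg_b : forall t s, `|ip (f t) (g s)| <= b * kappa ^+ ((t - s) + (s - t)).
Hypothesis fg0 : ip (f t) (g t) @[t --> \oo] --> (0 : R).

Let mean n om := n%:R^-1 * \sum_(1 <= t < n.+1) f t om * g t om.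

Let meanE n om : mean n om ^+ 2 =
  \sum_(1 <= t < n.+1) \sum_(1 <= s < n.+1) n%:R^-1 ^+ 2 * (f t om * g t om * f s om * g s om).
Proof.
rewrite /mean exprMn expr2 [X in _ * X]mulr_suml mulr_sumr; apply: eq_bigr => t _.
rewrite mulr_sumr mulr_sumr; apply: eq_bigr => s _.
by rewrite !mulrA.
Qed.

Lemma integ_mean_sqr n : integ P (fun om => mean n om ^+ 2).
Proof.
under eq_fun do rewrite meanE.
apply: integ_sum => t; apply: integ_sum => s; apply: integZ.
exact: (gaussian_prod4 hX).
Qed.

Let Ex_mean n : Ex P (fun om => mean n om ^+ 2) =
  \sum_(1 <= t < n.+1) \sum_(1 <= s < n.+1) n%:R^-1 ^+ 2 *
   (ip (f t) (g t) * ip (f s) (g s) + ip (f t) (f s) * ip (g t) (g s)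
     + ip (f t) (g s) * ip (g t) (f s)).
Proof.
under [in LHS]eq_Ex do rewrite meanE.
have i4 t s : integ P (fun om => n%:R^-1 ^+ 2 * (f t om * g t om * f s om * g s om)).
  by apply: integZ; exact: (gaussian_prod4 hX).
rewrite Ex_sum => [|t]; last exact: integ_sum.
apply: eq_bigr => t _; rewrite Ex_sum//; apply: eq_bigr => s _.
by rewrite ExZ ?(isserlis hX)//; exact: (gaussian_prod4 hX).
Qed.

(** Isserlis splits the double sum into three. The first part is the square of the average of E (f t
    * g t), which tends to 0 by Cesaro. In each of the other two, one factor decays in |t - s| and
    the other is bounded, so a row sums to O(1) and the normalized total is O(1/n). *)
Lemma mean_product_cvg0 : Ex P (fun om => mean n om ^+ 2) @[n --> \oo] --> (0 : R).
Proof.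
pose r n := n%:R^-1 * \sum_(1 <= t < n.+1) ip (f t) (g t).
pose K := 2 * b ^+ 2 * (2 / (1 - kappa)).
have K0 : 0 <= K by rewrite !mulr_ge0 ?sqr_ge0// invr_ge0 subr_ge0 ltW.
have bound n : Ex P (fun om => mean n om ^+ 2) <= r n ^+ 2 + K * n%:R^-1.
  rewrite Ex_mean.
  apply: (@le_trans _ _ (\sum_(1 <= t < n.+1) \sum_(1 <= s < n.+1) (n%:R^-1 ^+ 2 *
     (ip (f t) (g t) * ip (f s) (g s)) + n%:R^-1 ^+ 2 * (2 * b ^+ 2)
       * kappa ^+ ((t - s) + (s - t))))).
    apply: ler_sum => t _; apply: ler_sum => s _.
    rewrite -mulrA -mulrDr ler_wpM2l ?sqr_ge0// -addrA lerD2l.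
    set q := kappa ^+ _.
    have q0 : 0 <= q by rewrite exprn_ge0// ltW.
    have h1 : ip (f t) (f s) * ip (g t) (g s) <= b * (b * q).
      by rewrite (le_trans (ler_norm _))// normrM ler_pM.
    have h2 : ip (f t) (g s) * ip (g t) (f s) <= (b * q) * b.
      by rewrite (le_trans (ler_norm _))// normrM ler_pM.
    have -> : 2 * b ^+ 2 * q = b * (b * q) + b * q * b by ring.
    exact: lerD.
  under eq_bigr do rewrite big_split/=.
  rewrite big_split/=; apply: lerD.
    rewrite le_eqVlt; apply/orP; left; apply/eqP.
    rewrite /r exprMn expr2 [X in _ = _ * X]mulr_suml mulr_sumr; apply: eq_bigr => t _.
    by rewrite !mulr_sumr; apply: eq_bigr => s _.
  apply: (@le_trans _ _ (\sum_(1 <= t < n.+1) n%:R^-1 ^+ 2 * K)).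
    apply: ler_sum => t _; rewrite -mulr_sumr -mulrA ler_wpM2l ?sqr_ge0//.
    rewrite /K ler_wpM2l ?mulr_ge0 ?sqr_ge0//.
    apply: le_trans (geometric_row_sum t n.+1 k0 k1).
    rewrite [leRHS]big_nat_recl// big_add1/= lerDr.
    by rewrite exprn_ge0// ltW.
  rewrite sumr_const_nat subSS subn0 -[leLHS]mulr_natr.
  case: n => [|n]; first by rewrite mulr0 invr0 mulr0.
  have N0 : n.+1%:R != 0 :> R by rewrite pnatr_eq0.
  move: (n.+1%:R : R) N0 => N N0.
  by rewrite le_eqVlt; apply/orP; left; apply/eqP; field.
apply: (@squeeze_cvgr _ _ _ _ (cst 0) (fun n => r n ^+ 2 + K * n%:R^-1)).
- apply: nearW => n; rewrite bound andbT.
  by apply: Rintegral_ge0 => om _; exact: sqr_ge0.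
- exact: cvg_cst.
- have r0 : r n @[n --> \oo] --> (0 : R) by exact: cesaro_from1.
  rewrite -[X in _ --> X]addr0; apply: cvgD.
    have -> : (fun n => r n ^+ 2) = (fun n => r n * r n) by apply/funext => n; rewrite expr2.
    have h := cvgM r0 r0. rewrite mul0r in h. exact: h.
  rewrite -[X in _ --> X](mulr0 K); apply: cvgM; first exact: cvg_cst.
  by apply/gtr0_cvgV0; [exists 1%N => // n /=; rewrite ltr0n|exact: cvgr_idn].
Qed.

End MeanProduct.

(** * Loss of a fixed predictor and residual of the reference predictor *)

Section PredictionError.
Context {d : measure_display} {T : measurableType d} {R : realType}.
Variable P : probability T R.
Context {dx dy : nat}.
Variables (w : nat -> 'I_dx -> {RV P >-> R}) (v : nat -> 'I_dy -> {RV P >-> R}).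
Hypothesis hwv : independent_white_noises w v.
Variables (A Bw : 'M[R]_dx) (C : 'M[R]_(dy, dx)) (Dv : 'M[R]_dy).
Variable H : nat.
Notation X := (wv_noise w v).
Let hX : iid_std_normal X := hwv.
Notation mom := (mom P).
Notation gvec := (gvec X).
Notation y := (output A Bw C Dv w v).
Variables (Sx : 'M[R]_dx) (kappa c : R).
Hypothesis SxE : Sx = A *m Sx *m A^T + Bw *m Bw^T.
Hypotheses (k0 : 0 < kappa) (k1 : kappa < 1) (c0 : 0 <= c).
Hypothesis Ak : forall k i j, `|(A ^+ k) i j| <= c * kappa ^+ k.
Let Sy := C *m Sx *m C^T + Dv *m Dv^T.
Let N i := C *m A ^+ i.+1 *m Sx *m C^T.

Notation F t := (fun om => @future R dy H (fun s => y s om) t).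
Let gy t : gvec (y t). Proof. exact: gvec_output. Qed.

Let momy_cvg := mom_output0_cvg hwv (C := C) (Dv := Dv) SxE k0 k1 Ak.
Let momyS_cvg := mom_outputS_cvg hwv (C := C) Dv SxE k0 k1 Ak.

Section Loss.
Variable G : 'M[R]_(\sum_(i < H) dy, dy).

Let res (i : 'I_H) t om := y (t + i.+1)%N om - submxcol G i *m y t om.

Let gres (i : 'I_H) t : gvec (res i t).
Proof. by apply: gvecB => //; exact: gvecM. Qed.

Let fnorm_res t om :
  fnorm (F t om - G *m y t om) ^+ 2 = \sum_(i < H) fnorm (res i t om) ^+ 2.
Proof.
rewrite /future -{1}(submxcolK G) mxcol_mul -mxcolB fnorm_sqr_mxcol.
by [].
Qed.

Let mom_res (i : 'I_H) : mcvg (fun t => mom (res i t) (res i t))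
  (Sy - submxcol G i *m (N i)^T - N i *m (submxcol G i)^T
   + submxcol G i *m Sy *m (submxcol G i)^T).
Proof.
set Gi := submxcol G i.
have -> : (fun t => mom (res i t) (res i t)) = (fun t =>
    mom (y (t + i.+1)) (y (t + i.+1)) - Gi *m (mom (y (t + i.+1)) (y t))^T
    - mom (y (t + i.+1)) (y t) *m Gi^T + Gi *m mom (y t) (y t) *m Gi^T).
  apply/funext => t.
  have gG : gvec (fun om => Gi *m y t om) by exact: gvecM.
  have gr := gres i t.
  rewrite (momBl hX (gy _) gG gr).
  rewrite !(momBr hX)// !(momMl hX)// !(momMr hX)// mom_tr.
  rewrite -/Gi !mulmxA.
  move: (mom (y (t + i.+1)) (y (t + i.+1))) (mom (y (t + i.+1)) (y t) *m Gi^T)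
    (Gi *m mom (y t) (y (t + i.+1))) (Gi *m mom (y t) (y t) *m Gi^T) => a b e f.
  by apply/matrixP => k l; rewrite !mxE; ring.
have cG m n (L : 'M[R]_(m, n)) := @mcvg_cst R m n L.
apply: mcvgD.
  apply: mcvgD.
    apply: mcvgD.
      by move=> a b; have := @momy_cvg a b; rewrite -(cvg_shiftn i.+1); exact.
    apply: mcvgN; apply: mcvgM; first exact: cG.
    by apply: mcvg_tr; exact: momyS_cvg.
  apply: mcvgN; apply: mcvgM; last exact: cG.
  exact: momyS_cvg.
apply: mcvgM; last exact: cG.
by apply: mcvgM; first exact: cG.
Qed.

Definition asymptotic_risk : R := \sum_(i < H)
  \tr (Sy - submxcol G i *m (N i)^T - N i *m (submxcol G i)^T
   + submxcol G i *m Sy *m (submxcol G i)^T).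

(** For a deterministic G, the expected error at time t is a trace of output moments; it converges,
    and its running average has the same limit. *)
Lemma lossE : loss P y G = asymptotic_risk%:E.
Proof.
have ires i t := Ex_fnorm_sqr hX (gres i t).
pose a t := \sum_(i < H) \tr (mom (res i t) (res i t)).
have aE n : ('E_P[(fun om => n%:R^-1 *
        \sum_(0 <= t < n.+1) fnorm (F t om - G *m y t om) ^+ 2)%R] =
     (n%:R^-1 * \sum_(0 <= t < n.+1) a t)%:E)%E.
  have isum t : integ P (fun om => \sum_(i < H) fnorm (res i t om) ^+ 2).
    by apply: integ_sum => i; case: (ires i t).
  have -> : (fun om => n%:R^-1 * \sum_(0 <= t < n.+1) fnorm (F t om - G *m y t om) ^+ 2) =
      (fun om => n%:R^-1 * \sum_(0 <= t < n.+1) \sum_(i < H) fnorm (res i t om) ^+ 2).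
    by apply/funext => om; under eq_bigr do rewrite fnorm_res.
  rewrite unlock EFin_Ex; last by apply: integZ; exact: integ_sum.
  rewrite ExZ; last exact: integ_sum.
  rewrite Ex_sum//; congr (_ * _)%:E; apply: eq_bigr => t _.
  rewrite Ex_sum => [|i]; last by case: (ires i t).
  by apply: eq_bigr => i _; case: (ires i t).
rewrite /loss; apply/cvg_lim => //.
under eq_cvg do rewrite aE.
apply: cvg_EFin; first exact: nearW.
apply: cesaro_from0; apply: cvg_sum_ord => i.
by apply: mcvg_tr_mx; exact: mom_res.
Qed.

End Loss.

Section Residual.
Variable Gs : 'M[R]_(\sum_(i < H) dy, dy).

Definition residual t om := F t om - Gs *m y t om.

Let futE t om a : F t om a 0 = y (t + (tagnat.sig1 a).+1)%N om (tagnat.sig2 a) 0.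
Proof. by rewrite mxE. Qed.

Let gfut t : gvec (F t).
Proof. by move=> a; under eq_fun do rewrite futE; exact: gy. Qed.

Let gGs t : gvec (fun om => Gs *m y t om). Proof. exact: gvecM. Qed.

Lemma gvec_residual t : gvec (residual t). Proof. exact: gvecB. Qed.

Let mom_fut n t (z : T -> 'cV[R]_n) a j : mom (F t) z a j =
  mom (y (t + (tagnat.sig1 a).+1)) z (tagnat.sig2 a) j.
Proof. by rewrite !mxE; congr (ip _ _ _); apply/funext => om; rewrite futE. Qed.

Let mom_res_y t s : mom (residual t) (y s) = mom (F t) (y s) - Gs *m mom (y t) (y s).
Proof. by rewrite (momBl hX)// (momMl hX). Qed.

(** A coordinate of the future at t is an output at a time from t + 1 to t + H, which costs at most
    a factor kappa^-H in the decay. Between two residuals, boundedness is enough for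
    [mean_product_cvg0]. *)
Lemma residual_bounds : exists2 b, 0 <= b &
  [/\ forall t s, mbound (mom (y t) (y s)) (b * kappa ^+ ((t - s) + (s - t))),
      forall t s, mbound (mom (residual t) (y s)) (b * kappa ^+ ((t - s) + (s - t)))
    & forall t s, mbound (mom (residual t) (residual s)) b].
Proof.
have [b b0 yb] := mom_output_decay hwv C Dv SxE k0 k1 c0 Ak.
have [g g0 Gb] := mbound_ex Gs.
have kH : 0 < kappa ^+ H by rewrite exprn_gt0.
have pw e : 0 <= kappa ^+ e by rewrite exprn_ge0// ltW.
have pw1 e : kappa ^+ e <= 1 by rewrite exprn_ile1// ltW.
pose b1 := b / kappa ^+ H + dy%:R * (g * b).
have b10 : 0 <= b1 by rewrite addr_ge0 ?divr_ge0 ?mulr_ge0// ltW.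
have fy t s : mbound (mom (F t) (y s)) (b / kappa ^+ H * kappa ^+ ((t - s) + (s - t))).
  move=> a j; rewrite mom_fut; apply: (le_trans (yb _ _ _ _)).
  rewrite -mulrA ler_wpM2l// mulrC ler_pdivlMr// -exprD.
  have aH := ltn_ord (tagnat.sig1 a).
  by rewrite ler_wiXn2l// ?ltW//; lia.
have ry t s : mbound (mom (residual t) (y s)) (b1 * kappa ^+ ((t - s) + (s - t))).
  rewrite mom_res_y /b1 mulrDl; apply: mboundD => // i j; rewrite mxE normrN.
  by rewrite -2!mulrA; apply: mboundM.
have rf t s : mbound (mom (residual t) (F s)) (b1 / kappa ^+ H).
  move=> i a; have -> : mom (residual t) (F s) i a =
      mom (residual t) (y (s + (tagnat.sig1 a).+1)) i (tagnat.sig2 a).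
    by rewrite -(mom_tr P (F s)) mxE mom_fut -(mom_tr P (residual t)) mxE.
  apply: (le_trans (ry _ _ _ _)); rewrite ler_wpM2l//.
  rewrite (le_trans (pw1 _))// -[leLHS]invr1 lef_pV2 ?posrE ?ltr01//.
exists (b1 + b + (b1 / kappa ^+ H + dy%:R * (b1 * g))).
  by rewrite !addr_ge0 ?divr_ge0 ?mulr_ge0// ltW.
have r0 : 0 <= b1 / kappa ^+ H by rewrite divr_ge0// ltW.
have r1 : 0 <= dy%:R * (b1 * g) by rewrite !mulr_ge0.
split=> t s.
- by apply: mboundW (yb t s); rewrite ler_wpM2r//; lra.
- by apply: mboundW (ry t s); rewrite ler_wpM2r//; lra.
- apply: (@mboundW _ _ _ _ (b1 / kappa ^+ H + dy%:R * (b1 * g))); first by lra.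
  have -> : mom (residual t) (residual s) =
      mom (residual t) (F s) - mom (residual t) (y s) *m Gs^T.
    by rewrite {2}/residual (momBr hX)//; [rewrite (momMr hX)//|]; exact: gvec_residual.
  apply: mboundD => // i j; rewrite mxE normrN; move: i j.
  apply: mboundM; last exact: mbound_tr.
  by apply: mboundW (ry t s); rewrite ler_piMr.
Qed.

(** The normal equations: block i of [Gs] is the stationary regression of y_(t+i+1) on y_t. *)
Hypothesis GsE : forall i : 'I_H, submxcol Gs i *m Sy = N i.

Lemma residual_orth : mcvg (fun t => mom (residual t) (y t)) 0.
Proof.
have -> : (fun t => mom (residual t) (y t)) = (fun t => mom (F t) (y t) - Gs *m mom (y t) (y t)).
  by apply/funext => t; rewrite mom_res_y.
have GSy : Gs *m Sy = \mxcol_(i < H) N i.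
  by rewrite -[in LHS](submxcolK Gs) mxcol_mul; apply/eq_mxcol => i; exact: GsE.
rewrite -[X in mcvg _ X](subrr (Gs *m Sy)); apply: mcvgD; last first.
  by apply: mcvgN; apply: mcvgM; [exact: mcvg_cst|exact: momy_cvg].
rewrite GSy => a j.
have -> : (\mxcol_(i < H) N i) a j = N (tagnat.sig1 a) (tagnat.sig2 a) j by rewrite mxE.
have -> : (fun t => mom (F t) (y t) a j) =
    (fun t => mom (y (t + (tagnat.sig1 a).+1)) (y t) (tagnat.sig2 a) j).
  by apply/funext => t; exact: mom_fut.
exact: momyS_cvg.
Qed.

End Residual.

End PredictionError.

(** * Measurability of determinants and cofactors *)

Section MeasurableMatrix.
Context {d : measure_display} {T : measurableType d} {R : realType}.

Lemma measurable_sum_cond (J : finType) (Q : pred J) (F : J -> T -> R) :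
  (forall i, Q i -> measurable_fun setT (F i)) ->
  measurable_fun setT (fun om => \sum_(i | Q i) F i om).
Proof.
move=> mF.
have -> : (fun om => \sum_(i | Q i) F i om) = (fun om => \sum_i (if Q i then F i om else 0)).
  by apply/funext => om; rewrite big_mkcond.
by apply: measurable_sum => i; case Qi: (Q i) => //; exact: mF.
Qed.

Lemma measurable_det n (Z : T -> 'M[R]_n) :
  (forall a c, measurable_fun setT (fun om => Z om a c)) ->
  measurable_fun setT (fun om => \det (Z om)).
Proof.
move=> mZ; rewrite /determinant.
apply: measurable_sum => s; apply: measurable_funM => //.
by apply: measurable_prod => i _; exact: mZ.
Qed.

(** Row i and column j are exempted, so the cofactor remains measurable when the noise of entry (i,
    j) is left out of the sigma-algebra. *)
Lemma measurable_cofactor n (Z : T -> 'M[R]_n) i j :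
  (forall a c, a != i -> c != j -> measurable_fun setT (fun om => Z om a c)) ->
  measurable_fun setT (fun om => cofactor (Z om) i j).
Proof.
move=> mZ; rewrite /cofactor; apply: measurable_funM => //.
apply: measurable_det => a c.
under eq_fun do rewrite !mxE.
by apply: mZ; rewrite eq_sym neq_lift.
Qed.

End MeasurableMatrix.

(** By Cramer, z_j = sum_i (z Z)_i (Z^-1)_ij, and a sum of nonnegative numbers is at most the square
    of the sum of their square roots. The roots are introduced because only moments of order 1/2 of
    the inverse will be available. *)
Lemma block_bound (R : realType) m (Z : 'M[R]_m) (z : 'rV[R]_m) j : \det Z != 0 ->
  z 0 j ^+ 2 <= (\sum_i ((z *m Z) 0 i) ^+ 2)
     * (\sum_i Num.sqrt `|cofactor Z j i / \det Z|) ^+ 4.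
Proof.
move=> detZ; set N := \sum_i _ ^+ 2; set s := \sum_i Num.sqrt _.
have N0 : 0 <= N by apply: sumr_ge0 => i _; exact: sqr_ge0.
have s0 : 0 <= s by apply: sumr_ge0 => i _; exact: sqrtr_ge0.
have zj : z 0 j = \sum_i (z *m Z) 0 i * (cofactor Z j i / \det Z).
  have /matrixP/(_ 0 j) := mulmxA z Z (\adj Z).
  rewrite mul_mx_adj mul_mx_scalar !mxE => h.
  apply: (mulfI detZ); rewrite h mulr_sumr; apply: eq_bigr => i _.
  by rewrite !mxE; field.
have h1 : `|z 0 j| <= Num.sqrt N * s ^+ 2.
  rewrite zj; apply: (le_trans (ler_norm_sum _ _ _)).
  apply: (@le_trans _ _ (Num.sqrt N * \sum_i `|cofactor Z j i / \det Z|)).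
    rewrite mulr_sumr; apply: ler_sum => i _; rewrite normrM ler_wpM2r//.
    rewrite -sqrtr_sqr ler_wsqrtr// /N (bigD1 i)//= lerDl.
    by apply: sumr_ge0 => k _; exact: sqr_ge0.
  rewrite ler_wpM2l ?sqrtr_ge0// expr2 /s mulr_suml; apply: ler_sum => i _.
  rewrite -[leLHS]sqr_sqrtr// expr2 ler_wpM2l ?sqrtr_ge0//.
  rewrite (bigD1 i)//= lerDl.
  by apply: sumr_ge0 => k _; exact: sqrtr_ge0.
rewrite -real_normK ?num_real//.
apply: (@le_trans _ _ ((Num.sqrt N * s ^+ 2) ^+ 2)).
  by rewrite ler_pXn2r ?nnegrE// mulr_ge0 ?sqrtr_ge0 ?exprn_ge0.
by rewrite exprMn sqr_sqrtr// -exprM.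
Qed.

(** * Negative moments of blocks of noisy samples *)

Section NegativeMoments.
Context {d : measure_display} {T : measurableType d} {R : realType}.
Variable P : probability T R.
Context {I : eqType}.
Variable X : I -> {RV P >-> R}.
Hypothesis hX : iid_std_normal X.
Notation N01 := (@normal_prob R 0 1).
Variables (m : nat) (key : nat -> 'I_m -> I).
Hypothesis key_inj : forall t j t' j', key t j = key t' j' -> t = t' /\ j = j'.
Variable M : nat -> 'I_m -> T -> R.
(** In use, X (key t j) is coordinate j of v_t, while M comes from the state, which is driven by w
    only; so M stays measurable when any one of these noises is removed. *)
Hypothesis mM : forall t j t' j',
  measurable_fun setT (M t j : without X (key t' j') -> R).

Definition noisy t j om := X (key t j) om + M t j om.

Lemma measurable_noisy_without t j t' j' : (t != t') || (j != j') ->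
  measurable_fun setT (noisy t j : without X (key t' j') -> R).
Proof.
move=> ne; apply: measurable_funD => //; apply: measurable_other.
by apply/eqP => /key_inj[tt' jj']; move: ne; rewrite tt' jj' !eqxx.
Qed.

Lemma peel_invsqrt k (F a : T -> R) : (forall om, 0 <= F om) ->
  measurable_fun setT (F : without X k -> R) ->
  measurable_fun setT (a : without X k -> R) ->
  (\int[P]_om (F om * invsqrt (X k om + a om))%:E <= 9%:E * \int[P]_om (F om)%:E)%E.
Proof.
move=> F0 mF ma.
pose G (z : measurableTypeR R * without X k) : \bar R :=
  (F z.2 * invsqrt (z.1 + a z.2))%:E.
have mG : measurable_fun setT G.
  apply/measurable_EFinP; apply: measurable_funM.
    by apply: (measurableT_comp mF); exact: measurable_snd.
  apply: (measurableT_comp measurable_invsqrt); apply: measurable_funD.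
    exact: measurable_fst.
  by apply: (measurableT_comp ma); exact: measurable_snd.
have mFT : measurable_fun setT F.
  by apply: (measurableT_comp mF); exact (@measurable_without _ _ _ P I X k).
have G0 z : (0 <= G z)%E by rewrite lee_fin mulr_ge0// invsqrt_ge0.
rewrite (@peel _ _ _ _ _ _ hX k G)//.
rewrite -ge0_integralZl//=; first last.
- by move=> om _; rewrite lee_fin.
- exact/measurable_EFinP.
apply: ge0_le_integral => //=.
- by move=> om _; apply: integral_ge0.
- have h := @measurable_fun_fubini_tonelli_G _ _ (measurableTypeR R) (without X k) R N01 G mG G0.
  exact (measurableT_comp h (@measurable_without _ _ _ P I X k)).
- by apply: emeasurable_funM => //; exact/measurable_EFinP.
move=> om _; rewrite /G /=.
under eq_integral do rewrite EFinM.
rewrite ge0_integralZl//=; first last.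
- by rewrite lee_fin.
- by move=> x _; rewrite lee_fin invsqrt_ge0.
- apply/measurable_EFinP; apply: (measurableT_comp measurable_invsqrt).
  exact: measurable_funD.
by rewrite muleC lee_wpmul2r ?lee_fin// normal_invsqrt_le.
Qed.

Lemma peel_neq0 k (a : T -> R) : measurable_fun setT (a : without X k -> R) ->
  {ae P, forall om, X k om + a om != 0}.
Proof.
move=> ma.
have mX : measurable_fun setT (fun om => X k om + a om).
  apply: measurable_funD => //.
  by apply: (measurableT_comp ma); exact (@measurable_without _ _ _ P I X k).
pose D (z : measurableTypeR R * without X k) : R := z.1 + a z.2.
have mD : measurable_fun setT D.
  apply: measurable_funD; first exact: measurable_fst.
  by apply: (measurableT_comp ma); exact: measurable_snd.
pose Z := [set z | D z = 0].
have mZ : measurable Z.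
  have := mD measurableT _ (@measurable_set1 R 0); rewrite setTI.
  exact.
pose G (z : measurableTypeR R * without X k) : \bar R := (\1_Z z)%:E.
have mG : measurable_fun setT G by apply/measurable_EFinP; exact: measurable_indic.
have G0 z : (0 <= G z)%E by rewrite lee_fin.
have mS : measurable [set om | X k om + a om = 0].
  by have := mX measurableT _ (@measurable_set1 R 0); rewrite setTI.
exists [set om | X k om + a om = 0]; split => //.
  have := @peel _ _ _ _ _ _ hX k G mG G0.
  have -> : (\int[P]_om G (X k om, om) = \int[P]_om (\1_[set om | X k om + a om = 0] om)%:E)%E.
    by apply: eq_integral => om _; rewrite /G !indicE.
  rewrite integral_indic// setIT => ->.
  apply: integral0_eq => om _.
  have -> : (\int[N01]_x G (x, om) = \int[N01]_x (\1_[set x | x + a om = 0]%R x)%:E)%E.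
    by apply: eq_integral => x _; rewrite /G !indicE.
  rewrite integral_indic ?setIT//; first exact: normal_prob_shift0.
  have : measurable_fun [set: R] (fun x => x + a om) by exact: measurable_funD.
  by move=> /(_ measurableT _ (@measurable_set1 R 0)); rewrite setTI.
by move=> om /= /negP; rewrite negbK => /eqP.
Qed.

Lemma measurable_noisy t j : measurable_fun setT (noisy t j).
Proof.
have h := @measurable_noisy_without t j t.+1 j.
have ne : (t != t.+1) || (j != j) by rewrite neq_ltn ltnSn.
exact (measurableT_comp (h ne) (@measurable_without _ _ _ P I X (key t.+1 j))).
Qed.

Definition block k (tau : 'I_k -> nat) (r : 'I_k -> 'I_m) om : 'M[R]_k :=
  \matrix_(a, c) noisy (tau c) (r a) om.

(** Along the first row, the determinant is (X + a) b, with b the leading minor, nonzero almost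
    everywhere by induction, and a free of X. Index maps tau and r are general because the minors of
    a block must have the same form. *)
Lemma det_block_neq0 k (tau : 'I_k -> nat) (r : 'I_k -> 'I_m) :
  injective tau -> injective r -> {ae P, forall om, \det (block tau r om) != 0}.
Proof.
elim: k => [|k IH] in tau r *.
  by move=> _ _; apply: nearW => om; rewrite det_mx00 oner_neq0.
move=> tau_inj r_inj.
pose tau' c := tau (lift ord0 c); pose r' a := r (lift ord0 a).
have tau'_inj : injective tau' by move=> i1 i2 /tau_inj/lift_inj.
have r'_inj : injective r' by move=> i1 i2 /r_inj/lift_inj.
set k0 := key (tau ord0) (r ord0).
pose b om := cofactor (block tau r om) ord0 ord0.
have bE om : b om = \det (block tau' r' om).
  rewrite /b /cofactor addn0 expr0 mul1r; congr (\det _).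
  by apply/matrixP => i j; rewrite !mxE.
pose rest om := \sum_(c < k.+1 | c != ord0)
  noisy (tau c) (r ord0) om * cofactor (block tau r om) ord0 c.
pose a om := M (tau ord0) (r ord0) om + rest om * (b om)^-1.
have mcof c : measurable_fun setT
    ((fun om => cofactor (block tau r om) ord0 c) : without X k0 -> R).
  apply: measurable_cofactor => i j i0 _.
  under eq_fun do rewrite mxE.
  by apply: measurable_noisy_without; rewrite orbC; apply/orP; left; rewrite (inj_eq r_inj).
have ma : measurable_fun setT (a : without X k0 -> R).
  apply: measurable_funD; first exact: mM.
  apply: measurable_funM; last exact: (measurableT_comp (@measurable_invr R) (mcof ord0)).
  apply: measurable_sum_cond => c c0; apply: measurable_funM => //.
  by apply: measurable_noisy_without; rewrite (inj_eq tau_inj) c0.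
have detE om : \det (block tau r om) =
    (X k0 om + M (tau ord0) (r ord0) om) * b om + rest om.
  rewrite (expand_det_row _ ord0) (bigD1 ord0)//= mxE; congr (_ + _).
  by apply: eq_bigr => c _; rewrite mxE.
apply: filterS2 (IH _ _ tau'_inj r'_inj) (peel_neq0 ma) => om.
rewrite -bE detE => b0 Xa.
have -> : (X k0 om + M (tau ord0) (r ord0) om) * b om + rest om = (X k0 om + a om) * b om.
  by rewrite /a; field.
by rewrite mulf_neq0.
Qed.

Definition blk (tau : 'I_m -> nat) om : 'M[R]_m := block tau id om.

(** [cofactor Z j i / \det Z] is entry (i, j) of the inverse: this is the factor of [block_bound]
    for coordinate j. *)
Definition bscore (tau : 'I_m -> nat) j om : R :=
  \sum_i Num.sqrt `|cofactor (blk tau om) j i / \det (blk tau om)|.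

Lemma bscore_ge0 tau j om : 0 <= bscore tau j om.
Proof. by apply: sumr_ge0 => i _; exact: sqrtr_ge0. Qed.

Lemma measurable_bscore_without k tau j :
  (forall i l, measurable_fun setT (noisy (tau i) l : without X k -> R)) ->
  measurable_fun setT (bscore tau j : without X k -> R).
Proof.
move=> h; apply: measurable_sum => i.
have mZ a c : measurable_fun setT ((fun om => blk tau om a c) : without X k -> R).
  have -> : (fun om => blk tau om a c) = noisy (tau c) a by apply/funext => om; rewrite mxE.
  exact: h.
apply: (measurableT_comp (@measurable_sqrtr R)); apply: measurableT_comp => //.
apply: measurable_funM; first by apply: measurable_cofactor => *; exact: mZ.
apply: (measurableT_comp (@measurable_invr R)); exact: measurable_det.
Qed.

Lemma measurable_bscore tau j : measurable_fun setT (bscore tau j).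
Proof.
apply: measurable_sum => i.
have mZ a c : measurable_fun setT (fun om => blk tau om a c).
  have -> : (fun om => blk tau om a c) = noisy (tau c) a by apply/funext => om; rewrite mxE.
  exact: measurable_noisy.
apply: (measurableT_comp (@measurable_sqrtr R)); apply: measurableT_comp => //.
apply: measurable_funM; first by apply: measurable_cofactor => *; exact: mZ.
apply: (measurableT_comp (@measurable_invr R)); exact: measurable_det.
Qed.

(** Expansion along row j gives det = u (X + a), so that u / det is 1 / (X + a): the cofactor
    disappears and a single fresh noise remains. When u = 0 the left side is 0. *)
Lemma bscore_term tau j i om (u := cofactor (blk tau om) j i)
    (a := M (tau i) j om + (\sum_(c | c != i) noisy (tau c) j om * cofactor (blk tau om) j c) / u) :
  Num.sqrt `|u / \det (blk tau om)| <= invsqrt (X (key (tau i) j) om + a).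
Proof.
have [u0|u0] := eqVneq u 0; first by rewrite u0 mul0r normr0 sqrtr0 invsqrt_ge0.
rewrite /invsqrt ler_wsqrtr//.
have -> : \det (blk tau om) = u * (X (key (tau i) j) om + a).
  rewrite (expand_det_row _ j) (bigD1 i)//= mxE -/u.
  rewrite (eq_bigr (fun c => noisy (tau c) j om * cofactor (blk tau om) j c)); last first.
    by move=> c _; rewrite mxE.
  by rewrite /a /noisy; field.
by rewrite invfM mulrA divff// mul1r.
Qed.

(** Each of the m terms is integrated against its own noise (tau i, j), at cost 9; F is unaffected
    since it involves none of these noises. *)
Lemma peel_bscore tau j (F : T -> R) : injective tau -> (forall om, 0 <= F om) ->
  (forall i, measurable_fun setT (F : without X (key (tau i) j) -> R)) ->
  measurable_fun setT F ->
  (\int[P]_om (F om * bscore tau j om)%:E <= (9 * m%:R)%:E * \int[P]_om (F om)%:E)%E.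
Proof.
move=> tau_inj F0 mF mFT.
pose c i om := cofactor (blk tau om) j i.
pose a i om := M (tau i) j om + (\sum_(l | l != i) noisy (tau l) j om * c l om) / c i om.
have mc i l : measurable_fun setT (c l : without X (key (tau i) j) -> R).
  apply: measurable_cofactor => u v uj _; under eq_fun do rewrite mxE.
  by apply: measurable_noisy_without; rewrite uj orbT.
have ma i : measurable_fun setT (a i : without X (key (tau i) j) -> R).
  apply: measurable_funD; first exact: mM.
  apply: measurable_funM; last exact: (measurableT_comp (@measurable_invr R) (mc i i)).
  apply: measurable_sum_cond => l li; apply: measurable_funM => //.
  by apply: measurable_noisy_without; rewrite (inj_eq tau_inj) li.
have mE i : measurable_fun setT (fun om => (F om * invsqrt (X (key (tau i) j) om + a i om))%:E).
  apply/measurable_EFinP; apply: measurable_funM => //.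
  apply: (measurableT_comp (@measurable_invsqrt R)); apply: measurable_funD => //.
  exact (measurableT_comp (ma i) (@measurable_without _ _ _ P I X (key (tau i) j))).
apply: (@le_trans _ _ (\int[P]_om (\sum_i (F om * invsqrt (X (key (tau i) j) om + a i om))%:E))%E).
  apply: ge0_le_integral => //=.
  - by move=> om _; rewrite lee_fin mulr_ge0 ?bscore_ge0.
  - apply/measurable_EFinP; apply: measurable_funM => //; exact: measurable_bscore.
  - exact: emeasurable_sum.
  - move=> om _; rewrite sumEFin lee_fin mulr_sumr; apply: ler_sum => i _.
    by rewrite ler_wpM2l//; exact: bscore_term.
rewrite ge0_integral_sum//; last by move=> i om _; rewrite lee_fin mulr_ge0// invsqrt_ge0.
apply: (@le_trans _ _ (\sum_(i < m) (9%:E * \int[P]_om (F om)%:E))%E).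
  by apply: lee_sum => i _; exact: peel_invsqrt.
have : (0 <= \int[P]_om (F om)%:E)%E by apply: integral_ge0 => om _; rewrite lee_fin.
case: (\int[P]_om (F om)%:E)%E => // [r|] r0.
  by rewrite -EFinM sumEFin lee_fin sumr_const card_ord -mulr_natr; lra.
(* When the integral of F is infinite, so is the right side, except for m = 0, where both sides are
   0 by the convention 0 * oo = 0. *)
case: m => [|m']; first by rewrite big_ord0 mulr0 mul0e.
have c0 : (0 < (9 * m'.+1%:R)%:E :> \bar R)%E by rewrite lte_fin mulr_gt0// ltr0n.
by rewrite [leRHS]gt0_muley ?leey.
Qed.

Section Groups.
Variables (Mb : nat) (tau : nat -> 'I_Mb.+1 -> 'I_m -> nat).
Hypothesis tau_inj : forall g b i g' b' i', tau g b i = tau g' b' i' ->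
  [/\ g = g', b = b' & i = i'].

(* A high power of one score need not be integrable, but a product of scores of
   distinct groups is, and it bounds the 16th power of the least of 16 scores. *)
Definition gscore g j om : R := Mb.+1%:R^-1 * \sum_b bscore (tau g b) j om.

Lemma gscore_ge0 g j om : 0 <= gscore g j om.
Proof. by rewrite mulr_ge0 ?invr_ge0// sumr_ge0// => b _; exact: bscore_ge0. Qed.

Lemma measurable_gscore g j : measurable_fun setT (gscore g j).
Proof.
by apply: measurable_funM => //; apply: measurable_sum => b; exact: measurable_bscore.
Qed.

(** The last group is integrated out first: the earlier factors use samples at other times and play
    the role of F in [peel_bscore]. *)
Lemma gscore_moment G j :
  (\int[P]_om (\prod_(g < G) gscore g j om)%:E <= ((9 * m%:R) ^+ G)%:E)%E.
Proof.
elim: G => [|G IH].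
  under eq_integral do rewrite big_ord0.
  by rewrite integral_cst//= probability_setT mule1 expr0.
pose F om := \prod_(g < G) gscore g j om.
have F0 om : 0 <= F om by apply: prodr_ge0 => g _; exact: gscore_ge0.
have mF : measurable_fun setT F by apply: measurable_prod => g _; exact: measurable_gscore.
have mFk b i : measurable_fun setT (F : without X (key (tau G b i) j) -> R).
  apply: measurable_prod => g _; apply: measurable_funM => //.
  apply: measurable_sum => b'; apply: measurable_bscore_without => i' l.
  apply: measurable_noisy_without; apply/orP; left; apply/eqP => /tau_inj[gG _ _].
  by have := ltn_ord g; rewrite gG ltnn.
have mFb b : measurable_fun setT (fun om => (F om * bscore (tau G b) j om)%:E).
  by apply/measurable_EFinP; apply: measurable_funM => //; exact: measurable_bscore.
have Fb0 b om : (0 <= (F om * bscore (tau G b) j om)%:E)%E.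
  by rewrite lee_fin mulr_ge0// bscore_ge0.
have -> : (\int[P]_om (\prod_(g < G.+1) gscore g j om)%:E =
    \int[P]_om (Mb.+1%:R^-1%:E * \sum_b (F om * bscore (tau G b) j om)%:E))%E.
  apply: eq_integral => om _; rewrite big_ord_recr/= sumEFin -EFinM; congr EFin.
  by rewrite /gscore -/(F om) mulrCA mulr_sumr.
have i0 : (0 <= Mb.+1%:R^-1%:E :> \bar R)%E by rewrite lee_fin invr_ge0.
rewrite ge0_integralZl//=; first last.
- by move=> om _; exact: sume_ge0.
- exact: emeasurable_sum.
rewrite ge0_integral_sum//.
apply: (@le_trans _ _ (Mb.+1%:R^-1%:E * \sum_(b < Mb.+1) ((9 * m%:R) ^+ G.+1)%:E)%E).
  apply: lee_wpmul2l => //; apply: lee_sum => b _.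
  apply: (le_trans (peel_bscore _ F0 _ mF)).
  - by move=> i i' /tau_inj[].
  - by move=> i; exact: mFk.
  - by rewrite exprS [leRHS]EFinM lee_wpmul2l// lee_fin mulr_ge0.
rewrite sumEFin -EFinM lee_fin sumr_const card_ord -[X in _ * X]mulr_natl mulrA.
by rewrite mulVf ?mul1r// pnatr_eq0.
Qed.

(** Each block satisfies z_j^2 / s_b^4 <= N_b. Summing over b, convexity replaces the scores by
    their average, so the energy grows linearly with the number of blocks. *)
Lemma gscore_bound g j om (z : 'rV[R]_m) :
  (forall b, \det (blk (tau g b) om) != 0) ->
  Mb.+1%:R * z 0 j ^+ 2 <= (\sum_b \sum_i ((z *m blk (tau g b) om) 0 i) ^+ 2)
     * gscore g j om ^+ 4.
Proof.
move=> det0.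
pose s b := bscore (tau g b) j om.
(* A zero score would turn [block_bound] at the j-th basis vector into 1 <= 0. *)
have spos b : 0 < s b.
  rewrite lt_neqAle bscore_ge0 andbT eq_sym; apply/eqP => sb0.
  have := block_bound (delta_mx 0 j) j (det0 b).
  rewrite -/(bscore (tau g b) j om) -/(s b) sb0 expr0n/= mulr0 mxE !eqxx/= expr1n.
  by rewrite leNgt ltr01.
set c := gscore g j om.
have cpos : 0 < c.
  rewrite mulr_gt0 ?invr_gt0// (bigD1 ord0)//= ltr_pwDl//; first exact: spos.
  by apply: sumr_ge0 => b _; exact: bscore_ge0.
pose N b := \sum_i ((z *m blk (tau g b) om) 0 i) ^+ 2.
have N0 b : 0 <= N b by apply: sumr_ge0 => i _; exact: sqr_ge0.
(* Tangent line of the convex function x^-4 at the average score. *)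
have tangent (x : R) : 0 < x -> 5 - 4 * (x / c) <= c ^+ 4 / x ^+ 4.
  move=> x0; have y0 : 0 < x / c by rewrite divr_gt0.
  have -> : c ^+ 4 / x ^+ 4 = ((x / c) ^+ 4)^-1 by rewrite expr_div_n invf_div.
  rewrite -[leRHS]div1r ler_pdivlMr ?exprn_gt0//.
  move: (x / c) y0 => y y0.
  suff : 0 <= (y - 1) ^+ 2 * (4 * y ^+ 3 + 3 * y ^+ 2 + 2 * y + 1).
    have -> : (y - 1) ^+ 2 * (4 * y ^+ 3 + 3 * y ^+ 2 + 2 * y + 1) = 1 - (5 - 4 * y) * y ^+ 4 by ring.
    by rewrite subr_ge0.
  rewrite mulr_ge0 ?sqr_ge0//.
  by rewrite !addr_ge0// !mulr_ge0// ?exprn_ge0// ltW.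
have Nb b : z 0 j ^+ 2 * (5 - 4 * (s b / c)) <= N b * c ^+ 4.
  apply: (@le_trans _ _ (z 0 j ^+ 2 * (c ^+ 4 / s b ^+ 4))).
    by rewrite ler_wpM2l ?sqr_ge0// tangent.
  rewrite mulrCA mulrC ler_wpM2r ?exprn_ge0 ?(ltW cpos)//.
  by rewrite ler_pdivrMr ?exprn_gt0//; exact: block_bound.
apply: (@le_trans _ _ (\sum_b z 0 j ^+ 2 * (5 - 4 * (s b / c)))); last first.
  by rewrite mulr_suml; apply: ler_sum => b _; exact: Nb.
rewrite -mulr_sumr big_split/= sumr_const card_ord sumrN -mulr_sumr -mulr_suml.
have -> : \sum_b s b = Mb.+1%:R * c by rewrite /c /gscore mulrA divff ?mul1r// pnatr_eq0.
rewrite mulrK ?unitfE ?gt_eqF// mulrC -[5 *+ _]mulr_natr.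
by have := sqr_ge0 (z 0 j); lra.
Qed.

End Groups.

End NegativeMoments.

(** * Auxiliary inequalities for sums, products and traces *)

Section Auxiliary.
Context {R : realType}.

Lemma ler_sum_inj (J K : finType) (h : J -> K) (a : K -> R) : injective h ->
  (forall k, 0 <= a k) -> \sum_j a (h j) <= \sum_k a k.
Proof.
move=> hinj a0.
have -> : \sum_j a (h j) = \sum_(k in imset h (mem predT)) a k.
  by rewrite big_imset/= => [|i j _ _]; [exact: eq_bigl|exact: hinj].
rewrite [leRHS](bigID (fun k => k \in imset h (mem predT)))/= lerDl.
by apply: sumr_ge0.
Qed.

Lemma exists_exprn_le_prod n (x : 'I_n.+1 -> R) : (forall i, 0 <= x i) ->
  exists i, x i ^+ n.+1 <= \prod_i x i.
Proof.
move=> x0; have [i _ xi] := arg_minP x (isT : xpredT ord0).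
exists i; rewrite -[X in _ ^+ X](card_ord n.+1) -prodr_const.
by apply: ler_prod => j _; rewrite x0 xi.
Qed.

Lemma mxtrace_mul_tr_le m n (U V : 'M[R]_(m, n)) :
  \tr (U *m V^T) <= 2^-1 * (fnorm U ^+ 2 + fnorm V ^+ 2).
Proof.
rewrite !fnorm_sqr -big_split/= mulr_sumr; apply: ler_sum => i _.
rewrite mxE -big_split/= mulr_sumr; apply: ler_sum => j _.
by rewrite mxE; have := sqr_ge0 (U i j - V i j); lra.
Qed.

Lemma mxtrace_congr_ge0 m n (U : 'M[R]_(m, n)) (M : 'M[R]_n) : psdmx M ->
  0 <= \tr (U *m M *m U^T).
Proof.
move=> pM; have [_ h] := psdmx_congr U pM.
apply: sumr_ge0 => i _; have := h (delta_mx i 0).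
have -> : (delta_mx i 0 : 'cV[R]_m)^T = delta_mx 0 i by rewrite trmx_delta.
rewrite -rowE -colE.
by rewrite !mxE.
Qed.

End Auxiliary.

(** * Integrability from almost sure bounds *)

Section Dominated.
Context {d : measure_display} {T : measurableType d} {R : realType}.
Variable P : probability T R.

Lemma integ_ae_dominated (f g : T -> R) : measurable_fun setT f -> integ P g ->
  (forall om, 0 <= f om) -> (forall om, 0 <= g om) ->
  {ae P, forall om, f om <= g om} -> integ P f /\ Ex P f <= Ex P g.
Proof.
move=> mf ig f0 g0 fg; have mg := integ_measurable ig.
have le : (\int[P]_om (f om)%:E <= \int[P]_om (g om)%:E)%E.
  apply: ae_ge0_le_integral => //.
  - by move=> om _; rewrite lee_fin.
  - exact/measurable_EFinP.
  - by move=> om _; rewrite lee_fin.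
  - exact/measurable_EFinP.
  - by apply: filterS fg => om h _; rewrite lee_fin.
have fi : integ P f.
  apply/integrableP; split; first exact/measurable_EFinP.
  under eq_integral => om _ do rewrite /= ger0_norm//.
  by rewrite (le_lt_trans le)// (EFin_Ex ig) ltry.
by split => //; move: le; rewrite !EFin_Ex// lee_fin.
Qed.

Lemma integ_le_cst (f : T -> R) (b : R) : measurable_fun setT f ->
  (forall om, 0 <= f om) -> (\int[P]_om (f om)%:E <= b%:E)%E ->
  integ P f /\ Ex P f <= b.
Proof.
move=> mf f0 le.
have fi : integ P f.
  apply/integrableP; split; first exact/measurable_EFinP.
  under eq_integral => om _ do rewrite /= ger0_norm//.
  by rewrite (le_lt_trans le)// ltry.
by split => //; move: le; rewrite EFin_Ex// lee_fin.
Qed.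

End Dominated.

(** * Arrangement of the samples into groups of blocks *)

Section Design.
Variables (m Mb : nat).

(* Time of the i-th sample of the b-th block of the g-th group. *)
Definition design (g : nat) (b : 'I_Mb.+1) (i : 'I_m) : nat :=
  ((g * Mb.+1 + b) * m.+1 + i).+1.

(** Two Euclidean divisions read g, b and i off the time. Blocks are spaced by m.+1, a nonzero
    divisor for every m. *)
Lemma design_inj g b i g' b' i' : design g b i = design g' b' i' ->
  [/\ g = g', b = b' & i = i'].
Proof.
have im : (i < m.+1)%N by apply: ltnW; rewrite ltnS; exact: ltn_ord.
have im' : (i' < m.+1)%N by apply: ltnW; rewrite ltnS; exact: ltn_ord.
move=> [] e.
have q : (g * Mb.+1 + b = g' * Mb.+1 + b')%N.
  by have := congr1 (divn^~ m.+1) e; rewrite !divnMDl// !divn_small// !addn0.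
have r : (i = i' :> nat)%N by move: e; rewrite q => /addnI.
have qg : g = g'.
  by have := congr1 (divn^~ Mb.+1) q; rewrite !divnMDl// !divn_small// !addn0.
have qb : (b = b' :> nat)%N by move: q; rewrite qg => /addnI.
by split => //; exact: val_inj.
Qed.

Lemma design_le G g b i : (g < G)%N -> (design g b i <= G * (Mb.+1 * m.+1))%N.
Proof.
move=> gG; rewrite /design mulnA.
have := ltn_ord b; have := ltn_ord i => im bM.
have h1 : (g * Mb.+1 + b < G * Mb.+1)%N.
  by apply: (@leq_trans (g.+1 * Mb.+1)); rewrite ?leq_mul2r ?gG ?orbT// mulSn addnC ltn_add2r.
apply: (@leq_trans ((g * Mb.+1 + b).+1 * m.+1)); last by rewrite leq_mul2r h1 orbT.
by rewrite mulSn addnC ltn_add2r ltnS ltnW.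
Qed.

End Design.

(** * Excitation of the data and the resulting error bound *)

Section Excitation.
Context {d : measure_display} {T : measurableType d} {R : realType}.
Variable P : probability T R.
Context {I : eqType}.
Variable X : I -> {RV P >-> R}.
Variables (m : nat) (key : nat -> 'I_m -> I) (M : nat -> 'I_m -> T -> R).
Variables (Mb n : nat).
Hypothesis nMb : (16 * (Mb.+1 * m.+1) <= n)%N.
Notation tau := (@design m Mb).
Notation gs := (gscore X key M tau).
Notation noisyv t om := (\col_j noisy X key M t j om).

Definition score_prod j om : R := \prod_(g < 16) gs g j om.

Variables (om : T).
Hypothesis det0 : forall (g : 'I_16) b, \det (blk X key M (tau g b) om) != 0.

(** The samples of a group are distinct times in 1..n, so their energy is a partial sum of the
    total. *)
Lemma group_energy (g : 'I_16) p (Z : 'M[R]_(p, m)) a :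
  \sum_b \sum_i (row a Z *m blk X key M (tau g b) om) 0 i ^+ 2 <=
  \sum_(1 <= t < n.+1) (Z *m noisyv t om) a 0 ^+ 2.
Proof.
have desn b i : ((tau g b i).-1 < n)%N.
  by apply: leq_trans nMb; rewrite /design /=; exact: design_le.
pose h (q : 'I_Mb.+1 * 'I_m) : 'I_n := Ordinal (desn q.1 q.2).
have hinj : injective h.
  move=> [b i] [b' i'] /(congr1 val)/= e.
  have [_ -> ->] := @design_inj m Mb g b i g b' i' (congr1 S e).
  by [].
rewrite big_add1 big_mkord pair_big/=.
apply: le_trans (ler_sum_inj (a := fun t : 'I_n => (Z *m noisyv t.+1 om) a 0 ^+ 2) hinj _); last first.
  by move=> t; exact: sqr_ge0.
apply: ler_sum => -[b i] _ /=; rewrite le_eqVlt; apply/orP; left; apply/eqP.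
by congr (_ ^+ 2); rewrite !mxE; apply: eq_bigr => j _; rewrite !mxE.
Qed.

(** For each column j, take a group g whose score is at most the geometric mean of the 16 scores,
    and s_j = score^4 from [gscore_bound]. Then s_j^4 = score^16 is at most the product, which has a
    finite mean. *)
Lemma excitation p (Z : 'M[R]_(p, m)) : exists s : 'I_m -> R,
  [/\ forall j, 0 <= s j, forall j, s j ^+ 4 <= score_prod j om
    & Mb.+1%:R * fnorm Z ^+ 2 <=
        (\sum_(1 <= t < n.+1) fnorm (Z *m noisyv t om) ^+ 2) * \sum_j s j].
Proof.
have gs0 (g : 'I_16) j : 0 <= gs g j om by exact: gscore_ge0.
have hg j := exists_exprn_le_prod (fun g => gs0 g j).
exists (fun j => gs (xchoose (hg j)) j om ^+ 4); split.
- by move=> j; rewrite exprn_ge0.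
- by move=> j; rewrite -exprM; exact: (xchooseP (hg j)).
rewrite fnorm_sqr exchange_big/= !mulr_sumr; apply: ler_sum => j _.
set g := xchoose (hg j).
rewrite mulr_sumr; under [X in _ <= X * _]eq_bigr do rewrite fnorm_sqr_cV.
rewrite exchange_big/= mulr_suml; apply: ler_sum => a _.
have := gscore_bound j (row a Z) (det0 g).
rewrite mxE => /le_trans; apply.
by rewrite ler_wpM2r ?exprn_ge0//; exact: group_energy.
Qed.

(** This is [ls_error_bound] with tau = (r / n) sum_j s_j. Excitation is applied to D Dv, and Dv^-1
    leads back to D; the 32 stems from n <= 32 (Mb + 1)(m + 1). The inequality 2ab <= a^2 + b^2
    finally separates the scores from the residual energy. *)
Lemma estimation_error p (Dv : 'M[R]_m) (eta : nat -> 'cV[R]_p) (y : nat -> 'cV[R]_m)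
    (D : 'M[R]_(p, m)) (K : R) (r := 32 * m.+1%:R * fnorm (invmx Dv) ^+ 2) : 0 < K ->
  Dv \in unitmx -> (forall t, y t = Dv *m noisyv t om) ->
  (n <= 32 * (Mb.+1 * m.+1))%N ->
  \sum_(1 <= t < n.+1) fnorm (eta t - D *m y t) ^+ 2 <= \sum_(1 <= t < n.+1) fnorm (eta t) ^+ 2 ->
  fnorm D ^+ 2 <=
    4 * K ^+ 2 * (\sum_i \sum_j (n%:R^-1 * \sum_(1 <= t < n.+1) eta t i 0 * y t j 0) ^+ 2)
    + 2 * r ^+ 2 / K * (m%:R ^+ 3 * (\sum_j score_prod j om)
        + n%:R^-1 * \sum_(1 <= t < n.+1) (fnorm (eta t) ^+ 2) ^+ 2).
Proof.
move=> K0 uD yE nM minD.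
have [s [s0 sp hs]] := excitation (D *m Dv).
have n0 : 0 < n%:R :> R by rewrite ltr0n; lia.
have M0 : 0 < Mb.+1%:R :> R by rewrite ltr0n.
pose W := \sum_(1 <= t < n.+1) fnorm (D *m y t) ^+ 2.
have WE : \sum_(1 <= t < n.+1) fnorm (D *m Dv *m noisyv t om) ^+ 2 = W.
  by apply: eq_bigr => t _; rewrite yE mulmxA.
rewrite WE in hs.
have W0 : 0 <= W by apply: sumr_ge0 => t _; exact: sqr_ge0.
pose s1 := \sum_j s j; have s10 : 0 <= s1 by exact: sumr_ge0.
have f0 : 0 <= fnorm (invmx Dv) ^+ 2 by exact: sqr_ge0.
have r0 : 0 <= r by rewrite /r; apply: mulr_ge0 => //; apply: mulr_ge0.
have Mn : n%:R <= 32 * m.+1%:R * Mb.+1%:R :> R.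
  by rewrite -!natrM ler_nat; move: nM; rewrite -!mulnA [(Mb.+1 * _)%N]mulnC.
have DW : fnorm D ^+ 2 <= (r / n%:R * s1) * W.
  apply: (@le_trans _ _ (fnorm (D *m Dv) ^+ 2 * fnorm (invmx Dv) ^+ 2)).
    by rewrite -[in leLHS](mulmxK uD D); exact: fnorm_sqr_mulmx.
  have h : fnorm (D *m Dv) ^+ 2 <= 32 * m.+1%:R / n%:R * (W * s1).
    rewrite mulrAC ler_pdivlMr// mulrC.
    apply: (@le_trans _ _ (32 * m.+1%:R * Mb.+1%:R * fnorm (D *m Dv) ^+ 2)).
      by rewrite ler_wpM2r ?sqr_ge0.
    by rewrite -[leLHS]mulrA ler_wpM2l ?mulr_ge0.
  apply: (le_trans (ler_wpM2r f0 h)); rewrite le_eqVlt; apply/orP; left; apply/eqP.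
  by rewrite /r; move: (n%:R^-1) (fnorm _ ^+ 2) => u v'; ring.
have tau0 : 0 <= r / n%:R * s1 by rewrite mulr_ge0// divr_ge0// ltW.
(* Since tau is of order 1/n, the truncation level is K/n; its square turns the sums Q into time
   averages. *)
have Kn0 : 0 < K / n%:R by rewrite divr_gt0.
apply: (le_trans (ls_error_bound minD tau0 Kn0 DW)); apply: lerD.
  rewrite le_eqVlt; apply/orP; left; apply/eqP.
  rewrite expr_div_n mulrA -mulrA; congr (_ * _); rewrite mulr_sumr.
  apply: eq_bigr => i _; rewrite mulr_sumr; apply: eq_bigr => j _.
  by rewrite exprMn exprVn.
set S := \sum_(1 <= t < n.+1) fnorm (eta t) ^+ 2.
have -> : 4 * (r / n%:R * s1) ^+ 2 * S / (K / n%:R) =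
    2 * r ^+ 2 / K * (2 * s1 ^+ 2 * (n%:R^-1 * S)).
  by move: (n%:R) S n0 => n' S' n0; field; rewrite !gt_eqF.
apply: ler_wpM2l; first by apply: divr_ge0; [apply: mulr_ge0 => //; exact: sqr_ge0|exact: ltW].
have h4 : s1 ^+ 4 <= m%:R ^+ 3 * \sum_j score_prod j om.
  apply: (le_trans (pow4_sum_le _)); rewrite ler_wpM2l ?exprn_ge0//.
  by apply: ler_sum => j _; exact: sp.
have hS := sqr_mean_le n (fun t => fnorm (eta t) ^+ 2).
apply: le_trans (lerD h4 hS); rewrite -/S.
have := sqr_ge0 (s1 ^+ 2 - n%:R^-1 * S).
have -> : s1 ^+ 4 = (s1 ^+ 2) ^+ 2 by rewrite -exprM.
by move: (s1 ^+ 2) (n%:R^-1 * S) => a b h; nra.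
Qed.

End Excitation.

(** * Mean-square consistency of the estimator *)

Section Consistency.
Context {d : measure_display} {T : measurableType d} {R : realType}.
Variable P : probability T R.
Context {dx dy : nat}.
Variables (w : nat -> 'I_dx -> {RV P >-> R}) (v : nat -> 'I_dy -> {RV P >-> R}).
Hypothesis hwv : independent_white_noises w v.
Variables (A Bw : 'M[R]_dx) (C : 'M[R]_(dy, dx)) (Dv : 'M[R]_dy).
Hypothesis uDv : Dv \in unitmx.
Notation X := (wv_noise w v).
Let hX : iid_std_normal X := hwv.
Notation y := (output A Bw C Dv w v).
Notation x := (state A Bw w).

Let key (t : nat) (j : 'I_dy) : nat * ('I_dx + 'I_dy) := (t, inr j).

Let key_inj t j t' j' : key t j = key t' j' -> t = t' /\ j = j'.
Proof. by move=> [-> ->]. Qed.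

(** Dv^-1 y_t is v_t plus this vector, which depends on w alone: the form required by [noisy]. *)
Definition scaled_signal t (j : 'I_dy) om := (invmx Dv *m (C *m x t om)) j 0.
Notation M := scaled_signal.

Let measurable_state t i k j :
  measurable_fun setT ((fun om => x t om i 0) : without X (key k j) -> R).
Proof.
elim: t i => [|t IH] i /=.
  have -> : (fun om : T => (0 : 'cV[R]_dx) i 0) = (fun=> 0) by apply/funext => om; rewrite mxE.
  exact: measurable_cst.
have -> : (fun om => (A *m x t om + Bw *m rvec (w t) om) i 0) =
    (fun om => (\sum_l A i l * x t om l 0) + \sum_l Bw i l * X (t, inl l) om).
  apply/funext => om; rewrite !mxE; congr (_ + _).
  by apply: eq_bigr => l _; rewrite mxE.
apply: measurable_funD; apply: measurable_sum => l; apply: measurable_funM => //.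
by apply: measurable_other; rewrite xpair_eqE andbF.
Qed.

Let mM t j t' j' : measurable_fun setT (M t j : without X (key t' j') -> R).
Proof.
have -> : M t j = (fun om => \sum_i (invmx Dv *m C) j i * x t om i 0).
  by apply/funext => om; rewrite /scaled_signal mulmxA mxE.
by apply: measurable_sum => i; apply: measurable_funM.
Qed.

Let yE t om : y t om = Dv *m (\col_j noisy X key M t j om).
Proof.
have -> : \col_j noisy X key M t j om = rvec (v t) om + invmx Dv *m (C *m x t om).
  apply/matrixP => i j; rewrite (ord1 j) [LHS]mxE [RHS]mxE; congr (_ + _).
  by rewrite mxE.
by rewrite /output mulmxDr mulmxA mulmxV// mul1mx addrC.
Qed.

Notation score Mb := (score_prod X key M Mb).

Let score_moment Mb j : integ P (score Mb j) /\ Ex P (score Mb j) <= (9 * dy%:R) ^+ 16.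
Proof.
apply: integ_le_cst.
- apply: measurable_prod => g _.
  exact (@measurable_gscore _ _ _ P _ X dy key key_inj M mM Mb (@design dy Mb) g j).
- by move=> om; apply: prodr_ge0 => g _; exact: gscore_ge0.
- exact: (gscore_moment hX key_inj mM (@design_inj dy Mb)).
Qed.

Let det0 Mb : {ae P, forall om (g : 'I_16) b,
  \det (blk X key M (@design dy Mb g b) om) != 0}.
Proof.
have h (g : 'I_16) b : {ae P, forall om, \det (blk X key M (@design dy Mb g b) om) != 0}.
  apply: (det_block_neq0 hX key_inj mM) => [i i' /design_inj[]//|i i'//].
apply: filter_forall => g; apply: filter_forall => b; exact: h.
Qed.

Variables (H : nat) (Sx : 'M[R]_dx) (kappa c : R).
Hypothesis SxE : Sx = A *m Sx *m A^T + Bw *m Bw^T.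
Hypotheses (k0 : 0 < kappa) (k1 : kappa < 1) (c0 : 0 <= c).
Hypothesis Ak : forall k i j, `|(A ^+ k) i j| <= c * kappa ^+ k.
Variable Gs : 'M[R]_(\sum_(i < H) dy, dy).
Hypothesis GsE : forall i : 'I_H, submxcol Gs i *m (C *m Sx *m C^T + Dv *m Dv^T) =
  C *m A ^+ i.+1 *m Sx *m C^T.
Variable Ghat : nat -> T -> 'M[R]_(\sum_(i < H) dy, dy).
Hypothesis mGhat : forall N i j, measurable_fun setT (fun om => Ghat N om i j).
Hypothesis hGhat : \forall N \near \oo,
  {ae P, forall om, is_multistep_predictor (fun t => y t om) N (Ghat N om)}.

Notation eta := (residual w v A Bw C Dv Gs).
Let p := (\sum_(i < H) dy)%N.
Let mean n (i : 'I_p) (j : 'I_dy) om :=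
  n%:R^-1 * \sum_(1 <= t < n.+1) eta t om i 0 * y t om j 0.

Let geta t i : gaussian X (fun om => eta t om i 0).
Proof. exact: gvec_residual. Qed.

Let gy t i : gaussian X (fun om => y t om i 0).
Proof. exact: gvec_output. Qed.

Let mean_cvg i j : Ex P (fun om => mean n i j om ^+ 2) @[n --> \oo] --> (0 : R).
Proof.
have [b b0 [yy ry rr]] := residual_bounds hwv C Dv SxE k0 k1 c0 Ak Gs.
have := @mean_product_cvg0 _ _ _ P _ X hX (fun t om => eta t om i 0) (fun t om => y t om j 0) b kappa.
apply => //.
- by move=> t s; have := rr t s i i; rewrite mxE.
- move=> t s; rewrite ipC; have := ry s t i j; rewrite mxE => /le_trans; apply.
  by rewrite ler_piMr// exprn_ile1// ltW.
- by move=> t s; have := yy t s j j; rewrite mxE.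
- by move=> t s; have := ry t s i j; rewrite mxE.
- have := @residual_orth _ _ _ P _ _ w v hwv A Bw C Dv H Sx kappa c SxE k0 k1 Ak Gs GsE i j.
  rewrite mxE; under eq_cvg do rewrite mxE.
  exact.
Qed.

Let integ_mean n i j : integ P (fun om => mean n i j om ^+ 2).
Proof. exact: (integ_mean_sqr hX). Qed.

Let eta4 : exists b, forall t i, Ex P (fun om => eta t om i 0 ^+ 4) <= b.
Proof.
have [b b0 [_ _ rr]] := residual_bounds hwv C Dv SxE k0 k1 c0 Ak Gs.
exists (3 * b ^+ 2) => t i; have [_ ->] := gaussian_pow4 hX (geta t i).
rewrite ler_wpM2l// ler_pXn2r// ?nnegrE ?ip_ge0//.
have := rr t t i i; rewrite mxE; apply: le_trans; exact: ler_norm.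
Qed.

Let r := 32 * dy.+1%:R * fnorm (invmx Dv) ^+ 2.

(** B depends on neither K nor N: it collects the score moments and a uniform bound on the fourth
    moments of the residual. Letting N grow first, then K, is therefore legitimate. *)
Let error_bound : exists2 B, 0 <= B & forall K, 0 < K -> \forall N \near \oo,
  integ P (fun om => fnorm (Ghat N om - Gs) ^+ 2) /\
  Ex P (fun om => fnorm (Ghat N om - Gs) ^+ 2) <=
    4 * K ^+ 2 * (\sum_i \sum_j Ex P (fun om => mean (N - H) i j om ^+ 2)) + B / K.
Proof.
have [b hb] := eta4.
pose B0 := dy%:R ^+ 3 * (\sum_(j < dy) (9 * dy%:R) ^+ 16) + p%:R * \sum_(i < p) `|b|.
have B00 : 0 <= B0.
  by rewrite addr_ge0// mulr_ge0 ?exprn_ge0// sumr_ge0// => *; rewrite exprn_ge0// mulr_ge0.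
exists (2 * r ^+ 2 * B0); first by rewrite mulr_ge0// mulr_ge0// sqr_ge0.
move=> K K0.
near=> N.
have : {ae P, forall om, is_multistep_predictor (fun t => y t om) N (Ghat N om)}.
  by near: N.
have : (16 * dy.+1 + H <= N)%N by near: N; exact: nbhs_infty_ge.
set n := (N - H)%N => NH hN.
(* The largest block number for which 16 groups fit into n samples; then n is at most twice the
   length used, hence 32. *)
pose Mb := (n %/ (16 * dy.+1)).-1.
have n16 : (16 * dy.+1 <= n)%N by rewrite /n leq_subRL; lia.
have MbE : Mb.+1 = (n %/ (16 * dy.+1))%N by rewrite prednK// divn_gt0.
have nM1 : (16 * (Mb.+1 * dy.+1) <= n)%N.
  by rewrite MbE mulnCA; exact: leq_divM.
have nM2 : (n <= 32 * (Mb.+1 * dy.+1))%N.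
  have := ltn_ceil n (isT : 0 < 16 * dy.+1)%N; rewrite -MbE; nia.
pose g om := 4 * K ^+ 2 * (\sum_i \sum_j mean n i j om ^+ 2) +
   2 * r ^+ 2 / K * (dy%:R ^+ 3 * (\sum_j score Mb j om) +
     n%:R^-1 * \sum_(1 <= t < n.+1) p%:R * \sum_i eta t om i 0 ^+ 4).
have i1 : integ P (fun om => \sum_i \sum_j mean n i j om ^+ 2).
  by apply: integ_sum => i; apply: integ_sum => j.
have i2 : integ P (fun om => \sum_j score Mb j om).
  by apply: integ_sum => j; have [] := score_moment Mb j.
have i3 t : integ P (fun om => \sum_i eta t om i 0 ^+ 4).
  by apply: integ_sum => i; have [] := gaussian_pow4 hX (geta t i).
have i4 t : integ P (fun om => p%:R * \sum_i eta t om i 0 ^+ 4) by exact: integZ.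
have i5 : integ P (fun om => \sum_(1 <= t < n.+1) p%:R * \sum_i eta t om i 0 ^+ 4).
  by apply: integ_sum.
have i6 : integ P (fun om => n%:R^-1 * \sum_(1 <= t < n.+1) p%:R * \sum_i eta t om i 0 ^+ 4).
  exact: integZ.
have i7 : integ P (fun om => dy%:R ^+ 3 * (\sum_j score Mb j om)) by exact: integZ.
have i8 := integD i7 i6.
have i9 := integZ (2 * r ^+ 2 / K) i8.
have i10 := integZ (4 * K ^+ 2) i1.
have ig : integ P g by exact: integD.
have Eg : Ex P g <= 4 * K ^+ 2 * (\sum_i \sum_j Ex P (fun om => mean n i j om ^+ 2))
    + 2 * r ^+ 2 * B0 / K.
  rewrite /g ExD// !ExZ// ExD//; apply: lerD.
    rewrite le_eqVlt Ex_sum; last by move=> i; exact: integ_sum.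
    apply/orP; left; apply/eqP; congr (_ * _); apply: eq_bigr => i _.
    by rewrite Ex_sum.
  rewrite mulrAC ler_pM2r ?invr_gt0// ler_wpM2l//; first by rewrite mulr_ge0// sqr_ge0.
  apply: lerD.
    rewrite ExZ// ler_wpM2l ?exprn_ge0// Ex_sum; last by move=> j; case: (score_moment Mb j).
    by apply: ler_sum => j _; case: (score_moment Mb j).
  have n0 : 0 < n%:R :> R by rewrite ltr0n; lia.
  rewrite ExZ// ler_pdivrMl// Ex_sum//.
  apply: (@le_trans _ _ (\sum_(1 <= t < n.+1) p%:R * \sum_(i < p) `|b|)); last first.
    rewrite big_const_nat iter_addr_0 subSS subn0 -[X in X <= _]mulr_natl; exact: lexx.
  apply: ler_sum => t _; rewrite ExZ// ler_wpM2l// Ex_sum.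
    by apply: ler_sum => i _; apply: le_trans (hb t i) (ler_norm b).
  by move=> i; case: (gaussian_pow4 hX (geta t i)).
suff [] : integ P (fun om => fnorm (Ghat N om - Gs) ^+ 2) /\
    Ex P (fun om => fnorm (Ghat N om - Gs) ^+ 2) <= Ex P g.
  by move=> h1 h2; split => //; exact: le_trans h2 Eg.
apply: integ_ae_dominated => //.
- have -> : (fun om => fnorm (Ghat N om - Gs) ^+ 2) =
      (fun om => \sum_i \sum_j (Ghat N om i j - Gs i j) ^+ 2).
    apply/funext => om; rewrite fnorm_sqr; apply: eq_bigr => i _.
    by apply: eq_bigr => j _; rewrite !mxE.
  apply: measurable_sum => i; apply: measurable_sum => j.
  by apply: measurable_funX; apply: measurable_funB.
- by move=> om; exact: sqr_ge0.
- move=> om; rewrite /g; apply: addr_ge0; apply: mulr_ge0.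
  + by apply: mulr_ge0 => //; exact: sqr_ge0.
  + by do 2 (apply: sumr_ge0 => ? _); exact: sqr_ge0.
  + by apply: divr_ge0; [apply: mulr_ge0 => //; exact: sqr_ge0|exact: ltW].
  + apply: addr_ge0; apply: mulr_ge0; rewrite ?exprn_ge0 ?invr_ge0//.
      apply: sumr_ge0 => j _; apply: prodr_ge0 => k _; exact: gscore_ge0.
    apply: sumr_ge0 => t _; apply: mulr_ge0 => //; apply: sumr_ge0 => i _.
    by rewrite exprn_even_ge0.
apply: filterS2 hN (det0 Mb) => om hmin hdet.
have hmin' : \sum_(1 <= t < n.+1) fnorm (eta t om - (Ghat N om - Gs) *m y t om) ^+ 2
    <= \sum_(1 <= t < n.+1) fnorm (eta t om) ^+ 2.
  have := hmin Gs; rewrite /empirical_risk -/n; apply: le_trans.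
  rewrite le_eqVlt; apply/orP; left; apply/eqP; apply: eq_bigr => t _.
  by rewrite /residual mulmxBl opprB addrA subrK.
apply: (le_trans (estimation_error nM1 hdet K0 uDv (fun t => yE t om) nM2 hmin')).
apply: lerD => //; apply: ler_wpM2l.
  by apply: divr_ge0; [apply: mulr_ge0 => //; exact: sqr_ge0|exact: ltW].
apply: lerD => //; apply: ler_wpM2l; first by rewrite invr_ge0.
apply: ler_sum => t _; rewrite fnorm_sqr_cV; apply: (le_trans (sqr_sum_le _)).
rewrite ler_wpM2l//; apply: ler_sum => i _.
by rewrite -exprM.
Unshelve. all: by end_near.
Qed.

Lemma estimator_consistent :
  (\forall N \near \oo, integ P (fun om => fnorm (Ghat N om - Gs) ^+ 2)) /\
  Ex P (fun om => fnorm (Ghat N om - Gs) ^+ 2) @[N --> \oo] --> (0 : R).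
Proof.
have [B B0 hB] := error_bound.
split; first by have := hB 1 ltr01; apply: filterS => N [].
pose q n := \sum_i \sum_j Ex P (fun om => mean n i j om ^+ 2).
have q0 : q n @[n --> \oo] --> (0 : R).
  have -> : (0 : R) = \sum_(i < p) \sum_(j < dy) 0.
    by rewrite big1// => i _; rewrite big1.
  by apply: cvg_sum_ord => i; apply: cvg_sum_ord => j; exact: mean_cvg.
have qH : q (N - H)%N @[N --> \oo] --> (0 : R).
  rewrite -(cvg_shiftn H) /=.
  by have -> : (fun N => q (N + H - H)%N) = q by apply/funext => N; rewrite addnK.
apply/cvgr0Pnorm_lt => eps eps0.
(* Chosen so that B/K < eps/2; the added 1 makes K positive and the inequality strict. *)
pose K := 2 * B / eps + 1.
have K0 : 0 < K by rewrite ltr_pwDr// divr_ge0 ?mulr_ge0// ltW.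
have BK : B / K < eps / 2.
  rewrite ltr_pdivrMr// /K mulrDr mulr1.
  have -> : eps / 2 * (2 * B / eps) = B by field; rewrite gt_eqF.
  by rewrite ltrDl divr_gt0.
have K20 : 0 < 4 * K ^+ 2 by rewrite mulr_gt0// exprn_gt0.
have e0 : 0 < eps / 2 / (4 * K ^+ 2) by rewrite divr_gt0// divr_gt0.
move/cvgr0Pnorm_lt : qH => /(_ _ e0) qH.
apply: filterS2 (hB K K0) qH => N [iN hN] qN.
have E0 : 0 <= Ex P (fun om => fnorm (Ghat N om - Gs) ^+ 2).
  by apply: Rintegral_ge0 => om _; exact: sqr_ge0.
rewrite ger0_norm//; apply: (le_lt_trans hN).
have : q (N - H)%N < eps / 2 / (4 * K ^+ 2) by apply: le_lt_trans qN; exact: ler_norm.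
rewrite ltr_pdivlMr// mulrC -/(q _) => h.
by rewrite -/(q (N - H)%N); lra.
Qed.

End Consistency.

(** * Stationary covariances as solutions of Lyapunov equations *)

Section StationaryCovariance.
Context {d : measure_display} {T : measurableType d} {R : realType}.
Variable P : probability T R.
Context {I : eqType}.
Variable X : I -> {RV P >-> R}.
Hypothesis hX : iid_std_normal X.

Lemma stationary_mom n (z : nat -> T -> 'cV[R]_n) Sigma :
  (forall t, gvec X (z t)) -> stationary_covariance P z Sigma ->
  mcvg (fun t => mom P (z t) (z t)) Sigma.
Proof.
move=> gz h i j; have := fine_cvg (h i j).
have -> : fine \o (fun t => covariance P (fun om => z t om i 0) (fun om => z t om j 0)) =
    (fun t => mom P (z t) (z t) i j).
  by apply/funext => t; rewrite /= (covariance_gaussian hX (gz t i) (gz t j)) mxE.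
exact.
Qed.

(** Both properties hold at finite times, the second as the recursion [scovS], and pass to the
    limit. *)
Lemma stationary_lyapunov n m (A : 'M[R]_n) (B : 'M[R]_(n, m)) (u : nat -> 'I_m -> {RV P >-> R})
    Sigma : (forall t i, gaussian X (u t i)) ->
  (forall t i s j, ip P (u t i) (u s j) = ((t == s) && (i == j))%:R) ->
  stationary_covariance P (state A B u) Sigma ->
  psdmx Sigma /\ Sigma = A *m Sigma *m A^T + B *m B^T.
Proof.
move=> gu white hS; have gs := gvec_state A B gu.
have cS := stationary_mom gs hS.
split.
  by apply: psdmx_lim cS => t; exact: (psdmx_mom hX).
apply: (mcvg_unique (mcvg_shift cS)).
have -> : (fun t => mom P (state A B u t.+1) (state A B u t.+1)) =
    (fun t => A *m mom P (state A B u t) (state A B u t) *m A^T + B *m B^T).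
  by apply/funext => t; exact: (scovS hX A B gu white).
apply: mcvgD; last exact: mcvg_cst.
by apply: mcvgM; [apply: mcvgM; [exact: mcvg_cst|exact: cS]|exact: mcvg_cst].
Qed.

End StationaryCovariance.

(** * Excess risk over the best linear predictor *)

Section ExcessRisk.
Context {R : realType} {p H : nat}.
Variable Y : 'M[R]_p.
Hypothesis psdY : psdmx Y.

Definition excess (D : 'M[R]_(\sum_(i < H) p, p)) : R :=
  \sum_(i < H) \tr (submxcol D i *m Y *m (submxcol D i)^T).

Lemma excess_ge0 D : 0 <= excess D.
Proof. by apply: sumr_ge0 => i _; exact: mxtrace_congr_ge0. Qed.

(** [mxtrace_mul_tr_le] with U = D_i Y and V = D_i, for each block D_i. *)
Lemma excess_le D : excess D <= 2^-1 * (fnorm Y ^+ 2 + 1) * fnorm D ^+ 2.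
Proof.
rewrite -[in leRHS](submxcolK D) fnorm_sqr_mxcol mulr_sumr; apply: ler_sum => i _.
apply: (le_trans (mxtrace_mul_tr_le _ _)); rewrite -mulrA ler_wpM2l ?invr_ge0//.
by rewrite mulrDl mul1r lerD2r [leRHS]mulrC; exact: fnorm_sqr_mulmx.
Qed.

Lemma measurable_excess d (T : measurableType d) (D : T -> 'M[R]_(\sum_(i < H) p, p)) :
  (forall i j, measurable_fun setT (fun om => D om i j)) ->
  measurable_fun setT (fun om => excess (D om)).
Proof.
move=> mD; apply: measurable_sum => i; apply: measurable_sum => k.
have mDi l : measurable_fun setT (fun om => submxcol (D om) i k l).
  by under eq_fun do rewrite mxE; exact: mD.
under eq_fun do rewrite mxE.
apply: measurable_sum => l; under eq_fun do rewrite [_^T _ _]mxE.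
apply: measurable_funM => //; under eq_fun do rewrite mxE.
by apply: measurable_sum => a; apply: measurable_funM.
Qed.

End ExcessRisk.

Theorem proposition3 (R : realType) (dx dy H : nat)
  (A Bw : 'M[R]_dx) (C : 'M[R]_(dy, dx)) (Dv : 'M[R]_dy)
  (hH : (1 <= H)%N)
  (hA : spectral_radius A < 1)
  (hobs : observable A C)
  (hctrb : controllable A Bw)
  (hDv : pdmx (Dv *m Dv^T))
  (* dataset rollout *)
  (d : measure_display) (T : measurableType d) (P : probability T R)
  (w : nat -> 'I_dx -> {RV P >-> R}) (v : nat -> 'I_dy -> {RV P >-> R})
  (hwv : independent_white_noises w v)
  (* evaluation rollout, on its own probability space *)
  (d' : measure_display) (T' : measurableType d') (P' : probability T' R)
  (w' : nat -> 'I_dx -> {RV P' >-> R}) (v' : nat -> 'I_dy -> {RV P' >-> R})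
  (hwv' : independent_white_noises w' v')
  (* innovations form *)
  (S : 'M[R]_dx) (hS : riccati_stabilizing A Bw C Dv S)
  (De : 'M[R]_dy) (hDe : is_sqrtmx (innovation_cov C Dv S) De)
  (d'' : measure_display) (T'' : measurableType d'') (P'' : probability T'' R)
  (e : nat -> 'I_dy -> {RV P'' >-> R}) (he : white_noise e)
  (Sigma_xhat : 'M[R]_dx)
  (hSigma_xhat :
     stationary_covariance P'' (state A (kalman_gain A C Dv S *m De) e) Sigma_xhat)
  (Sigma_y : 'M[R]_dy)
  (hSigma_y : stationary_covariance P (output A Bw C Dv w v) Sigma_y)
  (* multi-step least-squares predictor *)
  (Ghat : nat -> T -> 'M[R]_(\sum_(i < H) dy, dy))
  (mGhat : forall N i j, measurable_fun setT (fun om => Ghat N om i j))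
  (hGhat : \forall N \near \oo,
     {ae P, forall om,
       is_multistep_predictor (fun t => output A Bw C Dv w v t om) N (Ghat N om)}) :
  (fun N : nat =>
     (\int[P]_om loss P' (output A Bw C Dv w' v') (Ghat N om))%E) @ \oo -->
  (\tr (Phi H A C (kalman_gain A C Dv S)
        *m (Sigma_xhat - Sigma_xhat *m C^T *m invmx Sigma_y *m C *m Sigma_xhat)
        *m (Phi H A C (kalman_gain A C Dv S))^T)
   + fnorm (Gamma_e H A C (kalman_gain A C Dv S) De) ^+ 2)%:E.
Proof.
have [psdS ric _] := hS.
have [kappa [c [k0 k1 c0 Ak]]] := spectral_decay hA.
have [psdX lyap] := stationary_lyapunov he
  (fun t i => gaussianX (fun k : nat * 'I_dy => e k.1 k.2) (t, i))
  (fun t i s j => ip_XX he (t, i) (s, j)) hSigma_xhat.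
have [trX _] := psdX.
have SxE := state_cov_lyapunov hDv psdS ric hDe lyap.
set Sx := state_cov S Sigma_xhat in SxE.
(* [Sigma_y] is defined by the actual rollout and [output_cov] by the innovations form; they are
   limits of the same moments. *)
have SyE : Sigma_y = output_cov C Dv S Sigma_xhat.
  apply: (mcvg_unique (stationary_mom hwv (gvec_output w v A Bw C Dv) hSigma_y)).
  exact (@mom_output0_cvg _ _ _ P _ _ w v hwv A Bw C Dv Sx kappa c SxE k0 k1 Ak).
have psdSx : psdmx Sx.
  split=> [|u]; first by rewrite raddfD/= trX; case: psdS => ->.
  rewrite mulmxDr mulmxDl mxE addr_ge0//; [by case: psdX|by case: psdS].
have pdSy : pdmx Sigma_y.
  by rewrite SyE; apply: pdmxD hDv; exact: psdmx_congr.
have uSy := pdmx_unit pdSy.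
have psdSy : psdmx Sigma_y.
  case: pdSy => tr h; split=> // u; have [->|/h/ltW//] := eqVneq u 0.
  by rewrite mulmx0 mxE.
(* Dv is square, so it is invertible as soon as Dv Dv^T is. *)
have uDv : Dv \in unitmx by have := pdmx_unit hDv; rewrite unitmx_mul => /andP[].
pose Gs : 'M[R]_(\sum_(i < H) dy, dy) :=
  \mxcol_(i < H) (cross_cov A C S Sigma_xhat i *m invmx Sigma_y).
have GsE (i : 'I_H) : submxcol Gs i *m (C *m Sx *m C^T + Dv *m Dv^T) =
    C *m A ^+ i.+1 *m Sx *m C^T.
  by rewrite mxcolK -[X in _ *m X]SyE mulmxKV.
have [iG EG] := estimator_consistent hwv uDv SxE k0 k1 c0 Ak GsE mGhat hGhat.
rewrite SyE in uSy.
have := innovation_risk hDv psdS hDe lyap H trX uSy.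
rewrite -SyE => <-; rewrite SyE; set Lstar := \sum_(i < H) _.
(* [Lstar] is the loss of [Gs]. The evaluation rollout enters only through its limiting second
   moments, expressed by the same [Sx] as those of the data. *)
have lossE' G : loss P' (output A Bw C Dv w' v') G =
    (Lstar + excess Sigma_y (G - Gs))%:E.
  rewrite (lossE hwv' C Dv SxE k0 k1 Ak) /asymptotic_risk /Lstar /excess -big_split/=.
  congr EFin; apply: eq_bigr => i _.
  have := prediction_risk A hDv psdS i (submxcol G i) trX uSy.
  rewrite -SyE submxcolB mxcolK SyE; exact.
pose f N om := excess Sigma_y (Ghat N om - Gs).
have mf N : measurable_fun setT (f N).
  apply: measurable_excess => i j.
  have -> : (fun om => (Ghat N om - Gs) i j) = (fun om => Ghat N om i j - Gs i j).
    by apply/funext => om; rewrite !mxE.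
  exact: measurable_funB.
pose K := 2^-1 * (fnorm Sigma_y ^+ 2 + 1).
have f0 N om : 0 <= f N om by exact: excess_ge0.
have fK N om : f N om <= K * fnorm (Ghat N om - Gs) ^+ 2 by exact: excess_le.
have hf : \forall N \near \oo, integ P (f N) /\
    Ex P (f N) <= K * Ex P (fun om => fnorm (Ghat N om - Gs) ^+ 2).
  apply: filterS iG => N iN; have iKN := integZ K iN.
  have ifN : integ P (f N).
    by apply: (integ_dominated (mf N) iKN) => om; rewrite ger0_norm.
  by split=> //; rewrite -ExZ//; apply: le_Ex.
have E0 : Ex P (f N) @[N --> \oo] --> (0 : R).
  apply: (@squeeze_cvgr _ _ _ _ (cst 0)
    (fun N => K * Ex P (fun om => fnorm (Ghat N om - Gs) ^+ 2))).
  - apply: filterS hf => N [_ h]; rewrite h andbT.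
    by apply: Rintegral_ge0 => om _; exact: f0.
  - exact: cvg_cst.
  - by rewrite -[X in _ --> X](mulr0 K); apply: cvgM => //; exact: cvg_cst.
have EL : (fun N => (Lstar + Ex P (f N))%:E) @ \oo --> Lstar%:E.
  apply: cvg_EFin; first exact: nearW.
  by rewrite -[X in _ --> X]addr0; apply: cvgD => //; exact: cvg_cst.
(* The integral is identified with Lstar + Ex P (f N) only for N large, where the squared error of
   the estimator is integrable. *)
apply: cvg_trans EL; apply: near_eq_cvg.
apply: filterS hf => N [iN _].
under eq_integral do rewrite lossE'.
by rewrite (EFin_Ex (integD (integ_cst P Lstar) iN)) ExD//; [rewrite Ex_cst|exact: integ_cst].
Qed.
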